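(* $\mathsf{RCA_0}$ proves that $\mathrm{WO}(\omega_3)$ implies ISCT soundness; that is, over $\mathsf{RCA_0}$, if $\omega_3=\omega^{\omega^\omega}$ is well-ordered, then for every program $P$ and every safe ISCT description $\mathcal G$ of $P$, the program $P$ is terminating.
   Context: Work in second-order arithmetic; $\mathsf{RCA_0}$ is the base system ($\Delta^0_1$-comprehension and $\Sigma^0_1$-induction). Ordinal notations: the set $\mathcal E$ of notations below $\varepsilon_0$ is defined by: if $\alpha_0\ge\dots\ge\alpha_n$ are in $\mathcal E$ then $\omega^{\alpha_0}+\dots+\omega^{\alpha_n}\in\mathcal E$ (the empty sum is $0$); $\omega^{\alpha_0}+\dots+\omega^{\alpha_n}<\omega^{\beta_0}+\dots+\omega^{\beta_m}$ iff either $n<m$ and $\alpha_i=\beta_i$ for all $i\le n$, or there is $i\le\min\{n,m\}$ with $\alpha_j=\beta_j$ for $j<i$ and $\alpha_i<\beta_i$. Write $1=\omega^0$, $\omega=\omega^1$, $\omega_0(\alpha)=\alpha$, $\omega_{d+1}(\alpha)=\omega^{\omega_d(\alpha)}$, $\omega_d=\omega_d(1)$; so $\omega_3=\omega^{\omega^\omega}$. $\mathrm{WO}(\alpha)$ means: there is no infinite strictly decreasing sequence $\alpha>\beta_0>\beta_1>\dots$ in $\mathcal E$. Programs: a program $P$ is a finite list of defining equations $f(x_0,\dots,x_{n-1})=e^f$ with distinct function identifiers $f$ on the left ($e^f$ is the body of $f$, $\mathrm{Par}(f)=\{x_0,\dots,x_{n-1}\}$); the first one is the entry function. Arithmetic expressions: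 $a::=x\mid x+1\mid x-1\mid f(a,\dots,a)$, with $x$ a parameter and $f$ a function identifier of $P$ or a primitive operator; each primitive operator $f$ of arity $k$ has a fixed interpretation $[\![f]\!]:\mathbb N^k\to\mathbb N$. Boolean expressions: $b::=x=0\mid x=1\mid x<y\mid x\le y\mid b\wedge b\mid b\vee b\mid\neg b$. Expressions: $e::=a\mid \text{if } b\text{ then } e\text{ else } e$. Terms: $t::=u\mid f(t,\dots,t)$ with $u\in\mathbb N$. For an expression $e$ with parameters among $x_0,\dots,x_{n-1}$ and $\mathbf u\in\mathbb N^n$, the term $e(\mathbf u)$ is: $x_i(\mathbf u)=u_i$, $(x_i+1)(\mathbf u)=u_i+1$, $(x_i-1)(\mathbf u)=\max(u_i-1,0)$, $f(e_0,\dots,e_{k-1})(\mathbf u)=f(e_0(\mathbf u),\dots,e_{k-1}(\mathbf u))$, and $(\text{if } b\text{ then } e_0\text{ else } e_1)(\mathbf u)$ equals $e_0(\mathbf u)$ if $b$ holds at $\mathbf u$ and $e_1(\mathbf u)$ otherwise. A one-step reduction $t\to_P s$ replaces the leftmost subterm of $t$ of the form $f(\mathbf u)$ with $\mathbf u$ a tuple of numbers by $e^f(\mathbf u)$ if $f$ is a function identifier, or by the number $[\![f]\!](\mathbf u)$ if $f$ is a primitive operator. $\to_P^*$ is the reflexive transitive closure. $P$ terminates on $\mathbf u$ if $f_0(\mathbf u)\to_P^* v$ for some $v\in\mathbb N$, where $f_0$ is the entry function; $P$ is terminating if it terminates on every input. Calls: positions in an expression are finite sequences of naturals ($\langle\rangle$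 is the whole expression; $\langle i\rangle^\frown\tau$ is position $\tau$ inside the $i$-th argument of an application, or inside the then-branch ($i=0$) or else-branch ($i=1$) of a conditional); $e|_\tau$ is the subexpression at $\tau$. A call $\tau:f\to g$ is a position $\tau$ in $e^f$ such that $e^f|_\tau$ has the form $g(\dots)$ with $g$ a function identifier. State transition: $(f,\mathbf u)\xrightarrow{\tau}(g,\mathbf v)$ iff $e^f|_\tau(\mathbf u)=g(s_0,\dots,s_{k-1})$ and $s_i\to_P^* v_i$ for all $i$. Size-change graphs: a size-change graph $G:f\to g$ is a set of arcs, each either strict $x\xrightarrow{\downarrow}y$ or non-strict $x\xrightarrow{\Downarrow}y$, with $x\in\mathrm{Par}(f)$, $y\in\mathrm{Par}(g)$. $(f,\mathbf u)\xrightarrow{G}(g,\mathbf v)$ iff $u_x>v_y$ for every strict arc and $u_x\ge v_y$ for every non-strict arc. The composition $G;H:f\to h$ of $G:f\to g$ and $H:g\to h$ contains $x\xrightarrow{\downarrow}z$ iff for some $y$ there are arcs $x\to y\in G$ and $y\to z\in H$ at least one of which is strict, and contains $x\xrightarrow{\Downarrow}z$ iff for some $y$ both $x\xrightarrow{\Downarrow}y\in G$ and $y\xrightarrow{\Downarrow}z\in H$ and $x\xrightarrow{\downarrow}z$ is not in $G;H$. $G:f\to f$ is idempotent if $G;G=G$. A description $\mathcal G$ of $P$ assigns to each call $\tau:f\to g$ of $P$ a size-change graph $G_\tau:f\to g$; it is safe if $(f,\mathbf u)\xrightarrow{\tau}(g,\mathbf v)$ implies $(f,\mathbf u)\xrightarrow{G_\tau}(g,\mathbf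 v)$ for every call $\tau$. $\mathrm{cl}(\mathcal G)$ is the closure of its graphs under composition. $\mathcal G$ is ISCT if every idempotent $G\in\mathrm{cl}(\mathcal G)$ contains a strict arc $x\xrightarrow{\downarrow}x$. ISCT soundness is the statement: for every program $P$ and every safe ISCT description of $P$, $P$ is terminating. *)

(* Defs.v *)
From Stdlib Require Import List.
Import ListNotations.

(** Two-sorted first-order logic over the signature 0, 1, +, *, =, <, and
    membership of a number in a set.  De Bruijn indices, with separate index
    spaces for the number variables and for the set variables. *)

Inductive tm : Set :=
| tvar (i : nat)
| tzero
| tone
| tadd (s t : tm)
| tmul (s t : tm).

Inductive fm : Set :=
| Eq (s t : tm)
| Lt (s t : tm)
| Mem (t : tm) (X : nat)
| Bot
| Imp (p q : fm)
| And (p q : fm)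
| Or (p q : fm)
| All1 (p : fm)
| Ex1 (p : fm)
| All2 (p : fm)
| Ex2 (p : fm).

Definition Iff (p q : fm) : fm := And (Imp p q) (Imp q p).

Definition scons {A : Type} (a : A) (f : nat -> A) (i : nat) : A :=
  match i with 0 => a | S j => f j end.

Fixpoint tsub (s : nat -> tm) (t : tm) : tm :=
  match t with
  | tvar i => s i
  | tzero => tzero
  | tone => tone
  | tadd a b => tadd (tsub s a) (tsub s b)
  | tmul a b => tmul (tsub s a) (tsub s b)
  end.

Definition tshift : tm -> tm := tsub (fun i => tvar (S i)).

(** Simultaneous substitution of terms for number variables and of set
    variables for set variables (variables are the only terms of sort set). *)
Fixpoint fsub (s : nat -> tm) (r : nat -> nat) (p : fm) : fm :=
  match p with
  | Eq a b => Eq (tsub s a) (tsub s b)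
  | Lt a b => Lt (tsub s a) (tsub s b)
  | Mem a X => Mem (tsub s a) (r X)
  | Bot => Bot
  | Imp a b => Imp (fsub s r a) (fsub s r b)
  | And a b => And (fsub s r a) (fsub s r b)
  | Or a b => Or (fsub s r a) (fsub s r b)
  | All1 a => All1 (fsub (scons (tvar 0) (fun i => tshift (s i))) r a)
  | Ex1 a => Ex1 (fsub (scons (tvar 0) (fun i => tshift (s i))) r a)
  | All2 a => All2 (fsub s (scons 0 (fun i => S (r i))) a)
  | Ex2 a => Ex2 (fsub s (scons 0 (fun i => S (r i))) a)
  end.

Definition shift1 : fm -> fm := fsub (fun i => tvar (S i)) (fun X => X).
Definition shift2 : fm -> fm := fsub tvar S.
Definition inst1 (t : tm) : fm -> fm := fsub (scons t tvar) (fun X => X).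
Definition inst2 (X : nat) : fm -> fm := fsub tvar (scons X (fun Y => Y)).

(** Classical natural deduction from the axioms [T].  The free variables of an
    axiom are read universally: it may be used in any context, hence
    generalized. *)
Inductive prv (T : fm -> Prop) : list fm -> fm -> Prop :=
| prv_ax G p : T p -> prv T G p
| prv_hyp G p : In p G -> prv T G p
| prv_impI G p q : prv T (p :: G) q -> prv T G (Imp p q)
| prv_impE G p q : prv T G (Imp p q) -> prv T G p -> prv T G q
| prv_andI G p q : prv T G p -> prv T G q -> prv T G (And p q)
| prv_andE1 G p q : prv T G (And p q) -> prv T G p
| prv_andE2 G p q : prv T G (And p q) -> prv T G q
| prv_orI1 G p q : prv T G p -> prv T G (Or p q)
| prv_orI2 G p q : prv T G q -> prv T G (Or p q)
| prv_orE G p q c :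
    prv T G (Or p q) -> prv T (p :: G) c -> prv T (q :: G) c -> prv T G c
| prv_raa G p : prv T (Imp p Bot :: G) Bot -> prv T G p
| prv_all1I G p : prv T (map shift1 G) p -> prv T G (All1 p)
| prv_all1E G p t : prv T G (All1 p) -> prv T G (inst1 t p)
| prv_ex1I G p t : prv T G (inst1 t p) -> prv T G (Ex1 p)
| prv_ex1E G p c :
    prv T G (Ex1 p) -> prv T (p :: map shift1 G) (shift1 c) -> prv T G c
| prv_all2I G p : prv T (map shift2 G) p -> prv T G (All2 p)
| prv_all2E G p X : prv T G (All2 p) -> prv T G (inst2 X p)
| prv_ex2I G p X : prv T G (inst2 X p) -> prv T G (Ex2 p)
| prv_ex2E G p c :
    prv T G (Ex2 p) -> prv T (p :: map shift2 G) (shift2 c) -> prv T G c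
| prv_eqI G t : prv T G (Eq t t)
| prv_eqE G p s t :
    prv T G (Eq s t) -> prv T G (inst1 s p) -> prv T G (inst1 t p).

Definition provable (T : fm -> Prop) (p : fm) : Prop := prv T [] p.

(** A [form] is a formula awaiting the numbers of number binders and of set
    binders above it; likewise an [nterm] awaits the number of number binders
    and an [sterm] the number of set binders.  The variable bound under [n]
    binders has, under [n'] binders, the de Bruijn index [n' - S n]. *)

Definition nterm : Type := nat -> tm.
Definition sterm : Type := nat -> nat.
Definition form : Type := nat -> nat -> fm.

Definition sentence (p : form) : fm := p 0 0.

Definition f_eq (a b : nterm) : form := fun n _ => Eq (a n) (b n).
Definition f_lt (a b : nterm) : form := fun n _ => Lt (a n) (b n).
Definition f_in (a : nterm) (X : sterm) : form := fun n m => Mem (a n) (X m).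
Definition f_bot : form := fun _ _ => Bot.
Definition f_imp (p q : form) : form := fun n m => Imp (p n m) (q n m).
Definition f_and (p q : form) : form := fun n m => And (p n m) (q n m).
Definition f_or (p q : form) : form := fun n m => Or (p n m) (q n m).
Definition f_not (p : form) : form := f_imp p f_bot.
Definition f_iff (p q : form) : form := f_and (f_imp p q) (f_imp q p).
Definition f_all1 (p : nterm -> form) : form :=
  fun n m => All1 (p (fun n' => tvar (n' - S n)) (S n) m).
Definition f_ex1 (p : nterm -> form) : form :=
  fun n m => Ex1 (p (fun n' => tvar (n' - S n)) (S n) m).
Definition f_all2 (p : sterm -> form) : form :=
  fun n m => All2 (p (fun m' => m' - S m) n (S m)).
Definition f_ex2 (p : sterm -> form) : form :=
  fun n m => Ex2 (p (fun m' => m' - S m) n (S m)).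
Definition f_ball (t : nterm) (p : nterm -> form) : form :=
  f_all1 (fun x => f_imp (f_lt x t) (p x)).
Definition f_bex (t : nterm) (p : nterm -> form) : form :=
  f_ex1 (fun x => f_and (f_lt x t) (p x)).

Definition t_zero : nterm := fun _ => tzero.
Definition t_one : nterm := fun _ => tone.
Definition t_add (a b : nterm) : nterm := fun n => tadd (a n) (b n).
Definition t_mul (a b : nterm) : nterm := fun n => tmul (a n) (b n).

Fixpoint lit (k : nat) : nterm :=
  match k with
  | 0 => t_zero
  | 1 => t_one
  | S k' => t_add (lit k') t_one
  end.

Declare Scope num_scope.
Delimit Scope num_scope with num.
Bind Scope num_scope with nterm.
Declare Scope so_scope.
Delimit Scope so_scope with so.
Bind Scope so_scope with form.

Notation "0" := t_zero : num_scope.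
Notation "1" := t_one : num_scope.
Notation "a + b" := (t_add a b) : num_scope.
Notation "a * b" := (t_mul a b) : num_scope.

(** Simpson's pairing function: (a + b)^2 + a. *)
Definition t_pair (a b : nterm) : nterm := ((a + b) * (a + b) + a)%num.
Notation "⟨ a , b ⟩" := (t_pair a b) (at level 0, a at level 99, b at level 99)
  : num_scope.

Notation "a = b" := (f_eq a%num b%num) : so_scope.
Notation "a < b" := (f_lt a%num b%num) : so_scope.
Notation "p -> q" := (f_imp p%so q%so) : so_scope.
Notation "p <-> q" := (f_iff p%so q%so) : so_scope.
Notation "p /\ q" := (f_and p%so q%so) : so_scope.
Notation "p \/ q" := (f_or p%so q%so) : so_scope.
Notation "~ p" := (f_not p%so) : so_scope.
Notation "'ALL' x .. y , p" :=
  (f_all1 (fun x => .. (f_all1 (fun y => p%so)) ..))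
  (at level 200, x binder, y binder, right associativity) : so_scope.
Notation "'EX' x .. y , p" :=
  (f_ex1 (fun x => .. (f_ex1 (fun y => p%so)) ..))
  (at level 200, x binder, y binder, right associativity) : so_scope.
Notation "'ALLB' x < t , p" := (f_ball t%num (fun x => p%so))
  (at level 200, x name, t at level 69, right associativity) : so_scope.
Notation "'EXB' x < t , p" := (f_bex t%num (fun x => p%so))
  (at level 200, x name, t at level 69, right associativity) : so_scope.
Notation "'ALLS' X , p" := (f_all2 (fun X => p%so))
  (at level 200, X name, right associativity) : so_scope.
Notation "'EXS' X , p" := (f_ex2 (fun X => p%so))
  (at level 200, X name, right associativity) : so_scope.

Definition f_exu (p : nterm -> form) : form :=
  (EX x, p x /\ (ALL y, p y -> y = x))%so.
Notation "'EXU' x , p" := (f_exu (fun x => p%so))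
  (at level 200, x name, right associativity) : so_scope.

Definition basic_axioms : list fm := map sentence
  [ (ALL n, ~ (n + 1 = 0))%so;
    (ALL m n, m + 1 = n + 1 -> m = n)%so;
    (ALL m, m + 0 = m)%so;
    (ALL m n, m + (n + 1) = (m + n) + 1)%so;
    (ALL m, m * 0 = 0)%so;
    (ALL m n, m * (n + 1) = (m * n) + m)%so;
    (ALL m, ~ (m < 0))%so;
    (ALL m n, m < n + 1 <-> (m < n \/ m = n))%so ].

(** The bounding term of a bounded quantifier does not contain the quantified
    variable, whence the shift. *)
Inductive Sigma00 : fm -> Prop :=
| Sigma00_eq s t : Sigma00 (Eq s t)
| Sigma00_lt s t : Sigma00 (Lt s t)
| Sigma00_mem t X : Sigma00 (Mem t X)
| Sigma00_bot : Sigma00 Bot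
| Sigma00_imp p q : Sigma00 p -> Sigma00 q -> Sigma00 (Imp p q)
| Sigma00_and p q : Sigma00 p -> Sigma00 q -> Sigma00 (And p q)
| Sigma00_or p q : Sigma00 p -> Sigma00 q -> Sigma00 (Or p q)
| Sigma00_all t p :
    Sigma00 p -> Sigma00 (All1 (Imp (Lt (tvar 0) (tshift t)) p))
| Sigma00_ex t p :
    Sigma00 p -> Sigma00 (Ex1 (And (Lt (tvar 0) (tshift t)) p)).

Inductive Sigma01 : fm -> Prop :=
| Sigma01_ex p : Sigma00 p -> Sigma01 (Ex1 p).

Inductive Pi01 : fm -> Prop :=
| Pi01_all p : Sigma00 p -> Pi01 (All1 p).

Definition at_succ : fm -> fm :=
  fsub (scons (tadd (tvar 0) tone) (fun i => tvar (S i))) (fun X => X).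

(** In both schemes the formulas may have number and set parameters; the
    variable of induction or comprehension is number variable 0. *)
Inductive RCA0 : fm -> Prop :=
| RCA0_basic p : In p basic_axioms -> RCA0 p
| RCA0_induction p : Sigma01 p ->
    RCA0 (Imp (And (inst1 tzero p) (All1 (Imp p (at_succ p)))) (All1 p))
| RCA0_comprehension p q : Sigma01 p -> Pi01 q ->
    RCA0 (Imp (All1 (Iff p q)) (Ex2 (All1 (Iff (Mem (tvar 0) 0) (shift2 p))))).

Local Open Scope num_scope.
Local Open Scope so_scope.

(** Coding of finite sets as in Simpson's "Subsystems of Second Order
    Arithmetic": the number ⟨k, ⟨m, n⟩⟩ codes the set of the x < k such that
    m(x + 1) + 1 divides n.  The elements of a coded set are smaller than its
    code. *)

Definition fin_in (x c : nterm) : form :=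
  EXB k < c + 1, EXB m < c + 1, EXB n < c + 1,
    c = ⟨k, ⟨m, n⟩⟩ /\ x < k /\ (EXB q < n + 1, q * (m * (x + 1) + 1) = n).

(** [c] is the least code of a finite set; two such codes with the same
    elements are equal. *)
Definition is_finset (c : nterm) : form :=
  ALLB c' < c, EXB x < c, ~ (fin_in x c' <-> fin_in x c).

(** Term [i] of the finite sequence [s], that is, of the finite set of pairs
    ⟨i, x⟩, is [x]. *)
Definition nth (s i x : nterm) : form := fin_in ⟨i, x⟩ s.

(** [s] is a finite sequence of length [l]. *)
Definition is_seq (s l : nterm) : form :=
  is_finset s /\
  (ALL z, fin_in z s -> EX i x, z = ⟨i, x⟩ /\ i < l) /\
  (ALLB i < l, EXU x, nth s i x).

(** [x] belongs to the predicate inductively generated by [rule M y] ("[y] is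
    generated if the elements of [M] are"): [x] is in a finite set all of whose
    elements are generated from elements of the set.  In all the uses below
    the premises of a rule have smaller codes than its conclusion, so there
    are no circular derivations. *)
Definition generated (rule : (nterm -> form) -> nterm -> form) (x : nterm)
  : form :=
  EX d, fin_in x d /\
    (ALL y, fin_in y d -> rule (fun z => fin_in z d) y).

(** The notation ω^α_0 + ... + ω^α_n is coded by the sequence of its
    exponents, and 0 by the empty sequence. *)

Definition ord_lt_rule (M : nterm -> form) (z : nterm) : form :=
  EX a b n m, z = ⟨a, b⟩ /\ is_seq a n /\ is_seq b m /\
    ((n < m /\ (ALLB j < n, EX x, nth a j x /\ nth b j x)) \/
     (EX i, i < n /\ i < m /\
        (ALLB j < i, EX x, nth a j x /\ nth b j x) /\
        (EX x y, nth a i x /\ nth b i y /\ M ⟨x, y⟩))).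

Definition ord_lt (a b : nterm) : form := generated ord_lt_rule ⟨a, b⟩.

Definition is_ord_rule (M : nterm -> form) (a : nterm) : form :=
  EX n, is_seq a n /\
    (ALLB i < n, EX x, nth a i x /\ M x) /\
    (ALL i x y, i + 1 < n -> nth a i x -> nth a (i + 1) y ->
       y = x \/ ord_lt y x).

Definition is_ord (a : nterm) : form := generated is_ord_rule a.

(** [b] is ω^[a]. *)
Definition is_omega_exp (a b : nterm) : form := is_seq b 1 /\ nth b 0 a.

(** [a] is ω_d, where ω_0 = 1 = ω^0 and ω_(d+1) = ω^(ω_d). *)
Fixpoint is_omega_tower (d : nat) (a : nterm) : form :=
  match d with
  | O => EX z, is_seq z 0 /\ is_omega_exp z a
  | S d' => EX b, is_omega_tower d' b /\ is_omega_exp b a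
  end.

(** No [F] is (the set of pairs of) an infinite sequence β of notations with
    [a] > β_0 > β_1 > ... *)
Definition WO (a : nterm) : form :=
  ~ (EXS F,
      (ALL i, EXU x, f_in ⟨i, x⟩ F) /\
      (ALL i x, f_in ⟨i, x⟩ F -> is_ord x) /\
      (ALL x, f_in ⟨0, x⟩ F -> ord_lt x a) /\
      (ALL i x y, f_in ⟨i, x⟩ F -> f_in ⟨i + 1, y⟩ F -> ord_lt y x)).

Definition WO_omega_tower (d : nat) : form :=
  EX a, is_omega_tower d a /\ WO a.

(** The function identifiers of a program are the positions of their equations
    in the list of equations, and the parameters of a function of arity n are
    the numbers i < n.  A primitive operator is a pair ⟨p, k⟩ of a name and an
    arity. *)

Definition e_var (i : nterm) : nterm := ⟨lit 0, i⟩%num.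
Definition e_succ (i : nterm) : nterm := ⟨lit 1, i⟩%num.
Definition e_pred (i : nterm) : nterm := ⟨lit 2, i⟩%num.
Definition e_call (f s : nterm) : nterm := ⟨lit 3, ⟨f, s⟩⟩%num.
Definition e_op (o s : nterm) : nterm := ⟨lit 4, ⟨o, s⟩⟩%num.
Definition e_if (b e0 e1 : nterm) : nterm := ⟨lit 5, ⟨b, ⟨e0, e1⟩⟩⟩%num.

Definition b_eq0 (i : nterm) : nterm := ⟨lit 0, i⟩%num.
Definition b_eq1 (i : nterm) : nterm := ⟨lit 1, i⟩%num.
Definition b_lt (i j : nterm) : nterm := ⟨lit 2, ⟨i, j⟩⟩%num.
Definition b_le (i j : nterm) : nterm := ⟨lit 3, ⟨i, j⟩⟩%num.
Definition b_and (b c : nterm) : nterm := ⟨lit 4, ⟨b, c⟩⟩%num.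
Definition b_or (b c : nterm) : nterm := ⟨lit 5, ⟨b, c⟩⟩%num.
Definition b_not (b : nterm) : nterm := ⟨lit 6, b⟩%num.

Definition t_num (u : nterm) : nterm := ⟨lit 0, u⟩%num.
Definition t_call (f s : nterm) : nterm := ⟨lit 1, ⟨f, s⟩⟩%num.
Definition t_op (o s : nterm) : nterm := ⟨lit 2, ⟨o, s⟩⟩%num.

(** The equation number [f] of [P] has [n] parameters and body [e]. *)
Definition equation (P f n e : nterm) : form := nth P f ⟨n, e⟩.

Definition is_bool_rule (n : nterm) (M : nterm -> form) (b : nterm) : form :=
  (EX i, i < n /\ (b = b_eq0 i \/ b = b_eq1 i)) \/
  (EX i j, i < n /\ j < n /\ (b = b_lt i j \/ b = b_le i j)) \/
  (EX c d, (b = b_and c d \/ b = b_or c d) /\ M c /\ M d) \/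
  (EX c, b = b_not c /\ M c).

Definition is_bool (n b : nterm) : form := generated (is_bool_rule n) b.

Definition is_arith_rule (P n : nterm) (M : nterm -> form) (a : nterm)
  : form :=
  (EX i, i < n /\ (a = e_var i \/ a = e_succ i \/ a = e_pred i)) \/
  (EX f s k e, a = e_call f s /\ equation P f k e /\ is_seq s k /\
     (ALLB i < k, EX x, nth s i x /\ M x)) \/
  (EX p s k, a = e_op ⟨p, k⟩ s /\ is_seq s k /\
     (ALLB i < k, EX x, nth s i x /\ M x)).

Definition is_arith (P n a : nterm) : form := generated (is_arith_rule P n) a.

Definition is_expr_rule (P n : nterm) (M : nterm -> form) (e : nterm) : form :=
  is_arith P n e \/
  (EX b e0 e1, e = e_if b e0 e1 /\ is_bool n b /\ M e0 /\ M e1).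

Definition is_expr (P n e : nterm) : form := generated (is_expr_rule P n) e.

Definition is_program (P : nterm) : form :=
  EX N, is_seq P N /\ 0 < N /\
    (ALLB f < N, EX n e, equation P f n e /\ is_expr P n e).

Definition op_value (I : sterm) (o u v : nterm) : form := f_in ⟨⟨o, u⟩, v⟩ I.

Definition is_interpretation (I : sterm) : form :=
  ALL p k u, is_seq u k -> EXU v, op_value I ⟨p, k⟩ u v.

Definition truth_value (v : nterm) (p : form) : form :=
  (p /\ v = 1) \/ (~ p /\ v = 0).

(** The pairs ⟨b, v⟩ such that [v] is the truth value (1 or 0) of [b] at [u]. *)
Definition bool_val_rule (u : nterm) (M : nterm -> form) (z : nterm) : form :=
  EX b v, z = ⟨b, v⟩ /\
    ((EX i x, b = b_eq0 i /\ nth u i x /\ truth_value v (x = 0)) \/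
     (EX i x, b = b_eq1 i /\ nth u i x /\ truth_value v (x = 1)) \/
     (EX i j x y, b = b_lt i j /\ nth u i x /\ nth u j y /\
        truth_value v (x < y)) \/
     (EX i j x y, b = b_le i j /\ nth u i x /\ nth u j y /\
        truth_value v (x < y \/ x = y)) \/
     (EX c d v0 v1, b = b_and c d /\ M ⟨c, v0⟩ /\ M ⟨d, v1⟩ /\
        truth_value v (v0 = 1 /\ v1 = 1)) \/
     (EX c d v0 v1, b = b_or c d /\ M ⟨c, v0⟩ /\ M ⟨d, v1⟩ /\
        truth_value v (v0 = 1 \/ v1 = 1)) \/
     (EX c v0, b = b_not c /\ M ⟨c, v0⟩ /\ truth_value v (~ (v0 = 1)))).

Definition bool_val (u b v : nterm) : form :=
  generated (bool_val_rule u) ⟨b, v⟩.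

(** The sequences [s] and [s'] have the same length and their corresponding
    terms are related by [R]. *)
Definition pointwise (R : nterm -> nterm -> form) (s s' : nterm) : form :=
  EX k, is_seq s k /\ is_seq s' k /\
    (ALLB i < k, EX x y, nth s i x /\ nth s' i y /\ R x y).

(** The pairs ⟨e, t⟩ such that [t] is the term e(u). *)
Definition subst_rule (u : nterm) (M : nterm -> form) (z : nterm) : form :=
  EX e t, z = ⟨e, t⟩ /\
    ((EX i x, e = e_var i /\ nth u i x /\ t = t_num x) \/
     (EX i x, e = e_succ i /\ nth u i x /\ t = t_num (x + 1)) \/
     (EX i x y, e = e_pred i /\ nth u i x /\
        (x = y + 1 \/ (x = 0 /\ y = 0)) /\ t = t_num y) \/
     (EX f s s', e = e_call f s /\ t = t_call f s' /\
        pointwise (fun x y => M ⟨x, y⟩) s s') \/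
     (EX o s s', e = e_op o s /\ t = t_op o s' /\
        pointwise (fun x y => M ⟨x, y⟩) s s') \/
     (EX b e0 e1, e = e_if b e0 e1 /\
        ((bool_val u b 1 /\ M ⟨e0, t⟩) \/ (bool_val u b 0 /\ M ⟨e1, t⟩)))).

Definition subst (u e t : nterm) : form := generated (subst_rule u) ⟨e, t⟩.

Definition numerals (u s : nterm) : form :=
  pointwise (fun x y => y = t_num x) u s.

(** The pairs ⟨t, t'⟩ such that [t] reduces to [t'] in one step: either [t] is
    itself a function identifier or primitive operator applied to numerals, or
    the reduction takes place in the first argument of [t] that is not a
    numeral. *)
Definition step_rule (I : sterm) (P : nterm) (M : nterm -> form) (z : nterm)
  : form :=
  EX t t', z = ⟨t, t'⟩ /\
    ((EX f s u n e, t = t_call f s /\ equation P f n e /\ is_seq u n /\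
        numerals u s /\ subst u e t') \/
     (EX o s u v, t = t_op o s /\ numerals u s /\ op_value I o u v /\
        t' = t_num v) \/
     (EX h s s' k i,
        ((t = t_call h s /\ t' = t_call h s') \/
         (t = t_op h s /\ t' = t_op h s')) /\
        is_seq s k /\ is_seq s' k /\ i < k /\
        (ALLB j < i, EX x, nth s j (t_num x)) /\
        (EX x x', nth s i x /\ nth s' i x' /\ M ⟨x, x'⟩) /\
        (ALLB j < k, ~ (j = i) -> EX x, nth s j x /\ nth s' j x))).

Definition step (I : sterm) (P t t' : nterm) : form :=
  generated (step_rule I P) ⟨t, t'⟩.

Definition reduces (I : sterm) (P t t' : nterm) : form :=
  EX s n, is_seq s (n + 1) /\ nth s 0 t /\ nth s n t' /\
    (ALLB i < n, EX x y, nth s i x /\ nth s (i + 1) y /\ step I P x y).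

Definition terminating (I : sterm) (P : nterm) : form :=
  ALL n e u s, equation P 0 n e -> is_seq u n -> numerals u s ->
    EX v, reduces I P (t_call 0 s) (t_num v).

Definition child (e i e' : nterm) : form :=
  (EX h s, (e = e_call h s \/ e = e_op h s) /\ nth s i e') \/
  (EX b e0 e1, e = e_if b e0 e1 /\
     ((i = 0 /\ e' = e0) \/ (i = 1 /\ e' = e1))).

(** [tau] is a position in [e], and [e'] is the subexpression there. *)
Definition subexpr_at (e tau e' : nterm) : form :=
  EX l s, is_seq tau l /\ is_seq s (l + 1) /\ nth s 0 e /\ nth s l e' /\
    (ALLB j < l, EX x i y,
       nth s j x /\ nth tau j i /\ nth s (j + 1) y /\ child x i y).

Definition call (P f tau g : nterm) : form :=
  EX n e s, equation P f n e /\ subexpr_at e tau (e_call g s).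

(** The transition (f, u) -> (g, v) at the call [tau] : [f] -> [g]. *)
Definition transition (I : sterm) (P f u tau g v : nterm) : form :=
  EX n e s s', equation P f n e /\ is_seq u n /\
    subexpr_at e tau (e_call g s) /\
    subst u (e_call g s) (t_call g s') /\
    pointwise (fun t x => reduces I P t (t_num x)) s' v.

(** The strict arc from [x] to [y] is ⟨⟨x, y⟩, 1⟩, the non-strict one is
    ⟨⟨x, y⟩, 0⟩. *)

Definition strict_arc (G x y : nterm) : form := fin_in ⟨⟨x, y⟩, lit 1⟩ G.
Definition weak_arc (G x y : nterm) : form := fin_in ⟨⟨x, y⟩, lit 0⟩ G.

Definition is_graph (P f g G : nterm) : form :=
  is_finset G /\
  (EX n e k e', equation P f n e /\ equation P g k e' /\
     (ALL z, fin_in z G ->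
        EX x y, x < n /\ y < k /\
          (z = ⟨⟨x, y⟩, lit 1⟩ \/ z = ⟨⟨x, y⟩, lit 0⟩))).

Definition graph_relates (G u v : nterm) : form :=
  (ALL x y, strict_arc G x y -> EX a b, nth u x a /\ nth v y b /\ b < a) /\
  (ALL x y, weak_arc G x y ->
     EX a b, nth u x a /\ nth v y b /\ (b < a \/ b = a)).

Definition composition (G H K : nterm) : form :=
  (ALL x z, strict_arc K x z <->
     EX y, (strict_arc G x y /\ (strict_arc H y z \/ weak_arc H y z)) \/
           (weak_arc G x y /\ strict_arc H y z)) /\
  (ALL x z, weak_arc K x z <->
     (EX y, weak_arc G x y /\ weak_arc H y z) /\ ~ strict_arc K x z).

(** The description [D] assigns the graph [G] to the call [tau] in the body of
    [f]. *)
Definition assigns (D f tau G : nterm) : form := fin_in ⟨⟨f, tau⟩, G⟩ D.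

Definition is_description (P D : nterm) : form :=
  ALL f tau g, call P f tau g ->
    (EXU G, assigns D f tau G) /\
    (ALL G, assigns D f tau G -> is_graph P f g G).

Definition safe (I : sterm) (P D : nterm) : form :=
  ALL f tau g G u v, call P f tau g -> assigns D f tau G ->
    transition I P f u tau g v -> graph_relates G u v.

(** [G] : [f] -> [g] is in the closure of [D] under composition: it is the last
    term of a sequence of graphs (with their source and target) each of which
    is assigned to a call, or is the composition of two earlier ones. *)
Definition in_closure (P D f g G : nterm) : form :=
  EX s n, is_seq s (n + 1) /\ nth s n ⟨⟨f, g⟩, G⟩ /\
    (ALLB i < n + 1, EX f' g' G', nth s i ⟨⟨f', g'⟩, G'⟩ /\
       ((EX tau, call P f' tau g' /\ assigns D f' tau G') \/
        (EX j k h G0 G1, j < i /\ k < i /\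
           nth s j ⟨⟨f', h⟩, G0⟩ /\ nth s k ⟨⟨h, g'⟩, G1⟩ /\
           is_graph P f' g' G' /\ composition G0 G1 G'))).

Definition ISCT (P D : nterm) : form :=
  ALL f G, in_closure P D f f G -> composition G G G -> EX x, strict_arc G x x.

(** The fixed interpretation of the primitive operators is arbitrary. *)
Definition ISCT_soundness : form :=
  ALLS I, is_interpretation I ->
    ALL P D, is_program P -> is_description P D -> safe I P D -> ISCT P D ->
      terminating I P.

(* Main.v *)
From Stdlib Require Import List Arith Lia Cantor.
From Stdlib Require Import Classical ClassicalEpsilon FunctionalExtensionality PropExtensionality ProofIrrelevance.
From HB Require Import structures.
From mathcomp Require ssreflect ssrfun ssrbool eqtype choice order ssralg ssrnum boolp ring lra.
Require Import Defs.
Import ListNotations.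

(** By completeness it suffices to work in a (possibly nonstandard, possibly
    non-omega) model of RCA0 in which omega_3 is well-ordered.

    Evaluation is run on an abstract machine with a stack of frames.  A frame
    consists of a function [f], its arguments [u], a counter going through the
    codes of the subexpressions of the body of [f], and a rank
    [m = (m_0, ..., m_K)] of the calls leading to it.  Since subexpressions have
    smaller codes than the expressions containing them, each value needed at the
    counter is either already known or asks for a new frame.  If every call
    decreases [m] lexicographically, then the sum over the stack of
    [ω^α(m) * (remaining steps of the counter)], with [α(m) < ω^ω], decreases
    at each step and stays below [ω^ω^ω]: by WO(omega_3) the machine stops, and
    it can only stop with a value.

    Ranks come from a forest of slots in place of Ramsey's theorem.  A colour is
    a size-change graph of the closure with its source and target.  A slot sets
    some colours and remembers for each of them the composite [r] of the calls
    made since; a call completing all set colours of a slot ([r] followed by the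
    call is [d], for every set [d]) kills it and creates one child for each
    colour, where this colour is set anew.  A set colour [d] that has to be set
    again is idempotent, hence by ISCT it has a strict arc [x -> x], and the
    argument [x] has decreased since [d] was set.  So the children either have
    more colours set, or as many and a smaller sum of bounds, and the number of
    slots with [r] set colours, weighted by bounds, gives a rank [m]. *)

(** * Substitution *)

(** The familiar argument applies Ramsey's theorem for pairs to an infinite sequence of calls, which
    RCA_0 does not provide. Slots keep only finite information about the past, and the well-ordering
    of ω_3 is spent on the run of the machine alone.

    Size of the ordinal: the number [K] depends on the program and may be nonstandard, so a rank has
    [K + 1] coordinates, the ordinals α(m) are bounded uniformly only by ω^ω, and the sums over the
    stack by ω^ω^ω. A slot with sum of bounds [b] weighs [(K + 1) ^ b] because a dead slot leaves at
    most [K] children with as many colours set, all with a smaller sum.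

    The other constraint is complexity: induction, collection and dependent choice are available for
    Sigma01 predicates only. Hence the machine does not store values but only uses their existence,
    and the Sigma01 notions that occur in premises of implications (being a subexpression, being a
    colour) are first turned into codes of finite sets by bounded comprehension. *)

Definition up (s : nat -> tm) : nat -> tm :=
  scons (tvar 0) (fun i => tshift (s i)).
Definition upr (r : nat -> nat) : nat -> nat := scons 0 (fun X => S (r X)).

Lemma tsub_tsub s s' t : tsub s (tsub s' t) = tsub (fun i => tsub s (s' i)) t.
Proof. induction t; simpl; congruence. Qed.

Lemma tsub_id t : tsub tvar t = t.
Proof. induction t; simpl; congruence. Qed.

Lemma up_tshift s t : tsub (up s) (tshift t) = tshift (tsub s t).
Proof. unfold tshift. now rewrite !tsub_tsub. Qed.

Lemma up_comp s s' : (fun i => tsub (up s) (up s' i)) = up (fun i => tsub s (s' i)).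
Proof.
  extensionality i; destruct i as [|i]; [reflexivity|]. apply up_tshift.
Qed.

Lemma upr_comp r r' : (fun X => upr r (upr r' X)) = upr (fun X => r (r' X)).
Proof. extensionality i; now destruct i. Qed.

Lemma fsub_fsub p : forall s r s' r',
  fsub s r (fsub s' r' p) = fsub (fun i => tsub s (s' i)) (fun X => r (r' X)) p.
Proof.
  induction p; intros; simpl; rewrite ?tsub_tsub; f_equal; auto.
  - etransitivity; [apply IHp|]. f_equal. apply up_comp.
  - etransitivity; [apply IHp|]. f_equal. apply up_comp.
  - etransitivity; [apply IHp|]. f_equal. apply upr_comp.
  - etransitivity; [apply IHp|]. f_equal. apply upr_comp.
Qed.

Lemma up_id : up tvar = tvar.
Proof. extensionality i; now destruct i. Qed.

Lemma upr_id : upr (fun X => X) = fun X => X.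
Proof. extensionality i; now destruct i. Qed.

Lemma fsub_id p : fsub tvar (fun X => X) p = p.
Proof.
  induction p; simpl; rewrite ?tsub_id; f_equal; auto.
  - change (fsub (up tvar) (fun X => X) p = p). now rewrite up_id.
  - change (fsub (up tvar) (fun X => X) p = p). now rewrite up_id.
  - change (fsub tvar (upr (fun X => X)) p = p). now rewrite upr_id.
  - change (fsub tvar (upr (fun X => X)) p = p). now rewrite upr_id.
Qed.

Lemma fsub_inst1 s r t p :
  fsub s r (inst1 t p) = inst1 (tsub s t) (fsub (up s) r p).
Proof.
  unfold inst1. rewrite !fsub_fsub. f_equal. extensionality i.
  destruct i as [|i]; [reflexivity|]. simpl. unfold tshift.
  rewrite tsub_tsub. simpl. now rewrite tsub_id.
Qed.

Lemma fsub_inst2 s r X p :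
  fsub s r (inst2 X p) = inst2 (r X) (fsub s (upr r) p).
Proof.
  unfold inst2. rewrite !fsub_fsub. f_equal.
  - extensionality i. simpl. now rewrite tsub_id.
  - extensionality i. now destruct i.
Qed.

Lemma fsub_shift1 s r p : fsub (up s) r (shift1 p) = shift1 (fsub s r p).
Proof. unfold shift1. now rewrite !fsub_fsub. Qed.

Lemma fsub_shift2 s r p : fsub s (upr r) (shift2 p) = shift2 (fsub s r p).
Proof.
  unfold shift2. rewrite !fsub_fsub. f_equal. extensionality i.
  simpl. now rewrite tsub_id.
Qed.

Lemma fsub_at_succ s r p : fsub (up s) r (at_succ p) = at_succ (fsub (up s) r p).
Proof.
  unfold at_succ. rewrite !fsub_fsub. f_equal. extensionality i.
  destruct i as [|i]; [reflexivity|]. simpl. unfold tshift.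
  rewrite !tsub_tsub. reflexivity.
Qed.

Definition sub_closed (T : fm -> Prop) : Prop := forall p s r, T p -> T (fsub s r p).

(** Lifted substitutions commute with [shift1] and [shift2], so the eigenvariable conditions of the
    quantifier rules survive; axioms are the only obstacle, whence [sub_closed]. The Henkin
    construction uses this to turn a fresh variable back into an eigenvariable. *)
Lemma prv_sub T (HT : sub_closed T) G p (H : prv T G p) :
  forall s r, prv T (map (fsub s r) G) (fsub s r p).
Proof.
  induction H; intros s0 r0; simpl in *.
  - apply prv_ax; auto.
  - apply prv_hyp. now apply in_map.
  - apply prv_impI; auto.
  - eapply prv_impE; eauto.
  - apply prv_andI; auto.
  - eapply prv_andE1; eauto.
  - eapply prv_andE2; eauto.
  - apply prv_orI1; auto.
  - apply prv_orI2; auto.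
  - eapply prv_orE; eauto.
  - apply prv_raa; auto.
  - apply prv_all1I. specialize (IHprv (up s0) r0).
    rewrite map_map in *. erewrite map_ext; [apply IHprv|].
    intros; simpl; now rewrite fsub_shift1.
  - rewrite fsub_inst1. apply prv_all1E. apply IHprv.
  - eapply (prv_ex1I _ _ _ (tsub s0 t)). rewrite <- fsub_inst1. apply IHprv.
  - eapply prv_ex1E; [apply IHprv1|]. specialize (IHprv2 (up s0) r0).
    rewrite map_map in *. rewrite <- fsub_shift1. erewrite map_ext; [apply IHprv2|].
    intros; simpl; now rewrite fsub_shift1.
  - apply prv_all2I. specialize (IHprv s0 (upr r0)).
    rewrite map_map in *. erewrite map_ext; [apply IHprv|].
    intros; simpl; now rewrite fsub_shift2.
  - rewrite fsub_inst2. apply prv_all2E. apply IHprv.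
  - eapply (prv_ex2I _ _ _ (r0 X)). rewrite <- fsub_inst2. apply IHprv.
  - eapply prv_ex2E; [apply IHprv1|]. specialize (IHprv2 s0 (upr r0)).
    rewrite map_map in *. rewrite <- fsub_shift2. erewrite map_ext; [apply IHprv2|].
    intros; simpl; now rewrite fsub_shift2.
  - apply prv_eqI.
  - rewrite fsub_inst1. eapply prv_eqE; [apply IHprv1|]. rewrite <- fsub_inst1. apply IHprv2.
Qed.

Lemma prv_weak T G p (H : prv T G p) : forall G', incl G G' -> prv T G' p.
Proof.
  induction H; intros G' HG.
  - now apply prv_ax.
  - apply prv_hyp; auto.
  - apply prv_impI. apply IHprv. intros x [->|Hx]; [now left|right; auto].
  - eapply prv_impE; eauto.
  - apply prv_andI; auto.
  - eapply prv_andE1; eauto.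
  - eapply prv_andE2; eauto.
  - apply prv_orI1; auto.
  - apply prv_orI2; auto.
  - eapply prv_orE; eauto; [apply IHprv2|apply IHprv3];
      (intros x [->|Hx]; [now left|right; auto]).
  - apply prv_raa. apply IHprv. intros x [->|Hx]; [now left|right; auto].
  - apply prv_all1I. apply IHprv. now apply incl_map.
  - apply prv_all1E; auto.
  - eapply prv_ex1I; eauto.
  - eapply prv_ex1E; eauto. apply IHprv2.
    intros x [->|Hx]; [now left|right]. eapply incl_map; eauto.
  - apply prv_all2I. apply IHprv. now apply incl_map.
  - apply prv_all2E; auto.
  - eapply prv_ex2I; eauto.
  - eapply prv_ex2E; eauto. apply IHprv2.
    intros x [->|Hx]; [now left|right]. eapply incl_map; eauto.
  - apply prv_eqI.
  - eapply prv_eqE; eauto.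
Qed.

(** * Free variables and enumeration of formulas *)

Fixpoint tbound (t : tm) : nat :=
  match t with
  | tvar i => S i
  | tzero | tone => 0
  | tadd a b | tmul a b => max (tbound a) (tbound b)
  end.

(** Crude bounds: the bound variables are counted as if they were free. *)
Fixpoint fbound (p : fm) : nat :=
  match p with
  | Eq a b | Lt a b => max (tbound a) (tbound b)
  | Mem a X => max (tbound a) (S X)
  | Bot => 0
  | Imp a b | And a b | Or a b => max (fbound a) (fbound b)
  | All1 a | Ex1 a | All2 a | Ex2 a => fbound a
  end.

Lemma tsub_ext_bound t s s' :
  (forall i, i < tbound t -> s i = s' i) -> tsub s t = tsub s' t.
Proof.
  induction t; simpl; intros H; auto;
    f_equal; first [apply IHt1 | apply IHt2]; intros; apply H; lia.
Qed.

Lemma fsub_ext_bound p : forall s r s' r',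
  (forall i, i < fbound p -> s i = s' i) -> (forall i, i < fbound p -> r i = r' i) ->
  fsub s r p = fsub s' r' p.
Proof.
  induction p; simpl; intros s0 r0 s' r' H1 H2; f_equal;
    try (apply tsub_ext_bound; intros; apply H1; lia);
    try (first [apply IHp1|apply IHp2]; intros; first [apply H1|apply H2]; lia);
    try (apply IHp; auto; intros [|i] Hi; simpl; f_equal;
         first [reflexivity|apply H1; lia|apply H2; lia]);
    try reflexivity; apply H2; lia.
Qed.

Definition cp (a b : nat) : nat := to_nat (a, b).

Lemma cp_inj a b c d : cp a b = cp c d -> a = c /\ b = d.
Proof. intros H. assert (E : (a, b) = (c, d)) by now apply to_nat_inj. now inversion E. Qed.

Fixpoint enc_tm (t : tm) : nat :=
  match t with
  | tvar i => cp 0 i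
  | tzero => cp 1 0
  | tone => cp 2 0
  | tadd a b => cp 3 (cp (enc_tm a) (enc_tm b))
  | tmul a b => cp 4 (cp (enc_tm a) (enc_tm b))
  end.

Fixpoint enc_fm (p : fm) : nat :=
  match p with
  | Eq a b => cp 0 (cp (enc_tm a) (enc_tm b))
  | Lt a b => cp 1 (cp (enc_tm a) (enc_tm b))
  | Mem a X => cp 2 (cp (enc_tm a) X)
  | Bot => cp 3 0
  | Imp a b => cp 4 (cp (enc_fm a) (enc_fm b))
  | And a b => cp 5 (cp (enc_fm a) (enc_fm b))
  | Or a b => cp 6 (cp (enc_fm a) (enc_fm b))
  | All1 a => cp 7 (enc_fm a)
  | Ex1 a => cp 8 (enc_fm a)
  | All2 a => cp 9 (enc_fm a)
  | Ex2 a => cp 10 (enc_fm a)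
  end.

Ltac inj_cantor :=
  repeat match goal with
  | H : cp _ _ = cp _ _ |- _ => apply cp_inj in H as [? ?]; try discriminate
  end.

Lemma enc_tm_inj t : forall t', enc_tm t = enc_tm t' -> t = t'.
Proof.
  induction t; intros [] H; cbn [enc_tm] in H; inj_cantor; subst; f_equal; auto.
Qed.

Lemma enc_fm_inj p : forall p', enc_fm p = enc_fm p' -> p = p'.
Proof.
  induction p; intros [] H; cbn [enc_fm] in H; inj_cantor; subst; f_equal;
    auto using enc_tm_inj.
Qed.

Definition enum (n : nat) : fm := epsilon (inhabits Bot) (fun p => enc_fm p = n).

Lemma enum_surj p : enum (enc_fm p) = p.
Proof.
  apply enc_fm_inj. unfold enum.
  apply (epsilon_spec (inhabits Bot) (fun q => enc_fm q = enc_fm p)). now exists p.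
Qed.

(** * Structures *)

(** Sets are a second sort with an arbitrary membership relation, so second-order logic is treated
    as a two-sorted first-order theory; only for this semantics is the calculus complete. *)
Record structure := Structure {
  dom :> Type;
  sets : Type;
  zero : dom;
  one : dom;
  add : dom -> dom -> dom;
  mul : dom -> dom -> dom;
  lt : dom -> dom -> Prop;
  mem : dom -> sets -> Prop }.

Arguments zero {_}.
Arguments one {_}.
Arguments add {_}.
Arguments mul {_}.
Arguments lt {_}.
Arguments mem {_}.

Fixpoint teval {A : structure} (e : nat -> A) (t : tm) : A :=
  match t with
  | tvar i => e i
  | tzero => zero
  | tone => one
  | tadd a b => add (teval e a) (teval e b)
  | tmul a b => mul (teval e a) (teval e b)
  end.

Fixpoint sat {A : structure} (e : nat -> A) (E : nat -> sets A) (p : fm) : Prop :=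
  match p with
  | Eq a b => teval e a = teval e b
  | Lt a b => lt (teval e a) (teval e b)
  | Mem a X => mem (teval e a) (E X)
  | Bot => False
  | Imp a b => sat e E a -> sat e E b
  | And a b => sat e E a /\ sat e E b
  | Or a b => sat e E a \/ sat e E b
  | All1 a => forall x, sat (scons x e) E a
  | Ex1 a => exists x, sat (scons x e) E a
  | All2 a => forall X, sat e (scons X E) a
  | Ex2 a => exists X, sat e (scons X E) a
  end.

Definition is_model (T : fm -> Prop) (A : structure) : Prop :=
  forall p, T p -> forall (e : nat -> A) E, sat e E p.

Lemma teval_tsub (A : structure) (e : nat -> A) s t :
  teval e (tsub s t) = teval (fun i => teval e (s i)) t.
Proof. induction t; simpl; congruence. Qed.

Lemma scons_teval_up (A : structure) (x : A) e s :
  (fun i => teval (scons x e) (up s i)) = scons x (fun i => teval e (s i)).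
Proof.
  extensionality i. destruct i as [|i]; [reflexivity|]. simpl. unfold tshift.
  now rewrite teval_tsub.
Qed.

Lemma sat_fsub (A : structure) p : forall (e : nat -> A) E s r,
  sat e E (fsub s r p) <-> sat (fun i => teval e (s i)) (fun X => E (r X)) p.
Proof.
  induction p; intros e E s0 r0; simpl; rewrite ?teval_tsub; try tauto.
  - rewrite IHp1, IHp2; tauto.
  - rewrite IHp1, IHp2; tauto.
  - rewrite IHp1, IHp2; tauto.
  - split; intros H x; specialize (H x); [apply IHp in H|apply IHp];
      change (fun i => teval (scons x e) _) with (fun i => teval (scons x e) (up s0 i)) in *;
      now rewrite scons_teval_up in *.
  - split; intros [x H]; exists x; [apply IHp in H|apply IHp];
      change (fun i => teval (scons x e) _) with (fun i => teval (scons x e) (up s0 i)) in *;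
      now rewrite scons_teval_up in *.
  - assert (Q : forall X, (fun Y => scons X E (upr r0 Y)) = scons X (fun Y => E (r0 Y)))
      by (intros X; extensionality i; now destruct i).
    split; intros H x; specialize (H x); [apply IHp in H|apply IHp];
      change (fun Y => scons x E _) with (fun Y => scons x E (upr r0 Y)) in *;
      now rewrite Q in *.
  - assert (Q : forall X, (fun Y => scons X E (upr r0 Y)) = scons X (fun Y => E (r0 Y)))
      by (intros X; extensionality i; now destruct i).
    split; intros [x H]; exists x; [apply IHp in H|apply IHp];
      change (fun Y => scons x E _) with (fun Y => scons x E (upr r0 Y)) in *;
      now rewrite Q in *.
Qed.

(** * Completeness *)

Section Henkin.
Variable T : fm -> Prop.
Hypothesis HT : sub_closed T.

Definition con (G : list fm) : Prop := ~ prv T G Bot.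

Local Notation Neg p := (Imp p Bot).

Lemma prv_cut G p q : prv T G p -> prv T (p :: G) q -> prv T G q.
Proof. intros H1 H2. eapply prv_impE; [apply prv_impI, H2|exact H1]. Qed.

Lemma prv_bot G p : prv T G Bot -> prv T G p.
Proof. intros H. apply prv_raa. eapply prv_weak; [exact H|]. now apply incl_tl, incl_refl. Qed.

Definition lbound (G : list fm) : nat := fold_right (fun p n => max (fbound p) n) 0 G.

Lemma lbound_in G p : In p G -> fbound p <= lbound G.
Proof.
  induction G as [|q G IH]; simpl; [tauto|]. intros [->|H]; [lia|].
  specialize (IH H). lia.
Qed.

(** The renaming [s] sends the fresh variable [k] to the eigenvariable and shifts the others. On
    formulas bounded by [k] it agrees with [shift1], and it undoes the instance at [tvar k], so a
    refutation of the witness becomes the second premise of [prv_ex1E]. *)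
Lemma con_witness1 G q k :
  lbound (Ex1 q :: G) <= k -> In (Ex1 q) G -> con G -> con (inst1 (tvar k) q :: G).
Proof.
  intros Hk Hin Hc H. apply Hc.
  apply (prv_ex1E _ _ q); [now apply prv_hyp|].
  pose (s := fun i => if Nat.eq_dec i k then tvar 0 else tvar (S i)).
  assert (E : forall p, fbound p <= k -> fsub s (fun X => X) p = shift1 p).
  { intros p Hp. apply fsub_ext_bound; auto. intros i Hi. unfold s.
    destruct (Nat.eq_dec i k); [lia|reflexivity]. }
  apply (prv_sub T HT) with (s := s) (r := fun X => X) in H. simpl in H.
  assert (Eq1 : fsub s (fun X => X) (inst1 (tvar k) q) = q).
  { unfold inst1. rewrite fsub_fsub. rewrite <- (fsub_id q) at 2.
    apply fsub_ext_bound; auto. intros [|i] Hi; simpl; unfold s.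
    - destruct (Nat.eq_dec k k); [reflexivity|lia].
    - simpl in Hk. destruct (Nat.eq_dec i k); [lia|reflexivity]. }
  rewrite Eq1 in H. erewrite map_ext_in; [exact H|].
  intros p Hp. symmetry. apply E. apply lbound_in in Hp. simpl in Hk. lia.
Qed.

Lemma con_witness2 G q k :
  lbound (Ex2 q :: G) <= k -> In (Ex2 q) G -> con G -> con (inst2 k q :: G).
Proof.
  intros Hk Hin Hc H. apply Hc.
  apply (prv_ex2E _ _ q); [now apply prv_hyp|].
  pose (s := fun i => if Nat.eq_dec i k then 0 else S i).
  assert (E : forall p, fbound p <= k -> fsub tvar s p = shift2 p).
  { intros p Hp. apply fsub_ext_bound; auto. intros i Hi. unfold s.
    destruct (Nat.eq_dec i k); [lia|reflexivity]. }
  apply (prv_sub T HT) with (s := tvar) (r := s) in H. simpl in H.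
  assert (Eq1 : fsub tvar s (inst2 k q) = q).
  { unfold inst2. rewrite fsub_fsub. rewrite <- (fsub_id q) at 2.
    apply fsub_ext_bound; auto. intros [|i] Hi; simpl; unfold s.
    - destruct (Nat.eq_dec k k); [reflexivity|lia].
    - simpl in Hk. destruct (Nat.eq_dec i k); [lia|reflexivity]. }
  rewrite Eq1 in H. erewrite map_ext_in; [exact H|].
  intros p Hp. symmetry. apply E. apply lbound_in in Hp. simpl in Hk. lia.
Qed.

(** An accepted existential formula gets its witness at once. The bound runs over [p :: p :: G]
    because [con_witness1] and [con_witness2] are applied in the context [p :: G]. *)
Definition extend (p : fm) (G : list fm) : list fm :=
  if excluded_middle_informative (con (p :: G)) then
    match p with
    | Ex1 q => inst1 (tvar (lbound (p :: p :: G))) q :: p :: G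
    | Ex2 q => inst2 (lbound (p :: p :: G)) q :: p :: G
    | _ => p :: G
    end
  else G.

Variable G0 : list fm.
Hypothesis con0 : con G0.

Fixpoint stage (n : nat) : list fm :=
  match n with 0 => G0 | S n => extend (enum n) (stage n) end.

Lemma stage_con n : con (stage n).
Proof.
  induction n as [|n IH]; [exact con0|]. simpl. unfold extend.
  destruct (excluded_middle_informative _) as [H|]; [|exact IH].
  destruct (enum n); auto.
  - apply con_witness1; auto; now left.
  - apply con_witness2; auto; now left.
Qed.

Lemma extend_incl p G : incl G (extend p G).
Proof.
  unfold extend. destruct (excluded_middle_informative _); [|apply incl_refl].
  destruct p; intros x Hx; simpl; tauto.
Qed.

Lemma stage_mono n m : n <= m -> incl (stage n) (stage m).
Proof.
  induction 1; [apply incl_refl|]. eapply incl_tran; [exact IHle|]. apply extend_incl.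
Qed.

Definition theory (p : fm) : Prop := exists n, In p (stage n).

Lemma theory_stage G : (forall p, In p G -> theory p) -> exists n, incl G (stage n).
Proof.
  induction G as [|p G IH]; intros H.
  - exists 0. intros x [].
  - destruct IH as [n Hn]; [intros; apply H; now right|].
    destruct (H p (or_introl eq_refl)) as [m Hm].
    exists (max n m). intros x [<-|Hx].
    + apply (stage_mono m); [lia|exact Hm].
    + apply (stage_mono n); [lia|auto].
Qed.

Lemma theory_extend p : (forall n, con (p :: stage n)) -> In p (stage (S (enc_fm p))).
Proof.
  intros H. simpl. rewrite enum_surj. unfold extend.
  destruct (excluded_middle_informative _) as [_|N]; [|exfalso; now apply N].
  destruct p; simpl; tauto.
Qed.

(** A consequence of the theory is consistent with every stage, since it could be cut away from a
    later one; hence [extend] accepts it when its number comes up. *)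
Lemma theory_prv G p : (forall q, In q G -> theory q) -> prv T G p -> theory p.
Proof.
  intros HG Hp. destruct (theory_stage G HG) as [n Hn].
  exists (S (enc_fm p)). apply theory_extend. intros m Hm.
  apply (stage_con (max n m)).
  apply (prv_cut _ p).
  - apply (prv_weak _ _ _ Hp). eapply incl_tran; [exact Hn|]. apply stage_mono; lia.
  - apply (prv_weak _ _ _ Hm). intros x [->|Hx]; [now left|right].
    apply (stage_mono m); [lia|exact Hx].
Qed.

Lemma theory_prv0 p : prv T [] p -> theory p.
Proof. apply theory_prv. intros q []. Qed.

Lemma theory_prv1 q p : theory q -> prv T [q] p -> theory p.
Proof. intros H. apply theory_prv. now intros ? [<-|[]]. Qed.

Lemma theory_prv2 q q' p : theory q -> theory q' -> prv T [q; q'] p -> theory p.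
Proof. intros H H'. apply theory_prv. now intros ? [<-|[<-|[]]]. Qed.

Lemma theory_bot : ~ theory Bot.
Proof. intros [n Hn]. apply (stage_con n). now apply prv_hyp. Qed.

Lemma theory_neg p : theory (Neg p) <-> ~ theory p.
Proof.
  split.
  - intros H1 H2. apply theory_bot. apply (theory_prv2 _ _ _ H1 H2).
    eapply prv_impE; apply prv_hyp; simpl; eauto.
  - intros H. exists (S (enc_fm (Neg p))). apply theory_extend. intros n Hn.
    apply H. destruct (theory_stage (stage n)) as [m Hm]; [intros q Hq; now exists n|].
    eapply (theory_prv (stage n)); [intros q Hq; now exists n|]. now apply prv_raa.
Qed.

Lemma theory_imp p q : theory (Imp p q) <-> (theory p -> theory q).
Proof.
  split.
  - intros H1 H2. apply (theory_prv2 _ _ _ H1 H2).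
    eapply prv_impE; apply prv_hyp; simpl; eauto.
  - intros H. destruct (classic (theory p)) as [Hp|Hp].
    + apply (theory_prv1 q); [auto|]. apply prv_impI, prv_hyp. simpl; auto.
    + apply theory_neg in Hp. apply (theory_prv1 _ _ Hp). apply prv_impI, prv_bot.
      eapply prv_impE; apply prv_hyp; simpl; eauto.
Qed.

Lemma theory_and p q : theory (And p q) <-> theory p /\ theory q.
Proof.
  split.
  - intros H. split; apply (theory_prv1 _ _ H);
      [eapply prv_andE1|eapply prv_andE2]; apply prv_hyp; simpl; eauto.
  - intros [H1 H2]. apply (theory_prv2 _ _ _ H1 H2).
    apply prv_andI; apply prv_hyp; simpl; auto.
Qed.

Lemma theory_or p q : theory (Or p q) <-> theory p \/ theory q.
Proof.
  split.
  - intros H. apply NNPP. intros N. apply not_or_and in N as [N1 N2].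
    apply theory_neg in N1, N2. apply theory_bot.
    apply (theory_prv [Or p q; Neg p; Neg q]); [now intros ? [<-|[<-|[<-|[]]]]|].
    apply (prv_orE _ _ p q); [apply prv_hyp; simpl; auto| |].
    + apply (prv_impE _ _ p); apply prv_hyp; simpl; auto.
    + apply (prv_impE _ _ q); apply prv_hyp; simpl; auto.
  - intros [H|H]; apply (theory_prv1 _ _ H); [apply prv_orI1|apply prv_orI2];
      apply prv_hyp; simpl; auto.
Qed.

Lemma theory_ex1 p : theory (Ex1 p) <-> exists t, theory (inst1 t p).
Proof.
  split.
  - intros H.
    assert (C : forall n, con (Ex1 p :: stage n)).
    { intros n Hn. apply (theory_bot). destruct H as [m Hm].
      eapply (theory_prv (Ex1 p :: stage n)); [|exact Hn].
      intros q [<-|Hq]; [now exists m|now exists n]. }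
    exists (tvar (lbound (Ex1 p :: Ex1 p :: stage (enc_fm (Ex1 p))))).
    exists (S (enc_fm (Ex1 p))).
    change (stage (S (enc_fm (Ex1 p)))) with (extend (enum (enc_fm (Ex1 p))) (stage (enc_fm (Ex1 p)))).
    rewrite enum_surj. unfold extend.
    destruct (excluded_middle_informative _) as [_|N]; [now left|].
    exfalso; apply N, C.
  - intros [t H]. apply (theory_prv1 _ _ H). eapply prv_ex1I, prv_hyp; simpl; eauto.
Qed.

Lemma theory_ex2 p : theory (Ex2 p) <-> exists X, theory (inst2 X p).
Proof.
  split.
  - intros H.
    assert (C : forall n, con (Ex2 p :: stage n)).
    { intros n Hn. apply (theory_bot). destruct H as [m Hm].
      eapply (theory_prv (Ex2 p :: stage n)); [|exact Hn].
      intros q [<-|Hq]; [now exists m|now exists n]. }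
    exists (lbound (Ex2 p :: Ex2 p :: stage (enc_fm (Ex2 p)))).
    exists (S (enc_fm (Ex2 p))).
    change (stage (S (enc_fm (Ex2 p)))) with (extend (enum (enc_fm (Ex2 p))) (stage (enc_fm (Ex2 p)))).
    rewrite enum_surj. unfold extend.
    destruct (excluded_middle_informative _) as [_|N]; [now left|].
    exfalso; apply N, C.
  - intros [t H]. apply (theory_prv1 _ _ H). eapply prv_ex2I, prv_hyp; simpl; eauto.
Qed.

(** Reduced to the existential case: if [All1 p] is not in the theory, then [Ex1 (Neg p)] is, by a
    proof by contradiction, and its witness refutes an instance of [p]. *)
Lemma theory_all1 p : theory (All1 p) <-> forall t, theory (inst1 t p).
Proof.
  split.
  - intros H t. apply (theory_prv1 _ _ H). apply prv_all1E, prv_hyp; simpl; auto.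
  - intros H. apply NNPP. intros N. apply theory_neg in N.
    assert (Q : theory (Ex1 (Neg p))).
    { apply (theory_prv1 _ _ N). apply prv_raa. eapply prv_impE.
      - apply prv_hyp. right; left; reflexivity.
      - apply prv_all1I. apply prv_raa. eapply prv_impE.
        + apply prv_hyp. right; left. reflexivity.
        + apply (prv_ex1I _ _ _ (tvar 0)). apply prv_hyp. left.
          unfold inst1. simpl. f_equal. rewrite fsub_fsub. rewrite <- (fsub_id p) at 1.
          f_equal. extensionality i. now destruct i. }
    apply theory_ex1 in Q as [t Q].
    exact (proj1 (theory_neg (inst1 t p)) Q (H t)).
Qed.

Lemma theory_all2 p : theory (All2 p) <-> forall X, theory (inst2 X p).
Proof.
  split.
  - intros H t. apply (theory_prv1 _ _ H). apply prv_all2E, prv_hyp; simpl; auto.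
  - intros H. apply NNPP. intros N. apply theory_neg in N.
    assert (Q : theory (Ex2 (Neg p))).
    { apply (theory_prv1 _ _ N). apply prv_raa. eapply prv_impE.
      - apply prv_hyp. right; left; reflexivity.
      - apply prv_all2I. apply prv_raa. eapply prv_impE.
        + apply prv_hyp. right; left. reflexivity.
        + apply (prv_ex2I _ _ _ 0). apply prv_hyp. left.
          unfold inst2. simpl. f_equal. rewrite fsub_fsub. rewrite <- (fsub_id p) at 1.
          f_equal. extensionality i. now destruct i. }
    apply theory_ex2 in Q as [t Q].
    exact (proj1 (theory_neg (inst2 t p)) Q (H t)).
Qed.

Definition teq (s t : tm) : Prop := theory (Eq s t).

Lemma teq_refl t : teq t t.
Proof. apply theory_prv0, prv_eqI. Qed.

Lemma theory_rewrite p s t : teq s t -> theory (inst1 s p) -> theory (inst1 t p).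
Proof.
  intros H1 H2. apply (theory_prv2 _ _ _ H1 H2).
  eapply prv_eqE; apply prv_hyp; simpl; auto.
Qed.

Lemma tsub_inst_shift t u : tsub (scons u tvar) (tshift t) = t.
Proof. unfold tshift. rewrite tsub_tsub. apply tsub_id. Qed.

Lemma teq_sym s t : teq s t -> teq t s.
Proof.
  intros H. pose proof (theory_rewrite (Eq (tvar 0) (tshift s)) s t H) as Q.
  unfold inst1 in Q. simpl in Q. rewrite !tsub_inst_shift in Q. apply Q, teq_refl.
Qed.

Lemma teq_trans s t u : teq s t -> teq t u -> teq s u.
Proof.
  intros H1 H2. pose proof (theory_rewrite (Eq (tshift s) (tvar 0)) t u H2) as Q.
  unfold inst1 in Q. simpl in Q. rewrite !tsub_inst_shift in Q. now apply Q.
Qed.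

Lemma teq_add s s' t t' : teq s s' -> teq t t' -> teq (tadd s t) (tadd s' t').
Proof.
  intros H1 H2. apply teq_trans with (tadd s' t).
  - pose proof (theory_rewrite (Eq (tadd (tshift s) (tshift t)) (tadd (tvar 0) (tshift t))) _ _ H1) as Q.
    unfold inst1 in Q. simpl in Q. rewrite !tsub_inst_shift in Q. apply Q, teq_refl.
  - pose proof (theory_rewrite (Eq (tadd (tshift s') (tshift t)) (tadd (tshift s') (tvar 0))) _ _ H2) as Q.
    unfold inst1 in Q. simpl in Q. rewrite !tsub_inst_shift in Q. apply Q, teq_refl.
Qed.

Lemma teq_mul s s' t t' : teq s s' -> teq t t' -> teq (tmul s t) (tmul s' t').
Proof.
  intros H1 H2. apply teq_trans with (tmul s' t).
  - pose proof (theory_rewrite (Eq (tmul (tshift s) (tshift t)) (tmul (tvar 0) (tshift t))) _ _ H1) as Q.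
    unfold inst1 in Q. simpl in Q. rewrite !tsub_inst_shift in Q. apply Q, teq_refl.
  - pose proof (theory_rewrite (Eq (tmul (tshift s') (tshift t)) (tmul (tshift s') (tvar 0))) _ _ H2) as Q.
    unfold inst1 in Q. simpl in Q. rewrite !tsub_inst_shift in Q. apply Q, teq_refl.
Qed.

Lemma theory_lt s s' t t' : teq s s' -> teq t t' -> theory (Lt s t) -> theory (Lt s' t').
Proof.
  intros H1 H2 H.
  pose proof (theory_rewrite (Lt (tvar 0) (tshift t)) _ _ H1) as Q.
  unfold inst1 in Q. simpl in Q. rewrite !tsub_inst_shift in Q.
  pose proof (theory_rewrite (Lt (tshift s') (tvar 0)) _ _ H2) as Q'.
  unfold inst1 in Q'. simpl in Q'. rewrite !tsub_inst_shift in Q'. auto.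
Qed.

Lemma theory_mem s s' X : teq s s' -> theory (Mem s X) -> theory (Mem s' X).
Proof. intros H1. exact (theory_rewrite (Mem (tvar 0) X) _ _ H1). Qed.

(** The quotient of the terms by provable equality. A class is represented by the predicate [teq t],
    so that equal classes are equal in Rocq and [Eq] can be interpreted by equality. *)
Definition tclass : Type := {c : tm -> Prop | exists t, c = teq t}.

Definition cls (t : tm) : tclass := exist _ (teq t) (ex_intro _ t eq_refl).

Definition rep (c : tclass) : tm :=
  proj1_sig (constructive_indefinite_description _ (proj2_sig c)).

Lemma cls_rep c : cls (rep c) = c.
Proof.
  unfold rep. destruct (constructive_indefinite_description _ _) as [t Ht]. simpl.
  destruct c as [c Hc]. simpl in *. subst c. unfold cls. f_equal. apply proof_irrelevance.
Qed.

Lemma cls_eq s t : cls s = cls t <-> teq s t.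
Proof.
  split.
  - intros H. injection H as H. rewrite H. apply teq_refl.
  - intros H. unfold cls.
    assert (E : teq s = teq t).
    { extensionality u. apply propositional_extensionality.
      split; intros; eauto using teq_trans, teq_sym. }
    generalize (ex_intro (fun t0 => teq s = teq t0) s eq_refl). rewrite E.
    intros e. f_equal. apply proof_irrelevance.
Qed.

Lemma teq_rep t : teq (rep (cls t)) t.
Proof. apply cls_eq, cls_rep. Qed.

Definition term_structure : structure := {|
  dom := tclass;
  sets := nat;
  zero := cls tzero;
  one := cls tone;
  add := fun a b => cls (tadd (rep a) (rep b));
  mul := fun a b => cls (tmul (rep a) (rep b));
  lt := fun a b => theory (Lt (rep a) (rep b));
  mem := fun a X => theory (Mem (rep a) X) |}.

Lemma teval_cls (s : nat -> tm) t :
  @teval term_structure (fun i => cls (s i)) t = cls (tsub s t).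
Proof.
  induction t; simpl; auto; rewrite IHt1, IHt2; apply cls_eq.
  - apply teq_add; apply teq_rep.
  - apply teq_mul; apply teq_rep.
Qed.

(** Stated for all substitution instances, so that the induction passes under binders: an assignment
    of classes is read as a substitution of representatives. Set variables stand for themselves. *)
Lemma truth p : forall s r,
  @sat term_structure (fun i => cls (s i)) r p <-> theory (fsub s r p).
Proof.
  assert (inst : forall t s r p, inst1 t (fsub (up s) r p) = fsub (scons t s) r p).
  { intros t s r q. unfold inst1. rewrite fsub_fsub. f_equal. extensionality i.
    destruct i; [reflexivity|]. simpl. apply tsub_inst_shift. }
  assert (inst' : forall X s r p, inst2 X (fsub s (upr r) p) = fsub s (scons X r) p).
  { intros t s r q. unfold inst2. rewrite fsub_fsub. f_equal; extensionality i.
    - apply tsub_id. - now destruct i. }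
  assert (E : forall s t, (fun i => cls (scons t s i)) = scons (cls t) (fun i => cls (s i))).
  { intros s t. extensionality i. now destruct i. }
  induction p; intros s0 r0; cbn [sat fsub]; rewrite ?teval_cls.
  - apply cls_eq.
  - split; apply theory_lt; auto using teq_rep, teq_sym.
  - split; apply theory_mem; auto using teq_rep, teq_sym.
  - split; [tauto|]. apply theory_bot.
  - rewrite theory_imp, IHp1, IHp2. reflexivity.
  - rewrite theory_and, IHp1, IHp2. reflexivity.
  - rewrite theory_or, IHp1, IHp2. reflexivity.
  - rewrite theory_all1. split; intros H.
    + intros t. fold (up s0). rewrite inst, <- IHp, E. apply H.
    + intros x. rewrite <- (cls_rep x), <- E. apply IHp. rewrite <- inst. apply H.
  - rewrite theory_ex1. split.
    + intros [x H]. exists (rep x). fold (up s0). rewrite inst, <- IHp, E, cls_rep. apply H.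
    + intros [t H]. exists (cls t). rewrite <- E. apply IHp. rewrite <- inst. apply H.
  - rewrite theory_all2. split; intros H X; specialize (H X).
    + fold (upr r0). rewrite inst', <- IHp. exact H.
    + fold (upr r0) in H. rewrite inst', <- IHp in H. exact H.
  - rewrite theory_ex2. split; intros [X H]; exists X.
    + fold (upr r0). rewrite inst', <- IHp. exact H.
    + fold (upr r0) in H. rewrite inst', <- IHp in H. exact H.
Qed.

Lemma term_structure_model : is_model T term_structure.
Proof.
  intros p Hp e E.
  replace e with (fun i => cls (rep (e i))) by (extensionality i; apply cls_rep).
  apply truth. apply theory_prv0, prv_ax, HT, Hp.
Qed.

End Henkin.

Theorem completeness T (HT : sub_closed T) p :
  (forall A, is_model T A -> forall (e : nat -> A) E, sat e E p) -> provable T p.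
Proof.
  intros H. apply NNPP. intros N.
  assert (C : con T [Imp p Bot]) by (intros Q; apply N; now apply prv_raa).
  pose proof (H _ (term_structure_model T HT _ C) (fun i => cls T [Imp p Bot] (tvar i)) (fun X => X)) as Q.
  apply (truth T HT _ C) in Q. rewrite fsub_id in Q.
  apply (theory_neg T HT _ C p); [|exact Q]. exists 0. now left.
Qed.

Lemma Sigma00_fsub p (H : Sigma00 p) : forall s r, Sigma00 (fsub s r p).
Proof.
  induction H; intros s0 r0; simpl; try (constructor; auto; fail).
  - fold (up s0). rewrite up_tshift. constructor. auto.
  - fold (up s0). rewrite up_tshift. constructor. auto.
Qed.

(** The basic axioms are closed, and the two schemes allow parameters, so that a substitution turns
    an instance into another instance. *)
Lemma RCA0_sub_closed : sub_closed RCA0.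
Proof.
  intros p s r [q H|q H|q1 q2 H1 H2].
  - apply RCA0_basic. replace (fsub s r q) with q; [exact H|].
    unfold basic_axioms in H. simpl in H.
    repeat destruct H as [<-|H]; try reflexivity. destruct H.
  - simpl. fold (up s). rewrite fsub_inst1, fsub_at_succ. apply RCA0_induction.
    destruct H. simpl. constructor. now apply Sigma00_fsub.
  - simpl. fold (up s). fold (upr r). rewrite fsub_shift2.
    apply RCA0_comprehension.
    + destruct H1. simpl. constructor. now apply Sigma00_fsub.
    + destruct H2. simpl. constructor. now apply Sigma00_fsub.
Qed.

(** The field [set0] excludes structures without sets: these would have no assignments of set
    variables at all, and would satisfy every axiom vacuously. *)
Record model := Model {
  str :> structure;
  set0 : sets str;
  str_RCA0 : is_model RCA0 str }.

(** * Definable predicates *)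

Section Definability.
Context {A : model}.
Notation env := (nat -> dom A).

(** Each variable of a formula stands for a variable of the environment or for
    a parameter. *)
Definition pick (s : nat -> nat + dom A) (e : env) : env :=
  fun i => match s i with inl j => e j | inr c => c end.

(** The semantic counterpart of [Sigma00], with parameters of both sorts. Working with Rocq
    predicates on environments lets definability be proved by following the shape of a statement,
    without writing formulas. *)
Definition def0 (P : env -> Prop) : Prop :=
  exists p s E, Sigma00 p /\ forall e, P e <-> sat (pick s e) E p.

Definition tdef (f : env -> dom A) : Prop :=
  exists t s, forall e, f e = teval (pick s e) t.

(** Two formulas with different assignments are brought under a common one by giving the even
    variables to the first and the odd variables to the second. *)
Definition weave {B : Type} (f g : nat -> B) (n : nat) : B :=
  if Nat.even n then f (Nat.div2 n) else g (Nat.div2 n).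

Lemma weave_even {B} (f g : nat -> B) n : weave f g (2 * n) = f n.
Proof. unfold weave. now rewrite Nat.even_mul, Nat.div2_double. Qed.

Lemma weave_odd {B} (f g : nat -> B) n : weave f g (S (2 * n)) = g n.
Proof. unfold weave. now rewrite Nat.even_succ, Nat.odd_mul, Nat.div2_succ_double. Qed.

Lemma pick_even s s' e : (fun i => pick (weave s s') e (2 * i)) = pick s e.
Proof. extensionality i. unfold pick. now rewrite weave_even. Qed.

Lemma pick_odd s s' e : (fun i => pick (weave s s') e (S (2 * i))) = pick s' e.
Proof. extensionality i. unfold pick. now rewrite weave_odd. Qed.

Lemma sat_even p s s' E E' (e : env) :
  sat (pick (weave s s') e) (weave E E') (fsub (fun i => tvar (2 * i)) (fun X => 2 * X) p)
  <-> sat (pick s e) E p.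
Proof.
  rewrite sat_fsub. cbn [teval]. rewrite pick_even.
  replace (fun X => weave E E' (2 * X)) with E; [tauto|].
  extensionality X. now rewrite weave_even.
Qed.

Lemma sat_odd p s s' E E' (e : env) :
  sat (pick (weave s s') e) (weave E E') (fsub (fun i => tvar (S (2 * i))) (fun X => S (2 * X)) p)
  <-> sat (pick s' e) E' p.
Proof.
  rewrite sat_fsub. cbn [teval]. rewrite pick_odd.
  replace (fun X => weave E E' (S (2 * X))) with E'; [tauto|].
  extensionality X. now rewrite weave_odd.
Qed.

Lemma def0_pair P Q : def0 P -> def0 Q ->
  exists p q s E, Sigma00 p /\ Sigma00 q /\
    (forall e, P e <-> sat (pick s e) E p) /\ (forall e, Q e <-> sat (pick s e) E q).
Proof.
  intros (p & s & E & Hp & H) (q & s' & E' & Hq & H').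
  do 2 eexists. exists (weave s s'), (weave E E'). split; [|split; [|split]].
  3: { intros e. rewrite H. symmetry. apply sat_even. }
  3: { intros e. rewrite H'. symmetry. apply sat_odd. }
  all: now apply Sigma00_fsub.
Qed.

Lemma def0_ext P Q : def0 P -> (forall e, Q e <-> P e) -> def0 Q.
Proof.
  intros (p & s & E & Hp & H) HQ. exists p, s, E. split; [exact Hp|].
  intros e. now rewrite HQ.
Qed.

Lemma def0_false : def0 (fun _ => False).
Proof. exists Bot, (fun _ => inr zero), (fun _ => set0 A). split; [constructor|]. simpl. tauto. Qed.

Lemma def0_imp P Q : def0 P -> def0 Q -> def0 (fun e => P e -> Q e).
Proof.
  intros HP HQ. destruct (def0_pair P Q HP HQ) as (p & q & s & E & Hp & Hq & H & H').
  exists (Imp p q), s, E. split; [now constructor|]. intros e. simpl. now rewrite H, H'.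
Qed.

Lemma def0_and P Q : def0 P -> def0 Q -> def0 (fun e => P e /\ Q e).
Proof.
  intros HP HQ. destruct (def0_pair P Q HP HQ) as (p & q & s & E & Hp & Hq & H & H').
  exists (And p q), s, E. split; [now constructor|]. intros e. simpl. now rewrite H, H'.
Qed.

Lemma def0_or P Q : def0 P -> def0 Q -> def0 (fun e => P e \/ Q e).
Proof.
  intros HP HQ. destruct (def0_pair P Q HP HQ) as (p & q & s & E & Hp & Hq & H & H').
  exists (Or p q), s, E. split; [now constructor|]. intros e. simpl. now rewrite H, H'.
Qed.

Lemma def0_not P : def0 P -> def0 (fun e => ~ P e).
Proof. intros H. apply (def0_imp P _ H def0_false). Qed.

Lemma def0_iff P Q : def0 P -> def0 Q -> def0 (fun e => P e <-> Q e).
Proof. intros. apply def0_and; now apply def0_imp. Qed.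

Definition comp_pick (s' s : nat -> nat + dom A) (i : nat) : nat + dom A :=
  match s i with inl j => s' j | inr c => inr c end.

Lemma pick_comp s' s (e : env) : pick (comp_pick s' s) e = pick s (pick s' e).
Proof. extensionality i. unfold pick, comp_pick. now destruct (s i). Qed.

Lemma def0_pick P s : def0 P -> def0 (fun e => P (pick s e)).
Proof.
  intros (p & s' & E & Hp & H). exists p, (comp_pick s s'), E. split; [exact Hp|].
  intros e. now rewrite pick_comp.
Qed.

Lemma def0_ren P r : def0 P -> def0 (fun e => P (fun i => e (r i))).
Proof. apply def0_pick with (s := fun i => inl (r i)). Qed.

(** The formula obtained from one under [s] by binding variable 0 of the
    environment. *)
Definition bind_tm (s : nat -> nat + dom A) (i : nat) : tm :=
  match s i with inl 0 => tvar 0 | _ => tvar (S i) end.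

Definition bind_pick (s : nat -> nat + dom A) (i : nat) : nat + dom A :=
  match s i with inl (S j) => inl j | inl 0 => inr zero | inr c => inr c end.

Lemma pick_bind s (x : A) e :
  (fun i => teval (scons x (pick (bind_pick s) e)) (bind_tm s i)) = pick s (scons x e).
Proof.
  extensionality i. unfold pick, bind_tm, bind_pick.
  destruct (s i) as [[|j]|c] eqn:Q; simpl; rewrite ?Q; reflexivity.
Qed.

(** Brings a bounding term and a matrix under one assignment in which variable 0 is reserved for the
    bound variable and does not occur in the term, as the bounded quantifiers of [Sigma00]
    require. *)
Lemma tdef_def0 (f : env -> A) P : tdef f -> def0 P ->
  exists t p s E, Sigma00 p /\ (forall e, f e = teval (pick (bind_pick s) e) t) /\
    forall x e, P (scons x e) <-> sat (scons x (pick (bind_pick s) e)) E (fsub (bind_tm s) (fun X => X) p).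
Proof.
  intros (t & s & Ht) (p & s' & E & Hp & H).
  exists (tsub (fun i => tvar (2 * i)) t), (fsub (fun i => tvar (S (2 * i))) (fun X => X) p),
    (weave (comp_pick (fun i => inl (S i)) s) s'), E. split; [|split].
  - now apply Sigma00_fsub.
  - intros e. rewrite teval_tsub, Ht. f_equal. extensionality i. cbn [teval].
    unfold pick, bind_pick. rewrite weave_even. unfold comp_pick. now destruct (s i).
  - intros x e. rewrite H. rewrite !sat_fsub. rewrite pick_bind. cbn [teval].
    rewrite pick_odd. tauto.
Qed.

Lemma def0_ball (f : env -> A) (P : env -> A -> Prop) :
  tdef f -> def0 (fun e => P (fun i => e (S i)) (e 0)) ->
  def0 (fun e => forall x, lt x (f e) -> P e x).
Proof.
  intros Hf HP. destruct (tdef_def0 _ _ Hf HP) as (t & p & s & E & Hp & Ht & H).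
  exists (All1 (Imp (Lt (tvar 0) (tshift t)) (fsub (bind_tm s) (fun X => X) p))), (bind_pick s), E.
  split; [constructor; now apply Sigma00_fsub|]. intros e.
  split; intros Q x; specialize (Q x); specialize (H x e); cbn [sat teval scons] in *;
    unfold tshift in *; rewrite teval_tsub in *; cbn [teval scons] in *;
    change (fun i => pick (bind_pick s) e i) with (pick (bind_pick s) e) in *;
    rewrite <- Ht in *; tauto.
Qed.

Lemma def0_bex (f : env -> A) (P : env -> A -> Prop) :
  tdef f -> def0 (fun e => P (fun i => e (S i)) (e 0)) ->
  def0 (fun e => exists x, lt x (f e) /\ P e x).
Proof.
  intros Hf HP. apply (def0_ext (fun e => ~ forall x, lt x (f e) -> ~ P e x)).
  - apply def0_not. apply (def0_ball f (fun e x => ~ P e x)); [exact Hf|].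
    now apply def0_not.
  - intros e. split.
    + intros (x & H1 & H2) Q. exact (Q x H1 H2).
    + intros H. apply NNPP. intros N. apply H. intros x H1 H2. apply N. eauto.
Qed.

Lemma tdef_var i : tdef (fun e => e i).
Proof. exists (tvar 0), (fun _ => inl i). reflexivity. Qed.

Lemma tdef_const c : tdef (fun _ => c).
Proof. exists (tvar 0), (fun _ => inr c). reflexivity. Qed.

Lemma tdef_op (o : A -> A -> A) (o' : tm -> tm -> tm) f g :
  (forall e a b, teval e (o' a b) = o (teval e a) (teval e b)) ->
  (forall s a b, tsub s (o' a b) = o' (tsub s a) (tsub s b)) ->
  tdef f -> tdef g -> tdef (fun e => o (f e) (g e)).
Proof.
  intros Ho Ho' (t & s & H) (t' & s' & H').
  exists (o' (tsub (fun i => tvar (2 * i)) t) (tsub (fun i => tvar (S (2 * i))) t')), (weave s s').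
  intros e. rewrite Ho, !teval_tsub, H, H'. cbn [teval]. now rewrite pick_even, pick_odd.
Qed.

Lemma tdef_add f g : tdef f -> tdef g -> tdef (fun e => add (f e) (g e)).
Proof. apply (tdef_op add tadd); reflexivity. Qed.

Lemma tdef_mul f g : tdef f -> tdef g -> tdef (fun e => mul (f e) (g e)).
Proof. apply (tdef_op mul tmul); reflexivity. Qed.

Lemma tdef_pair f g : tdef f -> tdef g ->
  exists t t' s, (forall e, f e = teval (pick s e) t) /\ (forall e, g e = teval (pick s e) t').
Proof.
  intros (t & s & H) (t' & s' & H').
  exists (tsub (fun i => tvar (2 * i)) t), (tsub (fun i => tvar (S (2 * i))) t'), (weave s s').
  split; intros e; rewrite !teval_tsub, ?H, ?H'; cbn [teval]; now rewrite ?pick_even, ?pick_odd.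
Qed.

Lemma def0_eq f g : tdef f -> tdef g -> def0 (fun e => f e = g e).
Proof.
  intros Hf Hg. destruct (tdef_pair f g Hf Hg) as (t & t' & s & H & H').
  exists (Eq t t'), s, (fun _ => set0 A). split; [constructor|]. intros e.
  simpl. now rewrite H, H'.
Qed.

Lemma def0_lt f g : tdef f -> tdef g -> def0 (fun e => lt (f e) (g e)).
Proof.
  intros Hf Hg. destruct (tdef_pair f g Hf Hg) as (t & t' & s & H & H').
  exists (Lt t t'), s, (fun _ => set0 A). split; [constructor|]. intros e.
  simpl. now rewrite H, H'.
Qed.

Lemma def0_mem f X : tdef f -> def0 (fun e => mem (f e) X).
Proof.
  intros (t & s & H). exists (Mem t 0), s, (fun _ => X). split; [constructor|].
  intros e. simpl. now rewrite H.
Qed.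

Definition sigma (P : env -> Prop) : Prop :=
  exists R, def0 R /\ forall e, P e <-> exists x, R (scons x e).

Lemma sigma_ext P Q : sigma P -> (forall e, Q e <-> P e) -> sigma Q.
Proof. intros (R & HR & H) HQ. exists R. split; [exact HR|]. intros e. now rewrite HQ. Qed.

Lemma def0_sigma P : def0 P -> sigma P.
Proof.
  intros H. exists (fun e => P (fun i => e (S i))). split; [now apply def0_ren with (r := S)|].
  intros e. simpl. split; [intros Q; exists zero|intros [_ Q]]; exact Q.
Qed.

Lemma sigma_pick P s : sigma P -> sigma (fun e => P (pick s e)).
Proof.
  intros (R & HR & H).
  pose (s' i := match i with
    | 0 => inl 0
    | S j => match s j with inl k => inl (S k) | inr c => inr c end end).
  exists (fun e => R (pick s' e)).
  split; [now apply def0_pick|].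
  intros e. rewrite H.
  assert (Q : forall x, pick s' (scons x e) = scons x (pick s e)).
  { intros x; extensionality i; destruct i as [|i]; [reflexivity|].
    unfold pick, s'. simpl. now destruct (s i). }
  split; intros [x Hx]; exists x; now rewrite Q in *.
Qed.

Lemma sigma_ren P r : sigma P -> sigma (fun e => P (fun i => e (r i))).
Proof. apply sigma_pick with (s := fun i => inl (r i)). Qed.

(** A predicate of one number [x] may be evaluated in the constant environment [fun _ => x]. So the
    variables above 0 of the environment all become variable 1, and the parameters become the
    variables from 2 on, with values given by [close_env]. *)
Definition close_tm (s : nat -> nat + dom A) (i : nat) : tm :=
  match s i with inl 0 => tvar 0 | inl (S _) => tvar 1 | inr _ => tvar (S (S i)) end.

Definition close_env (s : nat -> nat + dom A) (i : nat) : dom A :=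
  match s i with inl _ => zero | inr c => c end.

Lemma sat_close p s E (x y : A) :
  sat (scons y (scons x (close_env s))) E (fsub (close_tm s) (fun X => X) p)
  <-> sat (pick s (scons y (fun _ => x))) E p.
Proof.
  rewrite sat_fsub.
  replace (fun i => teval _ (close_tm s i)) with (pick s (scons y (fun _ => x))); [tauto|].
  extensionality i. unfold pick, close_tm, close_env.
  destruct (s i) as [[|j]|c] eqn:Q; simpl; rewrite ?Q; reflexivity.
Qed.

Lemma sigma_ind (P : A -> Prop) : sigma (fun e => P (e 0)) ->
  P zero -> (forall x, P x -> P (add x one)) -> forall x, P x.
Proof.
  intros (R & (p & s & E & Hp & H) & HR) H0 HS.
  pose (q := fsub (close_tm s) (fun X => X) p).
  assert (HP : forall x, P x <-> sat (scons x (close_env s)) E (Ex1 q)).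
  { intros x. rewrite (HR (fun _ => x)). simpl. unfold q.
    split; intros [y Hy]; exists y; [apply H in Hy|apply H]; now apply sat_close. }
  pose proof (str_RCA0 A _ (RCA0_induction (Ex1 q) (Sigma01_ex _ (Sigma00_fsub _ Hp _ _)))
    (close_env s) E) as I.
  intros x. apply HP. apply I. split.
  - apply sat_fsub. apply HP in H0.
    replace (fun i => teval _ _) with (scons zero (close_env s)); [exact H0|].
    extensionality i. now destruct i.
  - intros z Hz. apply sat_fsub. apply HP in Hz. apply HS in Hz. apply HP in Hz.
    replace (fun i => teval _ _) with (scons (add z one) (close_env s)); [exact Hz|].
    extensionality i. now destruct i.
Qed.

(** The Pi01 formula wanted by the axiom is obtained from the Sigma01 definition of the complement
    by negating the matrix. *)
Lemma comprehension (P : A -> Prop) :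
  sigma (fun e => P (e 0)) -> sigma (fun e => ~ P (e 0)) ->
  exists X, forall x, mem x X <-> P x.
Proof.
  intros (R & HR & H) (R' & HR' & H').
  destruct (def0_pair R R' HR HR') as (p & q & s & E & Hp & Hq & Ep & Eq).
  pose (p1 := fsub (close_tm s) (fun X => X) p).
  pose (q1 := fsub (close_tm s) (fun X => X) q).
  assert (HP : forall x, P x <-> sat (scons x (close_env s)) E (Ex1 p1)).
  { intros x. rewrite (H (fun _ => x)). simpl. unfold p1.
    split; intros [y Hy]; exists y; [apply Ep in Hy|apply Ep]; now apply sat_close. }
  assert (HQ : forall x, P x <-> sat (scons x (close_env s)) E (All1 (Imp q1 Bot))).
  { intros x. specialize (H' (fun _ => x)). simpl in *. unfold q1. split.
    - intros Px y Hy. apply sat_close, Eq in Hy. apply (proj2 H'); eauto.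
    - intros Hall. apply NNPP. intros N. apply H' in N as [y Hy]. apply Eq, sat_close in Hy. eauto. }
  pose proof (str_RCA0 A _ (RCA0_comprehension (Ex1 p1) (All1 (Imp q1 Bot))
    (Sigma01_ex _ (Sigma00_fsub _ Hp _ _))
    (Pi01_all _ (Sigma00_imp _ _ (Sigma00_fsub _ Hq _ _) Sigma00_bot)))
    (close_env s) E) as I.
  assert (J : sat (close_env s) E (Ex2 (All1 (Iff (Mem (tvar 0) 0) (shift2 (Ex1 p1)))))).
  { apply I. intros x. split; intros Q; [apply HQ, HP|apply HP, HQ]; exact Q. }
  destruct J as [X HX]. exists X. intros x. specialize (HX x). rewrite HP.
  assert (K : sat (scons x (close_env s)) (scons X E) (shift2 (Ex1 p1)) <->
              sat (scons x (close_env s)) E (Ex1 p1)) by exact (sat_fsub _ _ _ _ tvar S).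
  rewrite <- K. split; [apply (proj1 HX)|apply (proj2 HX)].
Qed.

Lemma def0_ind (P : A -> Prop) : def0 (fun e => P (e 0)) ->
  P zero -> (forall x, P x -> P (add x one)) -> forall x, P x.
Proof. intros H. apply sigma_ind. now apply def0_sigma. Qed.

Lemma sigma_ex0 (P : env -> A -> Prop) :
  def0 (fun e => P (fun i => e (S i)) (e 0)) -> sigma (fun e => exists x, P e x).
Proof. intros H. eexists. split; [exact H|]. reflexivity. Qed.

End Definability.

Ltac tdef :=
  cbv beta;
  lazymatch goal with
  | |- tdef (fun e => add (@?f e) (@?g e)) => apply (tdef_add f g); tdef
  | |- tdef (fun e => mul (@?f e) (@?g e)) => apply (tdef_mul f g); tdef
  | |- tdef (fun e => e ?i) => apply (tdef_var i)
  | |- tdef (fun _ => ?c) => apply (tdef_const c)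
  end.

Ltac def0 :=
  cbv beta;
  lazymatch goal with
  | |- def0 (fun e => @?P e /\ @?Q e) => apply (def0_and P Q); def0
  | |- def0 (fun e => @?P e \/ @?Q e) => apply (def0_or P Q); def0
  | |- def0 (fun e => @?P e <-> @?Q e) => apply (def0_iff P Q); def0
  | |- def0 (fun e => ~ @?P e) => apply (def0_not P); def0
  | |- def0 (fun e => forall x, lt x (@?f e) -> @?P e x) => apply (def0_ball f P); [tdef|def0]
  | |- def0 (fun e => exists x, lt x (@?f e) /\ @?P e x) => apply (def0_bex f P); [tdef|def0]
  | |- def0 (fun e => @?P e -> @?Q e) => apply (def0_imp P Q); def0
  | |- def0 (fun e => @?f e = @?g e) => apply (def0_eq f g); tdef
  | |- def0 (fun e => lt (@?f e) (@?g e)) => apply (def0_lt f g); tdef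
  | |- def0 (fun e => mem (@?f e) ?X) => apply (def0_mem f X); tdef
  | |- def0 (fun _ => False) => apply def0_false
  | |- def0 _ => idtac
  end.

Definition le {A : model} (a b : A) : Prop := lt a (add b one).

Ltac ind0 :=
  match goal with |- forall x, @?P x => refine (def0_ind P _ _ _); cbv beta end.
Ltac ind1 :=
  match goal with |- forall x, @?P x => refine (sigma_ind P _ _ _); cbv beta end.

(** * Arithmetic *)

Section Arithmetic.
Context {A : model}.
Notation "0" := (@zero A).
Notation "1" := (@one A).
Infix "+" := (@add A).
Infix "*" := (@mul A).
Infix "<" := (@lt A).

(** Satisfaction of a closed formula computes to its intended statement, so each of the lemmas below
    is an axiom, taken by its position in the list, up to conversion. *)
Lemma basic_sat k : Nat.lt k (length basic_axioms) ->
  sat (fun _ => 0) (fun _ => set0 A) (List.nth k basic_axioms Bot).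
Proof. intros H. apply str_RCA0, RCA0_basic, nth_In, H. Qed.

Lemma succ_neq0 : forall n : A, ~ (n + 1 = 0). Proof. refine (basic_sat 0 _). cbn. lia. Qed.
Lemma succ_inj : forall m n : A, m + 1 = n + 1 -> m = n. Proof. refine (basic_sat 1 _). cbn. lia. Qed.
Lemma add_0_r : forall m : A, m + 0 = m. Proof. refine (basic_sat 2 _). cbn. lia. Qed.
Lemma add_succ_r : forall m n : A, m + (n + 1) = (m + n) + 1. Proof. refine (basic_sat 3 _). cbn. lia. Qed.
Lemma mul_0_r : forall m : A, m * 0 = 0. Proof. refine (basic_sat 4 _). cbn. lia. Qed.
Lemma mul_succ_r : forall m n : A, m * (n + 1) = (m * n) + m. Proof. refine (basic_sat 5 _). cbn. lia. Qed.
Lemma not_lt_0 : forall m : A, ~ (m < 0). Proof. refine (basic_sat 6 _). cbn. lia. Qed.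
Lemma lt_succ : forall m n : A, m < n + 1 <-> (m < n \/ m = n). Proof. refine (basic_sat 7 _). cbn. lia. Qed.

Lemma add_0_l m : 0 + m = m.
Proof.
  revert m. ind0; [def0|apply add_0_r|]. intros x H. now rewrite add_succ_r, H.
Qed.

Lemma add_succ_l m n : (m + 1) + n = (m + n) + 1.
Proof.
  revert n. ind0; [def0| |].
  - now rewrite !add_0_r.
  - intros x H. now rewrite !add_succ_r, H.
Qed.

Lemma add_comm m n : m + n = n + m.
Proof.
  revert n. ind0; [def0| |].
  - now rewrite add_0_r, add_0_l.
  - intros x H. now rewrite add_succ_r, add_succ_l, H.
Qed.

Lemma add_assoc m n k : m + (n + k) = m + n + k.
Proof.
  revert k. ind0; [def0| |].
  - now rewrite !add_0_r.
  - intros x H. now rewrite !add_succ_r, H.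
Qed.

Lemma mul_0_l m : 0 * m = 0.
Proof.
  revert m. ind0; [def0|apply mul_0_r|]. intros x H. now rewrite mul_succ_r, H, add_0_r.
Qed.

Lemma mul_succ_l m n : (m + 1) * n = m * n + n.
Proof.
  revert n. ind0; [def0| |].
  - now rewrite !mul_0_r, add_0_r.
  - intros x H. rewrite !mul_succ_r, H, !add_succ_r. f_equal.
    rewrite <- !add_assoc. f_equal. apply add_comm.
Qed.

Lemma mul_comm m n : m * n = n * m.
Proof.
  revert n. ind0; [def0| |].
  - now rewrite mul_0_r, mul_0_l.
  - intros x H. now rewrite mul_succ_r, mul_succ_l, H.
Qed.

Lemma mul_add_r m n k : m * (n + k) = m * n + m * k.
Proof.
  revert k. ind0; [def0| |].
  - now rewrite mul_0_r, !add_0_r.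
  - intros x H. now rewrite add_succ_r, !mul_succ_r, H, add_assoc.
Qed.

Lemma mul_assoc m n k : m * (n * k) = m * n * k.
Proof.
  revert k. ind0; [def0| |].
  - now rewrite !mul_0_r.
  - intros x H. now rewrite !mul_succ_r, mul_add_r, H.
Qed.

Lemma mul_1_l m : 1 * m = m.
Proof. rewrite <- (add_0_l 1), mul_succ_l, mul_0_l. apply add_0_l. Qed.

Lemma add_cancel_r m n k : m + k = n + k -> m = n.
Proof.
  revert k. ind0; [def0| |].
  - now rewrite !add_0_r.
  - intros x H. rewrite !add_succ_r. intros E. now apply H, succ_inj.
Qed.

Lemma zero_or_succ m : m = 0 \/ exists n, m = n + 1.
Proof.
  revert m. ind1.
  (* So far [sigma] can be proved only for one leading quantifier over a bounded matrix; the
     disjunction is therefore put in prenex form by hand. *)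
  - apply (sigma_ext (fun e => exists n, e 0%nat = 0 \/ e 0%nat = n + 1)).
    + apply (sigma_ex0 (fun e n => e 0%nat = 0 \/ e 0%nat = n + 1)). def0.
    + intros e. split; [intros [H|[n H]]; [exists 0|exists n]; auto|intros [n [H|H]]; eauto].
  - now left.
  - intros x _. right. now exists x.
Qed.

Lemma lt_add_succ a d : a < a + (d + 1).
Proof.
  revert d. ind0; [def0| |].
  - rewrite add_0_l. apply lt_succ. now right.
  - intros d H. rewrite add_succ_r. apply lt_succ. now left.
Qed.

Lemma lt_iff a b : a < b <-> exists d, b = a + (d + 1).
Proof.
  split; [|intros [d ->]; apply lt_add_succ].
  revert b. ind1.
  - apply (sigma_ext (fun e => exists d, a < e 0%nat -> e 0%nat = a + (d + 1))).
    + apply (sigma_ex0 (fun e d => a < e 0%nat -> e 0%nat = a + (d + 1))). def0.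
    + intros e. destruct (classic (a < e 0%nat)) as [H|H].
      * split; [intros Q; destruct (Q H) as [d Hd]; eauto|intros [d Hd] _; eauto].
      * split; [intros _; exists 0; tauto|tauto].
  - intros H. now apply not_lt_0 in H.
  - intros b H Q. apply lt_succ in Q as [Q| ->].
    + destruct (H Q) as [d ->]. exists (d + 1). now rewrite (add_succ_r a (d + 1)).
    + exists 0. now rewrite add_0_l.
Qed.

Lemma lt_total a b : a < b \/ a = b \/ b < a.
Proof.
  revert b. ind0; [def0| |].
  - destruct (zero_or_succ a) as [H|[n ->]]; [auto|]. right. right. apply lt_iff.
    exists n. now rewrite add_0_l.
  - intros b [H|[->|H]].
    + left. apply lt_succ. auto.
    + left. apply lt_succ. auto.
    + right. apply lt_iff in H as [d ->].
      destruct (zero_or_succ d) as [-> |[k ->]].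
      * left. now rewrite add_0_l.
      * right. apply lt_iff. exists k. now rewrite <- (add_assoc b 1 (k + 1)), (add_comm 1 (k + 1)).
Qed.

End Arithmetic.

(** * The ring of integers of a model *)

Section Semiring.
Context {A : model}.

Lemma semiring : Ring_theory.semi_ring_theory (@zero A) one add mul eq.
Proof.
  constructor; intros; auto using add_0_l, add_comm, add_assoc, mul_1_l, mul_0_l, mul_comm, mul_assoc.
  now rewrite mul_comm, mul_add_r, (mul_comm p n), (mul_comm p m).
Qed.
Add Ring model_ring : semiring.

Notation "0" := (@zero A).
Infix "+" := (@add A).
Infix "*" := (@mul A).

(** Truncated subtraction. The choice is determined by [sub_spec], from which its computability is
    derived later. *)
Definition sub (a b : A) : A := epsilon (inhabits 0) (fun d => a = b + d \/ (lt a b /\ d = 0)).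

Lemma sub_spec a b : a = b + sub a b \/ (lt a b /\ sub a b = 0).
Proof.
  unfold sub. apply epsilon_spec. destruct (lt_total a b) as [H|[->|H]].
  - exists 0. auto.
  - exists 0. left. ring.
  - apply lt_iff in H as [d ->]. exists (d + one). auto.
Qed.

Lemma sub_add a b : sub (b + a) b = a.
Proof.
  destruct (sub_spec (b + a) b) as [H|[H _]].
  - symmetry. apply (add_cancel_r _ _ b). rewrite (add_comm a), (add_comm (sub _ _)). exact H.
  - exfalso. apply lt_iff in H as [d H]. apply (succ_neq0 (a + d)).
    apply (add_cancel_r _ _ b). rewrite add_0_l. etransitivity; [|symmetry; exact H]. ring.
Qed.

Lemma sub_add0 a b : sub a (a + b) = 0.
Proof.
  destruct (zero_or_succ b) as [->|[d ->]].
  - rewrite add_0_r. rewrite <- (add_0_r a) at 1. apply sub_add.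
  - destruct (sub_spec a (a + (d + one))) as [H|[_ H]]; [|exact H].
    exfalso. apply (succ_neq0 (d + sub a (a + (d + one)))).
    apply (add_cancel_r _ _ a). rewrite add_0_l. etransitivity; [|symmetry; exact H]. ring.
Qed.

Lemma sub_diag a : sub a a = 0.
Proof. rewrite <- (add_0_r a) at 2. apply sub_add0. Qed.

Lemma sub_0_r a : sub a 0 = a.
Proof. rewrite <- (add_0_l a) at 1. apply sub_add. Qed.

Lemma sub_0_l a : sub 0 a = 0.
Proof. rewrite <- (add_0_l a). apply sub_add0. Qed.

(** Differences of numbers in normal form: one of the two numbers is 0. *)
Definition Z : Type := {p : A * A | fst p = 0 \/ snd p = 0}.

Lemma norm_nf a b : fst (sub a b, sub b a) = 0 \/ snd (sub a b, sub b a) = 0.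
Proof.
  simpl. destruct (lt_total a b) as [H|[->|H]].
  - left. apply lt_iff in H as [d ->]. apply sub_add0.
  - left. apply sub_diag.
  - right. apply lt_iff in H as [d ->]. apply sub_add0.
Qed.

Definition norm (a b : A) : Z := exist _ (sub a b, sub b a) (norm_nf a b).

Lemma Z_eq (x y : Z) : proj1_sig x = proj1_sig y -> x = y.
Proof. destruct x, y. simpl. intros ->. f_equal. apply proof_irrelevance. Qed.

Lemma norm_cases a b : exists d, (a = b + d /\ proj1_sig (norm a b) = (d, 0)) \/
  (b = a + d /\ proj1_sig (norm a b) = (0, d)).
Proof.
  simpl. destruct (lt_total a b) as [H|[->|H]].
  - apply lt_iff in H as [d ->]. exists (d + one). right. now rewrite sub_add, sub_add0.
  - exists 0. left. rewrite add_0_r. split; [reflexivity|].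
    now rewrite sub_diag.
  - apply lt_iff in H as [d ->]. exists (d + one). left. now rewrite sub_add, sub_add0.
Qed.

Lemma norm_eq a b a' b' : norm a b = norm a' b' <-> a + b' = a' + b.
Proof.
  destruct (norm_cases a b) as [d H], (norm_cases a' b') as [d' H'].
  split.
  - intros E. rewrite E in H.
    destruct H as [[-> H]|[-> H]], H' as [[-> H']|[-> H']]; rewrite H' in H; inversion H; subst; ring.
  - intros E. apply Z_eq.
    destruct H as [[-> ->]|[-> ->]], H' as [[-> ->]|[-> ->]].
    + f_equal. apply (add_cancel_r _ _ (b + b')). transitivity (b + d + b'); [ring|]. rewrite E. ring.
    + assert (Q : (d + d') = 0).
      { apply (add_cancel_r _ _ (b + a')). transitivity (b + d + (a' + d')); [ring|]. rewrite E. ring. }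
      destruct (zero_or_succ d) as [->|[k ->]];
        [|exfalso; apply (succ_neq0 (k + d')); rewrite <- Q; ring].
      rewrite add_0_l in Q. now subst.
    + assert (Q : (d + d') = 0).
      { apply (add_cancel_r _ _ (a + b')). transitivity (b' + d' + (a + d)); [ring|]. rewrite <- E. ring. }
      destruct (zero_or_succ d) as [->|[k ->]];
        [|exfalso; apply (succ_neq0 (k + d')); rewrite <- Q; ring].
      rewrite add_0_l in Q. now subst.
    + f_equal. apply (add_cancel_r _ _ (a + a')). transitivity (a' + (a + d)); [ring|]. rewrite <- E. ring.
Qed.

Lemma norm_fst_snd (x : Z) : x = norm (fst (proj1_sig x)) (snd (proj1_sig x)).
Proof.
  apply Z_eq. destruct x as [[a b] [H|H]]; simpl in *; subst.
  - now rewrite sub_0_l, sub_0_r.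
  - now rewrite sub_0_l, sub_0_r.
Qed.

Lemma Z_ind (P : Z -> Prop) : (forall a b, P (norm a b)) -> forall x, P x.
Proof. intros H x. rewrite (norm_fst_snd x). apply H. Qed.

Definition Zop2 (f : A * A -> A * A -> A * A) (x y : Z) : Z :=
  let p := f (proj1_sig x) (proj1_sig y) in norm (fst p) (snd p).

Definition Zadd := Zop2 (fun p q => (fst p + fst q, snd p + snd q)).
Definition Zmul := Zop2 (fun p q => (fst p * fst q + snd p * snd q, fst p * snd q + snd p * fst q)).
Definition Zopp (x : Z) : Z := norm (snd (proj1_sig x)) (fst (proj1_sig x)).

Lemma Zadd_norm a b c d : Zadd (norm a b) (norm c d) = norm (a + c) (b + d).
Proof.
  apply norm_eq.
  destruct (norm_cases a b) as [x [[-> ->]|[-> ->]]], (norm_cases c d) as [y [[-> ->]|[-> ->]]];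
    cbn [fst snd]; ring.
Qed.

Lemma Zmul_norm a b c d : Zmul (norm a b) (norm c d) = norm (a * c + b * d) (a * d + b * c).
Proof.
  apply norm_eq.
  destruct (norm_cases a b) as [x [[-> ->]|[-> ->]]], (norm_cases c d) as [y [[-> ->]|[-> ->]]];
    cbn [fst snd]; ring.
Qed.

Lemma Zopp_norm a b : Zopp (norm a b) = norm b a.
Proof.
  apply norm_eq.
  destruct (norm_cases a b) as [x [[-> ->]|[-> ->]]]; cbn [fst snd]; ring.
Qed.

Definition Zpos (x : Z) : Prop := snd (proj1_sig x) = 0.

Lemma Zpos_norm a b : Zpos (norm a b) <-> exists d, a = b + d.
Proof.
  unfold Zpos. destruct (norm_cases a b) as [x [[-> ->]|[-> ->]]]; simpl.
  - split; eauto.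
  - split.
    + intros ->. exists 0. ring.
    + intros [d Hd]. destruct (zero_or_succ x) as [->|[k ->]]; [reflexivity|].
      exfalso. apply (succ_neq0 (d + k)). apply (add_cancel_r _ _ a).
      rewrite add_0_l. etransitivity; [|symmetry; exact Hd]. ring.
Qed.

Lemma Zpos_iff x : Zpos x <-> exists a, x = norm a 0.
Proof.
  split.
  - intros H. exists (fst (proj1_sig x)). rewrite (norm_fst_snd x) at 1. now rewrite H.
  - intros [a ->]. apply Zpos_norm. exists a. ring.
Qed.

(** The algebraic hierarchy asks for an inverse on the units that is the identity elsewhere; the
    case distinction is made by choice. *)
Definition Zinv (x : Z) : Z := epsilon (inhabits x)
  (fun y => Zmul y x = norm one 0 \/ (~ (exists y, Zmul y x = norm one 0) /\ y = x)).

Lemma Zinv_spec x : Zmul (Zinv x) x = norm one 0 \/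
  (~ (exists y, Zmul y x = norm one 0) /\ Zinv x = x).
Proof.
  unfold Zinv. apply epsilon_spec.
  destruct (classic (exists y, Zmul y x = norm one 0)) as [[y H]|H]; eauto.
Qed.

Lemma Zmul_eq0 x y : Zmul x y = norm 0 0 -> x = norm 0 0 \/ y = norm 0 0.
Proof.
  assert (P : forall a b, a * b = 0 -> a = 0 \/ b = 0).
  { intros a b H. destruct (zero_or_succ a) as [->|[k ->]]; [auto|].
    destruct (zero_or_succ b) as [->|[l ->]]; [auto|].
    exfalso. apply (succ_neq0 (k * l + k + l)). rewrite <- H. ring. }
  pattern x; apply Z_ind; intros a b. pattern y; apply Z_ind; intros c d.
  rewrite Zmul_norm, !norm_eq. rewrite !add_0_l, !add_0_r.
  destruct (norm_cases a b) as [u [[-> _]|[-> _]]], (norm_cases c d) as [v [[-> _]|[-> _]]]; intros H;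
  (destruct (P u v) as [-> | ->]; [|left; ring|right; ring]).
  - apply (add_cancel_r _ _ (b * (d + v) + (b + u) * d)). rewrite add_0_l.
    transitivity ((b + u) * (d + v) + b * d); [ring|]. rewrite H. ring.
  - apply (add_cancel_r _ _ ((b + u) * c + b * (c + v))). rewrite add_0_l. symmetry. rewrite H at 1. ring.
  - apply (add_cancel_r _ _ (a * (d + v) + (a + u) * d)). rewrite add_0_l. symmetry. rewrite H at 1. ring.
  - apply (add_cancel_r _ _ (a * (c + v) + (a + u) * c)). rewrite add_0_l.
    transitivity (a * c + (a + u) * (c + v)); [ring|]. rewrite H. ring.
Qed.

End Semiring.

Ltac Zring :=
  repeat (let x := fresh in intros x; pattern x; apply Z_ind; clear x; intros ? ?);
  rewrite ?Zopp_norm, ?Zadd_norm, ?Zmul_norm, ?Zadd_norm, ?Zmul_norm, ?Zadd_norm;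
  apply norm_eq.

Section ZLaws.
Context {A : model}.
Add Ring model_ring2 : (@semiring A).
Lemma ZaddA (x y z : @Z A) : Zadd x (Zadd y z) = Zadd (Zadd x y) z.
Proof. revert x y z; Zring; ring. Qed.
Lemma ZaddC (x y : @Z A) : Zadd x y = Zadd y x.
Proof. revert x y; Zring; ring. Qed.
Lemma Zadd0 (x : @Z A) : Zadd (norm zero zero) x = x.
Proof. revert x; Zring; ring. Qed.
Lemma ZaddN (x : @Z A) : Zadd (Zopp x) x = norm zero zero.
Proof. revert x; Zring; ring. Qed.
Lemma ZmulA (x y z : @Z A) : Zmul x (Zmul y z) = Zmul (Zmul x y) z.
Proof. revert x y z; Zring; ring. Qed.
Lemma ZmulC (x y : @Z A) : Zmul x y = Zmul y x.
Proof. revert x y; Zring; ring. Qed.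
Lemma Zmul1 (x : @Z A) : Zmul (norm one zero) x = x.
Proof. revert x; Zring; ring. Qed.
Lemma ZmulDl (x y z : @Z A) : Zmul (Zadd x y) z = Zadd (Zmul x z) (Zmul y z).
Proof. revert x y z; Zring; ring. Qed.
End ZLaws.

(** * The integers of a model as an ordered integral domain *)

Module ZInstances.
Import ssreflect ssrfun ssrbool eqtype choice order ssralg ssrnum boolp.
Import GRing.Theory.

HB.instance Definition _ (A : model) := gen_eqMixin (@Z A).
HB.instance Definition _ (A : model) := gen_choiceMixin (@Z A).
HB.instance Definition _ (A : model) := GRing.isZmodule.Build (@Z A) (@ZaddA A) (@ZaddC A) (@Zadd0 A) (@ZaddN A).

Lemma Zone_neq0 (A : model) : (norm one zero : @Z A) != norm zero zero.
Proof.
  apply/eqP => /norm_eq H. apply: (succ_neq0 (@zero A)). by rewrite add_0_l -{1}(add_0_r one) H add_0_r.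
Qed.

HB.instance Definition _ (A : model) := GRing.Zmodule_isComNzRing.Build (@Z A)
  (@ZmulA A) (@ZmulC A) (@Zmul1 A) (@ZmulDl A) (@Zone_neq0 A).

Definition Zunit (A : model) : {pred @Z A} := fun x => `[< exists y, Zmul y x = norm one zero >].

Lemma ZmulV (A : model) : {in @Zunit A, left_inverse (norm one zero) Zinv Zmul}.
Proof. by move=> x /asboolP H; case: (Zinv_spec x) => [|[]]. Qed.

Lemma ZunitP (A : model) (x y : @Z A) : Zmul y x = norm one zero -> Zunit A x.
Proof. by move=> H; apply/asboolP; exists y. Qed.

Lemma Zinv_out (A : model) : {in [predC @Zunit A], @Zinv A =1 id}.
Proof.
  move=> x /asboolP H; case: (Zinv_spec x) => [E|[] //]. by case: H; exists (Zinv x).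
Qed.

HB.instance Definition _ (A : model) := GRing.ComNzRing_hasMulInverse.Build (@Z A)
  (@ZmulV A) (@ZunitP A) (@Zinv_out A).

Lemma Zintegral (A : model) : GRing.integral_domain_axiom (@Z A).
Proof. by move=> x y /Zmul_eq0 [->|->]; rewrite eqxx ?orbT. Qed.

HB.instance Definition _ (A : model) := GRing.ComUnitRing_isIntegral.Build (@Z A) (@Zintegral A).

Definition Zle {A : model} (x y : @Z A) : bool := `[< Zpos (Zadd y (Zopp x)) >].
Definition Zabs {A : model} (x : @Z A) : @Z A := if Zle (norm zero zero) x then x else Zopp x.

Local Open Scope ring_scope.

Lemma Zle0 (A : model) (x : @Z A) : reflect (exists a, x = norm a zero) (Zle 0 x).
Proof.
  rewrite /Zle. change (Zopp 0) with (- (0 : @Z A)). change (Zadd x (- 0)) with (x - 0). rewrite subr0.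
  by apply: (iffP (asboolP _)) => /Zpos_iff.
Qed.

Lemma Zle_add (A : model) (x y : @Z A) : Zle 0 x -> Zle 0 y -> Zle 0 (x + y).
Proof.
  move=> /Zle0 [a ->] /Zle0 [b ->]. apply/Zle0. exists (add a b).
  etransitivity; first exact: Zadd_norm. by rewrite add_0_l.
Qed.

Lemma Zle_mul (A : model) (x y : @Z A) : Zle 0 x -> Zle 0 y -> Zle 0 (x * y).
Proof.
  move=> /Zle0 [a ->] /Zle0 [b ->]. apply/Zle0. exists (mul a b).
  etransitivity; first exact: Zmul_norm. by rewrite !mul_0_l mul_0_r !add_0_r.
Qed.

Lemma Zle_sub (A : model) (x y : @Z A) : Zle 0 (y - x) = Zle x y.
Proof.
  rewrite {1}/Zle. change (Zopp 0) with (- (0 : @Z A)).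
  change (Zadd (y - x) (- 0)) with (y - x - 0). by rewrite subr0.
Qed.

Lemma Zle0_neg (A : model) (x : @Z A) : Zle x 0 = Zle 0 (- x).
Proof. by rewrite -Zle_sub add0r. Qed.

Lemma Zle_total (A : model) (x : @Z A) : Zle 0 x || Zle x 0.
Proof.
  rewrite Zle0_neg. pattern x; apply Z_ind => a b. change (- norm a b) with (Zopp (norm a b)).
  rewrite Zopp_norm. apply/orP.
  case: (norm_cases a b) => d [[-> _]|[-> _]]; [left|right]; apply/Zle0; exists d; apply/norm_eq;
  by rewrite add_0_r add_comm.
Qed.

Lemma Zle_anti (A : model) (x : @Z A) : Zle 0 x -> Zle x 0 -> x = 0.
Proof.
  rewrite Zle0_neg => /Zle0 [a ->] /Zle0 [b]. change (- norm a zero) with (Zopp (norm a zero)).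
  rewrite Zopp_norm => /norm_eq. rewrite !add_0_l => H. apply/norm_eq. rewrite !add_0_r.
  case: (zero_or_succ a) => // -[k Ek]. exfalso.
  by apply: (succ_neq0 (add b k)); rewrite H Ek add_assoc.
Qed.

Lemma Zabs_opp (A : model) (x : @Z A) : Zabs (- x) = Zabs x.
Proof.
  rewrite /Zabs. change (Zopp (- x)) with (- - x). change (Zopp x) with (- x). rewrite opprK.
  change (norm zero zero) with (0 : @Z A). rewrite -Zle0_neg.
  case: ifP => H1; case: ifP => H2 //.
  - by rewrite (Zle_anti _ _ H2 H1) oppr0.
  - by move: (Zle_total _ x); rewrite H1 H2.
Qed.

Lemma Zabs_pos (A : model) (x : @Z A) : Zle 0 x -> Zabs x = x.
Proof. by rewrite /Zabs => ->. Qed.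

HB.instance Definition _ (A : model) := Num.IntegralDomain_isLeReal.Build (@Z A)
  (@Zle_add A) (@Zle_mul A) (@Zle_anti A) (@Zle_sub A) (@Zle_total A) (@Zabs_opp A)
  (@Zabs_pos A) (fun x y => erefl).

Definition inj {A : model} (a : A) : @Z A := norm a zero.

Section Inj.
Context {A : model}.
Implicit Types a b : A.

Lemma inj_eq a b : inj a = inj b <-> a = b.
Proof. by rewrite norm_eq !add_0_r. Qed.
Lemma inj_0 : inj (zero : A) = 0. Proof. by []. Qed.
Lemma inj_1 : inj (one : A) = 1. Proof. by []. Qed.
Lemma inj_add a b : inj (add a b) = inj a + inj b.
Proof. by symmetry; etransitivity; [exact: Zadd_norm|rewrite add_0_r]. Qed.
Lemma inj_mul a b : inj (mul a b) = inj a * inj b.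
Proof. by symmetry; etransitivity; [exact: Zmul_norm|rewrite !mul_0_r !mul_0_l !add_0_r]. Qed.
Lemma inj_ge0 a : (0 <= inj a)%R.
Proof. by apply/Zle0; exists a. Qed.
Lemma inj_ge0_ex (x : @Z A) : (0 <= x)%R -> exists a, x = inj a.
Proof. by move/Zle0. Qed.
(** Discreteness is built into the translation: with [inj a + 1 <= inj b] for [a < b], arithmetic
    over ordered domains also proves facts that hold only of integers. *)
Lemma inj_lt a b : lt a b <-> (inj a + 1 <= inj b)%R.
Proof.
  rewrite -(Num.Theory.subr_ge0 (inj a + 1)). split.
  - move=> /lt_iff [d ->]. rewrite !inj_add inj_1 (addrC (inj d)) addrA (addrC _ (inj d)) addrK. exact: inj_ge0.
  - move=> /inj_ge0_ex [d H]. apply/lt_iff; exists d. apply/inj_eq.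
    by rewrite !inj_add inj_1 -H (addrC (_ - _)) addrA subrKC.
Qed.
Lemma inj_not_lt a b : ~ lt a b <-> (inj b <= inj a)%R.
Proof.
  split.
  - case: (lt_total a b) => [//|[-> _|/inj_lt H _]]; first exact: Order.POrderTheory.lexx.
    apply: Order.POrderTheory.le_trans H. by rewrite Num.Theory.lerDl Num.Theory.ler01.
  - move=> H /inj_lt H'. have := Order.POrderTheory.le_trans H' H.
    by rewrite -Num.Theory.lerBrDl subrr Num.Theory.ler10.
Qed.
End Inj.
End ZInstances.
Export ZInstances.

(** * Linear and nonlinear arithmetic in a model, by translation to its integers *)

Module ZTactics.
Import ssrbool order ssralg ssrnum ZInstances.
Import mathcomp.algebra_tactics.lra.
Import Order.POrderTheory.
Local Open Scope ring_scope.

Lemma eq_of_le {A : model} (a b : A) : (inj a <= inj b) -> (inj b <= inj a) -> a = b.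
Proof. intros H1 H2. apply inj_eq. lra. Qed.
Lemma eq_to_inj {A : model} (a b : A) : a = b -> inj a = inj b.
Proof. now intros ->. Qed.
Lemma lt_to_inj {A : model} (a b : A) : lt a b -> inj a + 1 <= inj b.
Proof. apply inj_lt. Qed.
Lemma lt_of_inj {A : model} (a b : A) : inj a + 1 <= inj b -> lt a b.
Proof. apply inj_lt. Qed.
Lemma nlt_to_inj {A : model} (a b : A) : ~ lt a b -> inj b <= inj a.
Proof. apply inj_not_lt. Qed.
Lemma nlt_of_inj {A : model} (a b : A) : inj b <= inj a -> ~ lt a b.
Proof. apply inj_not_lt. Qed.

Ltac mpre :=
  unfold le in *;
  repeat match goal with
  | H : lt _ _ |- _ => apply lt_to_inj in H; revert H
  | H : ~ lt _ _ |- _ => apply nlt_to_inj in H; revert H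
  | H : @eq (dom _) _ _ |- _ => apply eq_to_inj in H; revert H
  end.
Ltac mpost :=
  repeat match goal with
  | |- context [inj (add ?a ?b)] => rewrite (inj_add a b)
  | |- context [inj (mul ?a ?b)] => generalize (inj_ge0 (mul a b)); rewrite (inj_mul a b)
  end;
  rewrite ?inj_1, ?inj_0;
  repeat match goal with
  | |- context [inj ?x] => generalize (inj_ge0 x); generalize (inj x)
  end;
  clear; intros.
Ltac mgoal tac :=
  intros;
  repeat match goal with H : _ /\ _ |- _ => destruct H end;
  lazymatch goal with
  | |- _ /\ _ => split; mgoal tac
  | |- ~ lt _ _ => apply nlt_of_inj; mpre; mpost; tac
  | |- ~ (@eq (dom _) _ _) => intros ?; exfalso; mpre; mpost; tac
  | |- False => mpre; mpost; tac
  | |- lt _ _ => apply lt_of_inj; mpre; mpost; tac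
  | |- le _ _ => unfold le; apply lt_of_inj; mpre; mpost; tac
  | |- @eq (dom _) _ _ => apply eq_of_le; mpre; mpost; tac
  | _ => exfalso; mpre; mpost; tac
  end.
Ltac mlia := mgoal ltac:(lra).
Ltac mnia := mgoal ltac:(nra).

End ZTactics.
Ltac mlia := ZTactics.mlia.
Ltac mnia := ZTactics.mnia.

Export mathcomp.algebra_tactics.lra.

From mathcomp Require Import order ssralg ssrnum lra.
(** * Computable functions and decidable predicates *)

Section Computability.
Context {A : model}.
Notation env := (nat -> dom A).
Notation "0" := (@zero A).
Notation "1" := (@one A).
Infix "+" := (@add A).
Infix "*" := (@mul A).
Infix "<" := (@lt A).

Lemma sigma_ex (P : env -> A -> Prop) :
  sigma (fun e => P (fun i => e (S i)) (e 0%nat)) -> sigma (fun e => exists x, P e x).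
Proof.
  intros (R & HR & H).
  exists (fun e => exists x, x < e 0%nat /\ exists y, y < e 0%nat /\
     R (scons y (scons x (fun i => e (S i))))).
  split.
  - def0. eapply def0_ext.
    + apply (def0_ren R (fun i => match i with 0 => 0 | 1 => 1 | S (S j) => S (S (S j)) end)%nat HR).
    + intros e. cbv beta. match goal with |- R ?a <-> R ?b => replace b with a; [tauto|] end.
      extensionality i. now destruct i as [|[|i]].
  - intros e. cbn [scons]. split.
    + intros [x Hx]. apply (H (scons x e)) in Hx as [y Hy].
      exists (x + y + 1), x. split; [mlia|]. exists y. split; [mlia|exact Hy].
    + intros (_ & x & _ & y & _ & Q). exists x. apply (H (scons x e)). exists y. exact Q.
Qed.

Lemma sigma_or P Q : @sigma A P -> sigma Q -> sigma (fun e => P e \/ Q e).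
Proof.
  intros (R & HR & H) (R' & HR' & H'). exists (fun e => R e \/ R' e).
  split; [now apply def0_or|]. intros e. rewrite H, H'. firstorder.
Qed.

Lemma sigma_and P Q : @sigma A P -> sigma Q -> sigma (fun e => P e /\ Q e).
Proof.
  intros (R & HR & H) (R' & HR' & H').
  apply (sigma_ext (fun e => exists x, exists y, R (scons x e) /\ R' (scons y e))).
  - apply (sigma_ex (fun e x => exists y, R (scons x e) /\ R' (scons y e))).
    apply (sigma_ex0 (fun e y => R (scons (e 0%nat) (fun i => e (S i))) /\ R' (scons y (fun i => e (S i))))).
    apply def0_and; eapply def0_ext.
    + apply (def0_ren R S HR).
    + intros e. cbv beta. match goal with |- R ?a <-> R ?b => replace b with a; [tauto|] end.
      extensionality i. now destruct i.
    + apply (def0_ren R' (fun i => match i with 0 => 0 | S j => S (S j) end)%nat HR').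
    + intros e. cbv beta. match goal with |- R' ?a <-> R' ?b => replace b with a; [tauto|] end.
      extensionality i. now destruct i.
  - intros e. rewrite H, H'. firstorder.
Qed.

(** Induction on initial segments: a bound for the elements below [b] is enlarged by the witness of
    [b]. The induction statement begins with the quantifier over the bound, so it is Sigma01. *)
Lemma collection0 (R : A -> A -> Prop) a : def0 (fun e => R (e 0%nat) (e 1%nat)) ->
  (forall x, x < a -> exists y, R x y) -> exists w, forall x, x < a -> exists y, y < w /\ R x y.
Proof.
  intros HR H.
  assert (Q : forall b, exists w, b < a + 1 -> forall x, x < b -> exists y, y < w /\ R x y).
  { ind1.
    - apply (sigma_ex0 (fun e w => e 0%nat < a + 1 -> forall x, x < e 0%nat -> exists y, y < w /\ R x y)).
      def0. apply (def0_ren (fun e => R (e 0%nat) (e 1%nat)) (fun i => match i with 0 => 1 | _ => 0 end)%nat HR).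
    - exists 0. intros _ x Hx. mlia.
    - intros b [w Hw]. destruct (classic (b < a)) as [Hb|Hb].
      + destruct (H b Hb) as [y Hy]. exists (w + y + 1). intros _ x Hx.
        destruct (classic (x = b)) as [->|N].
        * exists y. split; [mlia|exact Hy].
        * destruct (Hw ltac:(mlia) x) as (z & Hz & Rz).
          { destruct (lt_total x b) as [|[|]]; [assumption|tauto|mlia]. }
          exists z. split; [mlia|exact Rz].
      + exists 0. intros Hb'. exfalso. mlia. }
  destruct (Q a) as [w Hw]. exists w. apply Hw. mlia.
Qed.

(** Collection moves the unbounded quantifier in front of the bounded one, as a common bound [e 0]
    for the witnesses. *)
Lemma sigma_ball0 (f : env -> A) (P : env -> A -> Prop) :
  tdef f -> sigma (fun e => P (fun i => e (S i)) (e 0%nat)) ->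
  sigma (fun e => forall x, x < f e -> P e x).
Proof.
  intros Hf (R & HR & H).
  exists (fun e => forall x, x < f (fun i => e (S i)) -> exists y, y < e 0%nat /\
    R (scons y (scons x (fun i => e (S i))))).
  split.
  - apply (def0_ball (fun e => f (fun i => e (S i)))
      (fun e x => exists y, y < e 0%nat /\ R (scons y (scons x (fun i => e (S i)))))).
    + destruct Hf as (t & s & Ht). exists t, (comp_pick (fun i => inl (S i)) s). intros e.
      rewrite pick_comp. apply Ht.
    + def0. eapply def0_ext.
      * apply (def0_ren R (fun i => match i with 0 => 0 | 1 => 1 | S (S j) => S (S (S j)) end)%nat HR).
      * intros e. cbv beta. match goal with |- R ?a <-> R ?b => replace b with a; [tauto|] end.
        extensionality i. now destruct i as [|[|i]].
  - intros e. cbn [scons]. split.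
    + intros Q. apply (collection0 (fun x y => R (scons y (scons x e)))).
      * eapply def0_ext.
        -- apply (def0_pick R (fun i => match i with 0 => inl 1 | 1 => inl 0 | S (S j) => inr (e j) end)%nat HR).
        -- intros e'. cbv beta. match goal with |- R ?a <-> R ?b => replace b with a; [tauto|] end.
           extensionality i. now destruct i as [|[|i]].
      * intros x Hx. apply (H (scons x e)). now apply Q.
    + intros (w & Q) x Hx. apply (H (scons x e)). destruct (Q x Hx) as (y & _ & Hy). now exists y.
Qed.

(** A Sigma01 graph suffices: as [f] is total, the complement of the graph is then Sigma01 as
    well. *)
Definition comp (f : env -> A) : Prop := sigma (fun e => e 0%nat = f (fun i => e (S i))).
Definition delta (P : env -> Prop) : Prop := sigma P /\ sigma (fun e => ~ P e).

Lemma comp_tdef f : tdef f -> comp f.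
Proof.
  intros (t & s & H). apply def0_sigma.
  apply (def0_ext (fun e => e 0%nat = teval (pick (comp_pick (fun i => inl (S i)) s) e) t)).
  - apply def0_eq; [apply tdef_var|]. now exists t, (comp_pick (fun i => inl (S i)) s).
  - intros e. now rewrite H, pick_comp.
Qed.

Lemma comp_var i : comp (fun e => e i). Proof. apply comp_tdef, tdef_var. Qed.
Lemma comp_const c : comp (fun _ => c). Proof. apply comp_tdef, tdef_const. Qed.

Lemma comp_pick_comp f s : comp f -> comp (fun e => f (pick s e)).
Proof.
  intros H.
  apply (sigma_ext (fun e => pick (fun i => match i with
     | 0 => inl 0 | S j => match s j with inl k => inl (S k) | inr c => inr c end end)%nat e 0%nat
     = f (fun i => pick (fun i => match i with
     | 0 => inl 0 | S j => match s j with inl k => inl (S k) | inr c => inr c end end)%nat e (S i)))).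
  - apply (sigma_pick _ _ H).
  - intros e. cbv beta. match goal with |- _ = f ?a <-> _ = f ?b => replace b with a; [tauto|] end.
    extensionality i. unfold pick. now destruct (s i).
Qed.

Lemma comp_ren f r : comp f -> comp (fun e => f (fun i => e (r i))).
Proof. apply comp_pick_comp with (s := fun i => inl (r i)). Qed.

Lemma sigma_subst (P : env -> A -> Prop) f :
  comp f -> sigma (fun e => P (fun i => e (S i)) (e 0%nat)) -> sigma (fun e => P e (f e)).
Proof.
  intros Hf HP. apply (sigma_ext (fun e => exists y, y = f e /\ P e y)).
  - apply (sigma_ex (fun e y => y = f e /\ P e y)). now apply sigma_and.
  - intros e. split; [eauto|]. now intros (y & -> & H).
Qed.

Lemma comp_subst (g : env -> A -> A) f :
  comp f -> comp (fun e => g (fun i => e (S i)) (e 0%nat)) -> comp (fun e => g e (f e)).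
Proof.
  intros Hf Hg. apply (sigma_subst (fun e y => e 0%nat = g (fun i => e (S i)) y)
    (fun e => f (fun i => e (S i)))).
  - now apply comp_ren.
  - exact (sigma_ren _ (fun i => match i with 0 => 1 | 1 => 0 | S (S j) => S (S j) end)%nat Hg).
Qed.

Definition sigma1 (P : A -> Prop) := sigma (fun e => P (e 0%nat)).
Definition sigma2 (P : A -> A -> Prop) := sigma (fun e => P (e 0%nat) (e 1%nat)).
Definition sigma3 (P : A -> A -> A -> Prop) := sigma (fun e => P (e 0%nat) (e 1%nat) (e 2%nat)).
Definition sigma4 (P : A -> A -> A -> A -> Prop) :=
  sigma (fun e => P (e 0%nat) (e 1%nat) (e 2%nat) (e 3%nat)).
Definition sigma5 (P : A -> A -> A -> A -> A -> Prop) :=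
  sigma (fun e => P (e 0%nat) (e 1%nat) (e 2%nat) (e 3%nat) (e 4%nat)).
Definition delta1 (P : A -> Prop) := delta (fun e => P (e 0%nat)).
Definition delta2 (P : A -> A -> Prop) := delta (fun e => P (e 0%nat) (e 1%nat)).
Definition delta3 (P : A -> A -> A -> Prop) := delta (fun e => P (e 0%nat) (e 1%nat) (e 2%nat)).
Definition delta4 (P : A -> A -> A -> A -> Prop) :=
  delta (fun e => P (e 0%nat) (e 1%nat) (e 2%nat) (e 3%nat)).
Definition delta5 (P : A -> A -> A -> A -> A -> Prop) :=
  delta (fun e => P (e 0%nat) (e 1%nat) (e 2%nat) (e 3%nat) (e 4%nat)).
Definition comp1 (f : A -> A) := comp (fun e => f (e 0%nat)).
Definition comp2 (f : A -> A -> A) := comp (fun e => f (e 0%nat) (e 1%nat)).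
Definition comp3 (f : A -> A -> A -> A) := comp (fun e => f (e 0%nat) (e 1%nat) (e 2%nat)).
Definition comp4 (f : A -> A -> A -> A -> A) :=
  comp (fun e => f (e 0%nat) (e 1%nat) (e 2%nat) (e 3%nat)).

Lemma sigma_app1 P f : sigma1 P -> comp f -> sigma (fun e => P (f e)).
Proof.
  intros HP Hf. apply (sigma_subst (fun _ y => P y) f Hf).
  exact (sigma_ren _ (fun _ => 0%nat) HP).
Qed.

Lemma sigma_app2 P f g : sigma2 P -> comp f -> comp g -> sigma (fun e => P (f e) (g e)).
Proof.
  intros HP Hf Hg. apply (sigma_subst (fun e y => P y (g e)) f Hf).
  apply (sigma_subst (fun e y => P (e 0%nat) y) (fun e => g (fun i => e (S i))) (comp_ren _ S Hg)).
  exact (sigma_ren _ (fun i => match i with 0 => 1 | _ => 0 end)%nat HP).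
Qed.

Lemma sigma_app3 P f g h : sigma3 P -> comp f -> comp g -> comp h ->
  sigma (fun e => P (f e) (g e) (h e)).
Proof.
  intros HP Hf Hg Hh. apply (sigma_subst (fun e y => P y (g e) (h e)) f Hf).
  apply (sigma_subst (fun e y => P (e 0%nat) y (h (fun i => e (S i)))) (fun e => g (fun i => e (S i))) (comp_ren _ S Hg)).
  apply (sigma_subst (fun e y => P (e 1%nat) (e 0%nat) y) (fun e => h (fun i => e (S (S i)))) (comp_ren _ (fun i => S (S i)) Hh)).
  exact (sigma_ren _ (fun i => match i with 0 => 2 | 1 => 1 | _ => 0 end)%nat HP).
Qed.

Lemma sigma_app4 P f g h k : sigma4 P -> comp f -> comp g -> comp h -> comp k ->
  sigma (fun e => P (f e) (g e) (h e) (k e)).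
Proof.
  intros HP Hf Hg Hh Hk. apply (sigma_subst (fun e y => P y (g e) (h e) (k e)) f Hf).
  apply (sigma_subst (fun e y => P (e 0%nat) y (h (fun i => e (S i))) (k (fun i => e (S i)))) (fun e => g (fun i => e (S i))) (comp_ren _ S Hg)).
  apply (sigma_subst (fun e y => P (e 1%nat) (e 0%nat) y (k (fun i => e (S (S i))))) (fun e => h (fun i => e (S (S i)))) (comp_ren _ (fun i => S (S i)) Hh)).
  apply (sigma_subst (fun e y => P (e 2%nat) (e 1%nat) (e 0%nat) y) (fun e => k (fun i => e (S (S (S i))))) (comp_ren _ (fun i => S (S (S i))) Hk)).
  exact (sigma_ren _ (fun i => match i with 0 => 3 | 1 => 2 | 2 => 1 | _ => 0 end)%nat HP).
Qed.

Lemma sigma_app5 P f g h k l : sigma5 P -> comp f -> comp g -> comp h -> comp k -> comp l ->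
  sigma (fun e => P (f e) (g e) (h e) (k e) (l e)).
Proof.
  intros HP Hf Hg Hh Hk Hl. apply (sigma_subst (fun e y => P y (g e) (h e) (k e) (l e)) f Hf).
  apply (sigma_subst (fun e y => P (e 0%nat) y (h (fun i => e (S i))) (k (fun i => e (S i))) (l (fun i => e (S i)))) (fun e => g (fun i => e (S i))) (comp_ren _ S Hg)).
  apply (sigma_subst (fun e y => P (e 1%nat) (e 0%nat) y (k (fun i => e (S (S i)))) (l (fun i => e (S (S i))))) (fun e => h (fun i => e (S (S i)))) (comp_ren _ (fun i => S (S i)) Hh)).
  apply (sigma_subst (fun e y => P (e 2%nat) (e 1%nat) (e 0%nat) y (l (fun i => e (S (S (S i)))))) (fun e => k (fun i => e (S (S (S i))))) (comp_ren _ (fun i => S (S (S i))) Hk)).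
  apply (sigma_subst (fun e y => P (e 3%nat) (e 2%nat) (e 1%nat) (e 0%nat) y) (fun e => l (fun i => e (S (S (S (S i)))))) (comp_ren _ (fun i => S (S (S (S i)))) Hl)).
  exact (sigma_ren _ (fun i => match i with 0 => 4 | 1 => 3 | 2 => 2 | 3 => 1 | _ => 0 end)%nat HP).
Qed.

Lemma delta_app1 P f : delta1 P -> comp f -> delta (fun e => P (f e)).
Proof. intros [H H'] ?. split; [now apply sigma_app1|now apply (sigma_app1 (fun x => ~ P x))]. Qed.
Lemma delta_app2 P f g : delta2 P -> comp f -> comp g -> delta (fun e => P (f e) (g e)).
Proof. intros [H H'] ? ?. split; [now apply sigma_app2|now apply (sigma_app2 (fun x y => ~ P x y))]. Qed.
Lemma delta_app3 P f g h : delta3 P -> comp f -> comp g -> comp h ->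
  delta (fun e => P (f e) (g e) (h e)).
Proof. intros [H H'] ? ? ?. split; [now apply sigma_app3|now apply (sigma_app3 (fun x y z => ~ P x y z))]. Qed.
Lemma delta_app4 P f g h k : delta4 P -> comp f -> comp g -> comp h -> comp k ->
  delta (fun e => P (f e) (g e) (h e) (k e)).
Proof. intros [H H'] ? ? ? ?. split; [now apply sigma_app4|now apply (sigma_app4 (fun x y z w => ~ P x y z w))]. Qed.
Lemma delta_app5 P f g h k l : delta5 P -> comp f -> comp g -> comp h -> comp k -> comp l ->
  delta (fun e => P (f e) (g e) (h e) (k e) (l e)).
Proof. intros [H H'] ? ? ? ? ?. split; [now apply sigma_app5|now apply (sigma_app5 (fun x y z w v => ~ P x y z w v))]. Qed.

Lemma comp_app1 F f : comp1 F -> comp f -> comp (fun e => F (f e)).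
Proof.
  intros HF Hf. apply (sigma_app2 (fun x y => x = F y) _ _ HF); [apply comp_var|].
  exact (comp_ren _ S Hf).
Qed.
Lemma comp_app2 F f g : comp2 F -> comp f -> comp g -> comp (fun e => F (f e) (g e)).
Proof.
  intros HF Hf Hg. apply (sigma_app3 (fun x y z => x = F y z) _ _ _ HF); [apply comp_var| |].
  - exact (comp_ren _ S Hf).
  - exact (comp_ren _ S Hg).
Qed.
Lemma comp_app3 F f g h : comp3 F -> comp f -> comp g -> comp h -> comp (fun e => F (f e) (g e) (h e)).
Proof.
  intros HF Hf Hg Hh. apply (sigma_app4 (fun x y z w => x = F y z w) _ _ _ _ HF); [apply comp_var| | |].
  - exact (comp_ren _ S Hf).
  - exact (comp_ren _ S Hg).
  - exact (comp_ren _ S Hh).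
Qed.
Lemma comp_app4 F f g h k : comp4 F -> comp f -> comp g -> comp h -> comp k ->
  comp (fun e => F (f e) (g e) (h e) (k e)).
Proof.
  intros HF Hf Hg Hh Hk. apply (sigma_app5 (fun x y z w v => x = F y z w v) _ _ _ _ _ HF); [apply comp_var| | | |].
  - exact (comp_ren _ S Hf).
  - exact (comp_ren _ S Hg).
  - exact (comp_ren _ S Hh).
  - exact (comp_ren _ S Hk).
Qed.

Lemma comp2_add : comp2 (@add A).
Proof. apply comp_tdef. tdef. Qed.
Lemma comp2_mul : comp2 (@mul A).
Proof. apply comp_tdef. tdef. Qed.

Lemma def0_delta P : @def0 A P -> delta P.
Proof. split; apply def0_sigma; [|apply def0_not]; assumption. Qed.
Lemma delta2_lt : delta2 (@lt A). Proof. apply def0_delta. def0. Qed.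
Lemma delta2_eq : delta2 (@eq A). Proof. apply def0_delta. def0. Qed.
Lemma delta1_mem X : delta1 (fun x : A => mem x X). Proof. apply def0_delta. def0. Qed.
Lemma delta_false : delta (fun _ => False). Proof. apply def0_delta. def0. Qed.

Lemma delta_ext P Q : delta P -> (forall e, Q e <-> P e) -> delta Q.
Proof.
  intros [H H'] E. split; [exact (sigma_ext _ _ H E)|].
  refine (sigma_ext _ _ H' _). intros e. now rewrite E.
Qed.

Lemma delta_sigma P : delta P -> sigma P. Proof. now intros []. Qed.
Lemma delta_not P : delta P -> delta (fun e => ~ P e).
Proof.
  intros [H H']. split; [exact H'|]. refine (sigma_ext _ _ H _). intros e.
  split; [apply NNPP|tauto].
Qed.
Lemma delta_and P Q : delta P -> delta Q -> delta (fun e => P e /\ Q e).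
Proof.
  intros [H1 H2] [H3 H4]. split; [now apply sigma_and|].
  refine (sigma_ext _ _ (sigma_or _ _ H2 H4) _). intros e. split; [apply not_and_or|tauto].
Qed.
Lemma delta_or P Q : delta P -> delta Q -> delta (fun e => P e \/ Q e).
Proof.
  intros [H1 H2] [H3 H4]. split; [now apply sigma_or|].
  refine (sigma_ext _ _ (sigma_and _ _ H2 H4) _). intros e. tauto.
Qed.
Lemma sigma_imp P Q : delta P -> sigma Q -> sigma (fun e => P e -> Q e).
Proof.
  intros [_ H] HQ. refine (sigma_ext _ _ (sigma_or _ _ H HQ) _). intros e.
  split; [apply imply_to_or|tauto].
Qed.
Lemma delta_imp P Q : delta P -> delta Q -> delta (fun e => P e -> Q e).
Proof.
  intros HP HQ. refine (delta_ext _ _ (delta_or _ _ (delta_not _ HP) HQ) _). intros e.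
  split; [apply imply_to_or|tauto].
Qed.
Lemma delta_iff P Q : delta P -> delta Q -> delta (fun e => P e <-> Q e).
Proof. intros. apply delta_and; now apply delta_imp. Qed.

Lemma sigma_ball (f : env -> A) (P : env -> A -> Prop) :
  comp f -> sigma (fun e => P (fun i => e (S i)) (e 0%nat)) ->
  sigma (fun e => forall x, x < f e -> P e x).
Proof.
  intros Hf HP. apply (sigma_subst (fun e y => forall x, x < y -> P e x) f Hf).
  apply (sigma_ball0 (fun e => e 0%nat) (fun e x => P (fun i => e (S i)) x)); [tdef|].
  exact (sigma_ren _ (fun i => match i with 0 => 0 | S j => S (S j) end)%nat HP).
Qed.

Lemma delta_bex (f : env -> A) (P : env -> A -> Prop) :
  comp f -> delta (fun e => P (fun i => e (S i)) (e 0%nat)) ->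
  delta (fun e => exists x, x < f e /\ P e x).
Proof.
  intros Hf HP. split.
  - apply (sigma_ex (fun e x => x < f e /\ P e x)). apply sigma_and; [|apply HP].
    apply (sigma_app2 (@lt A)); [apply delta2_lt|apply comp_var|exact (comp_ren _ S Hf)].
  - apply (sigma_ext (fun e => forall x, x < f e -> ~ P e x)).
    + apply (sigma_ball f (fun e x => ~ P e x) Hf), HP.
    + intros e. firstorder.
Qed.

Lemma delta_ball (f : env -> A) (P : env -> A -> Prop) :
  comp f -> delta (fun e => P (fun i => e (S i)) (e 0%nat)) ->
  delta (fun e => forall x, x < f e -> P e x).
Proof.
  intros Hf HP. apply (delta_ext (fun e => ~ exists x, x < f e /\ ~ P e x)).
  - apply delta_not. apply (delta_bex f (fun e x => ~ P e x) Hf). now apply delta_not.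
  - intros e. split; [firstorder|]. intros H x Hx. apply NNPP. eauto.
Qed.

Lemma sigma_strong_ind (P : A -> Prop) : sigma1 P ->
  (forall x, (forall y, y < x -> P y) -> P x) -> forall x, P x.
Proof.
  intros HP H x.
  assert (Q : forall z, forall y, y < z -> P y).
  { ind1.
    - apply (sigma_ball (fun e => e 0%nat) (fun _ y => P y)); [apply comp_var|].
      exact (sigma_ren _ (fun _ => 0%nat) HP).
    - intros y Hy. mlia.
    - intros z IH y Hy. apply lt_succ in Hy as [Hy| ->]; auto. }
  apply (Q (x + 1)). mlia.
Qed.

(** This is strong induction for the negation of [P], which therefore has to be Sigma01. *)
Lemma least (P : A -> Prop) : delta1 P -> (exists x, P x) ->
  exists x, P x /\ forall y, y < x -> ~ P y.
Proof.
  intros HP [x Hx]. apply NNPP. intros N. revert x Hx.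
  apply (sigma_strong_ind (fun x => ~ P x)); [apply HP|].
  intros x IH Hx. apply N. now exists x.
Qed.

Definition mu (P : A -> Prop) : A :=
  epsilon (inhabits 0) (fun x => P x /\ forall y, y < x -> ~ P y).

Lemma mu_spec P : delta1 P -> (exists x, P x) -> P (mu P) /\ forall y, y < mu P -> ~ P y.
Proof. intros HP H. exact (epsilon_spec (inhabits 0) (fun x => P x /\ forall y, y < x -> ~ P y) (least P HP H)). Qed.

Lemma mu_eq P x : P x -> (forall y, y < x -> ~ P y) -> mu P = x.
Proof.
  intros H1 H2.
  destruct (epsilon_spec (inhabits 0) (fun x => P x /\ forall y, y < x -> ~ P y)
    (ex_intro _ x (conj H1 H2))) as [H3 H4]. fold (mu P) in *.
  destruct (lt_total (mu P) x) as [H|[H|H]]; [exfalso; eapply H2; eauto|assumption|exfalso; eapply H4; eauto].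
Qed.

Lemma delta_spec (P : env -> A -> Prop) e :
  delta (fun e => P (fun i => e (S i)) (e 0%nat)) -> delta1 (P e).
Proof.
  intros [H H']. split;
    [exact (sigma_pick _ (fun i => match i with 0 => inl 0 | S j => inr (e j) end)%nat H)
    |exact (sigma_pick _ (fun i => match i with 0 => inl 0 | S j => inr (e j) end)%nat H')].
Qed.

Lemma comp_spec (P : env -> A -> A) e :
  comp (fun e => P (fun i => e (S i)) (e 0%nat)) -> comp1 (P e).
Proof.
  intros H. exact (comp_pick_comp _ (fun i => match i with 0 => inl 0 | S j => inr (e j) end)%nat H).
Qed.

Lemma comp_spec2 (P : env -> A -> A -> A) e :
  comp (fun e => P (fun i => e (S (S i))) (e 0%nat) (e 1%nat)) -> comp2 (P e).
Proof.
  intros H. exact (comp_pick_comp _ (fun i => match i with 0 => inl 0 | 1 => inl 1 | S (S j) => inr (e j) end)%nat H).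
Qed.

Lemma delta_ren P r : delta P -> delta (fun e => P (fun i => e (r i))).
Proof. intros [H H']. split; [exact (sigma_ren _ r H)|exact (sigma_ren _ r H')]. Qed.

Lemma comp_mu (P : env -> A -> Prop) :
  delta (fun e => P (fun i => e (S i)) (e 0%nat)) -> (forall e, exists x, P e x) ->
  comp (fun e => mu (P e)).
Proof.
  intros HP H.
  apply (sigma_ext (fun e => P (fun i => e (S i)) (e 0%nat) /\ forall y, y < e 0%nat -> ~ P (fun i => e (S i)) y)).
  - apply sigma_and; [apply HP|].
    apply (sigma_ball (fun e => e 0%nat) (fun e y => ~ P (fun i => e (S i)) y)); [apply comp_var|].
    exact (sigma_ren _ (fun i => match i with 0 => 0 | S j => S (S j) end)%nat (proj2 HP)).
  - intros e. split.
    + intros ->. now apply mu_spec; [apply delta_spec|].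
    + intros [H1 H2]. symmetry. now apply mu_eq.
Qed.

(** The value is the bound [b] if the search fails. *)
Definition bmu (b : A) (P : A -> Prop) : A := mu (fun x => P x \/ x = b).

Lemma bmu_spec b P x : delta1 P -> P x -> x < b -> P (bmu b P) /\ le (bmu b P) x.
Proof.
  intros HP Hx Hb.
  destruct (mu_spec (fun x => P x \/ x = b)) as [H1 H2].
  - apply delta_or; [exact HP|]. apply (delta_app2 eq); [apply delta2_eq|apply comp_var|apply comp_const].
  - exists b. now right.
  - fold (bmu b P) in *. assert (L : le (bmu b P) x).
    { destruct (classic (x < bmu b P)) as [Q|Q]; [|mlia]. exfalso. apply (H2 _ Q). now left. }
    split; [|exact L]. destruct H1 as [|E]; [assumption|]. exfalso. rewrite E in L. mlia.
Qed.

Lemma comp_bmu (f : env -> A) (P : env -> A -> Prop) :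
  comp f -> delta (fun e => P (fun i => e (S i)) (e 0%nat)) ->
  comp (fun e => bmu (f e) (P e)).
Proof.
  intros Hf HP. apply (comp_mu (fun e x => P e x \/ x = f e)).
  - apply delta_or; [exact HP|]. apply (delta_app2 eq); [apply delta2_eq|apply comp_var|exact (comp_ren _ S Hf)].
  - intros e. exists (f e). now right.
Qed.

(** Definition by cases written as a search, so that its computability is an instance of
    [comp_mu]. *)
Definition ite (P : Prop) (a b : A) : A := mu (fun x => (P /\ x = a) \/ (~ P /\ x = b)).

Lemma ite_true (P : Prop) a b : P -> ite P a b = a.
Proof. intros H. apply mu_eq; [auto|]. intros y Hy [[_ ->]|[N _]]; [mlia|auto]. Qed.
Lemma ite_false (P : Prop) a b : ~ P -> ite P a b = b.
Proof. intros H. apply mu_eq; [auto|]. intros y Hy [[N _]|[_ ->]]; [auto|mlia]. Qed.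

Lemma comp_ite P f g : delta P -> comp f -> comp g -> comp (fun e => ite (P e) (f e) (g e)).
Proof.
  intros HP Hf Hg. apply (comp_mu (fun e x => (P e /\ x = f e) \/ (~ P e /\ x = g e))).
  - apply delta_or; apply delta_and.
    + exact (delta_ren _ S HP).
    + apply (delta_app2 eq); [apply delta2_eq|apply comp_var|exact (comp_ren _ S Hf)].
    + apply delta_not. exact (delta_ren _ S HP).
    + apply (delta_app2 eq); [apply delta2_eq|apply comp_var|exact (comp_ren _ S Hg)].
  - intros e. destruct (classic (P e)); eauto.
Qed.

End Computability.

(* Automation of definability proofs *)
Create HintDb defn.
#[export] Hint Constants Opaque : defn.
#[export] Hint Resolve delta2_lt delta2_eq comp2_add comp2_mul delta1_mem : defn.
#[export] Hint Extern 5 (sigma1 ?P) => apply (delta_sigma (fun e => P (e 0%nat))); change (delta1 P) : defn.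
#[export] Hint Extern 5 (sigma2 ?P) => apply (delta_sigma (fun e => P (e 0%nat) (e 1%nat))); change (delta2 P) : defn.
#[export] Hint Extern 5 (sigma3 ?P) => apply (delta_sigma (fun e => P (e 0%nat) (e 1%nat) (e 2%nat))); change (delta3 P) : defn.
#[export] Hint Extern 5 (sigma4 ?P) => apply (delta_sigma (fun e => P (e 0%nat) (e 1%nat) (e 2%nat) (e 3%nat))); change (delta4 P) : defn.
#[export] Hint Extern 5 (sigma5 ?P) => apply (delta_sigma (fun e => P (e 0%nat) (e 1%nat) (e 2%nat) (e 3%nat) (e 4%nat))); change (delta5 P) : defn.

Ltac defn := solve [auto 2 with defn nocore].

Ltac comp_extra := fail.
Ltac sigma_extra := fail.
Ltac delta_extra := fail.

Ltac comp :=
  cbv beta;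
  lazymatch goal with
  | |- comp (fun e => e ?i) => apply (comp_var i)
  | |- comp (fun _ => ?c) => apply (comp_const c)
  | |- comp (fun e => bmu (@?f e) (@?P e)) => apply (comp_bmu f P); [comp|delta]
  | |- comp (fun e => ite (@?P e) (@?f e) (@?g e)) => apply (comp_ite P f g); [delta|comp|comp]
  | |- comp _ =>
    first
    [ comp_extra
    | lazymatch goal with |- comp (fun e => ?F (@?f e) (@?g e) (@?h e) (@?k e)) =>
        apply (comp_app4 F f g h k); [defn|comp|comp|comp|comp] end
    | lazymatch goal with |- comp (fun e => ?F (@?f e) (@?g e) (@?h e)) =>
        apply (comp_app3 F f g h); [defn|comp|comp|comp] end
    | lazymatch goal with |- comp (fun e => ?F (@?f e) (@?g e)) =>
        apply (comp_app2 F f g); [defn|comp|comp] end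
    | lazymatch goal with |- comp (fun e => ?F (@?f e)) =>
        apply (comp_app1 F f); [defn|comp] end
    | idtac ]
  end
with delta :=
  cbv beta;
  lazymatch goal with
  | |- delta (fun e => @?P e /\ @?Q e) => apply (delta_and P Q); delta
  | |- delta (fun e => @?P e \/ @?Q e) => apply (delta_or P Q); delta
  | |- delta (fun e => @?P e <-> @?Q e) => apply (delta_iff P Q); delta
  | |- delta (fun e => ~ @?P e) => apply (delta_not P); delta
  | |- delta (fun e => forall x, lt x (@?f e) -> @?P e x) => apply (delta_ball f P); [comp|delta]
  | |- delta (fun e => exists x, lt x (@?f e) /\ @?P e x) => apply (delta_bex f P); [comp|delta]
  | |- delta (fun e => @?P e -> @?Q e) => apply (delta_imp P Q); delta
  | |- delta (fun _ => False) => apply delta_false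
  | |- delta _ =>
    first
    [ delta_extra
    | lazymatch goal with |- delta (fun e => ?F (@?f e) (@?g e) (@?h e) (@?k e) (@?l e)) =>
        apply (delta_app5 F f g h k l); [defn|comp|comp|comp|comp|comp] end
    | lazymatch goal with |- delta (fun e => ?F (@?f e) (@?g e) (@?h e) (@?k e)) =>
        apply (delta_app4 F f g h k); [defn|comp|comp|comp|comp] end
    | lazymatch goal with |- delta (fun e => ?F (@?f e) (@?g e) (@?h e)) =>
        apply (delta_app3 F f g h); [defn|comp|comp|comp] end
    | lazymatch goal with |- delta (fun e => ?F (@?f e) (@?g e)) =>
        apply (delta_app2 F f g); [defn|comp|comp] end
    | lazymatch goal with |- delta (fun e => mem (@?f e) ?X) =>
        apply (delta_app1 (fun x => mem x X) f); [apply delta1_mem|comp] end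
    | lazymatch goal with |- delta (fun e => ?F (@?f e)) =>
        apply (delta_app1 F f); [defn|comp] end
    | idtac ]
  end.

Ltac sigma :=
  cbv beta;
  lazymatch goal with
  | |- sigma (fun e => @?P e /\ @?Q e) => apply (sigma_and P Q); sigma
  | |- sigma (fun e => @?P e \/ @?Q e) => apply (sigma_or P Q); sigma
  | |- sigma (fun e => exists x, @?P e x) => apply (sigma_ex P); sigma
  | |- sigma (fun e => forall x, lt x (@?f e) -> @?P e x) => apply (sigma_ball f P); [comp|sigma]
  | |- sigma (fun e => ~ @?P e) => apply delta_sigma; apply (delta_not P); delta
  | |- sigma (fun e => @?P e -> @?Q e) => apply (sigma_imp P Q); [delta|sigma]
  | |- sigma _ =>
    first
    [ sigma_extra
    | lazymatch goal with |- sigma (fun e => ?F (@?f e) (@?g e) (@?h e) (@?k e) (@?l e)) =>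
        apply (sigma_app5 F f g h k l); [defn|comp|comp|comp|comp|comp] end
    | lazymatch goal with |- sigma (fun e => ?F (@?f e) (@?g e) (@?h e) (@?k e)) =>
        apply (sigma_app4 F f g h k); [defn|comp|comp|comp|comp] end
    | lazymatch goal with |- sigma (fun e => ?F (@?f e) (@?g e) (@?h e)) =>
        apply (sigma_app3 F f g h); [defn|comp|comp|comp] end
    | lazymatch goal with |- sigma (fun e => ?F (@?f e) (@?g e)) =>
        apply (sigma_app2 F f g); [defn|comp|comp] end
    | lazymatch goal with |- sigma (fun e => ?F (@?f e)) =>
        apply (sigma_app1 F f); [defn|comp] end
    | apply delta_sigma; delta ]
  end.

From mathcomp Require Import ring.
(** * Finite sets and sequences *)

Section CoprimeZ.
Local Open Scope ring_scope.
Import ssrbool ssralg.GRing.Theory.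

(** An explicit Bezout computation. With [d = m * (i + 1) + 1] the second hypothesis says
    [n * m * e = (c - n) * d]. Since [d - m * (i + 1) = 1] and [m = e * q], multiplying out the
    displayed cofactor by [d] leaves [n]. *)
Lemma coprime_Z (A : model) (m i e q n c : @Z A) :
  e * q = m -> n * (m * (i + e + 1) + 1) = c * (m * (i + 1) + 1) ->
  n = (n - (n * e - (i + 1) * (c - n)) * q * (i + 1)) * (m * (i + 1) + 1).
Proof.
  intros <- H.
  (* The multiple of the hypothesis that makes the goal linear in the remaining products. *)
  assert (H' : n * ((e * q) * (i + e + 1) + 1) * (q * (i + 1) * (i + 1)) =
    c * ((e * q) * (i + 1) + 1) * (q * (i + 1) * (i + 1))) by now rewrite H.
  lra.
Qed.

Lemma factor_nonneg (A : model) (n d w : @Z A) : 0 <= n -> 0 < d -> n = w * d -> 0 <= w.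
Proof.
  intros Hn Hd ->. exact (eq_ind _ is_true Hn _ (Num.Theory.pmulr_lge0 w Hd)).
Qed.
End CoprimeZ.

Ltac inj_push H :=
  repeat match type of H with
  | context [inj (add ?a ?b)] => rewrite (inj_add a b) in H
  | context [inj (mul ?a ?b)] => rewrite (inj_mul a b) in H
  end;
  rewrite ?inj_1, ?inj_0 in H.

Section Finite.
Context {A : model}.
Notation env := (nat -> dom A).
Notation "0" := (@zero A).
Notation "1" := (@one A).
Infix "+" := (@add A).
Infix "*" := (@mul A).
Infix "<" := (@lt A).

Definition pr (a b : A) : A := (a + b) * (a + b) + a.

Lemma comp2_pr : comp2 pr.
Proof. unfold comp2, pr. comp. Qed.

(** For [s = a + b] the code is at least [s * s] and below [(s + 1) * (s + 1)], so different sums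
    already decide the order. *)
Lemma pr_sum_lt a b c d : a + b < c + d -> pr a b < pr c d.
Proof.
  intros H. apply lt_iff in H as [k Hk]. unfold pr. rewrite Hk. mnia.
Qed.

Lemma pr_inj a b c d : pr a b = pr c d -> a = c /\ b = d.
Proof.
  intros H. destruct (lt_total (a + b) (c + d)) as [Q|[Q|Q]].
  - apply pr_sum_lt in Q. mlia.
  - unfold pr in H. rewrite Q in H. assert (a = c) by mlia. subst. split; mlia.
  - apply pr_sum_lt in Q. mlia.
Qed.

Lemma pr_le_l a b : le a (pr a b).
Proof. unfold pr. mnia. Qed.
Lemma pr_le_r a b : le b (pr a b).
Proof. unfold pr. destruct (zero_or_succ b) as [->|[k ->]]; mnia. Qed.
Lemma pr_lt_r a b : 0 < a -> b < pr a b.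
Proof. intros H. unfold pr. destruct (zero_or_succ b) as [->|[k ->]]; mnia. Qed.
Lemma pr_mono a b a' b' : le a a' -> le b b' -> le (pr a b) (pr a' b').
Proof.
  intros H1 H2. destruct (classic (a + b < a' + b')) as [H|H].
  - apply pr_sum_lt in H. mlia.
  - assert (a = a') by mlia. assert (b = b') by mlia. subst. mlia.
Qed.

(** * Coding of finite sets by divisibility *)

Definition dvd (d n : A) : Prop := exists q, q < n + 1 /\ q * d = n.

Lemma delta2_dvd : delta2 dvd.
Proof. unfold delta2, dvd. delta. Qed.

Lemma dvd_intro q d n : 0 < d -> q * d = n -> dvd d n.
Proof. intros Hd <-. exists q. split; [|reflexivity]. mnia. Qed.

Lemma common_multiple k : exists m, 0 < m /\ forall t, t < k -> dvd (t + 1) m.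
Proof.
  revert k. ind1.
  - pose proof delta2_dvd. sigma.
  - exists 1. split; [mlia|]. intros t Ht. mlia.
  - intros k (m & Hm & H). exists (m * (k + 1)). split; [mnia|].
    intros t Ht. apply lt_succ in Ht as [Ht| ->].
    + destruct (H t Ht) as (q & _ & <-). apply (dvd_intro (q * (k + 1))); mlia.
    + apply (dvd_intro m); mlia.
Qed.

Definition modulus (m x : A) : A := m * (x + 1) + 1.

(** The difference of [i] and [j] is at most [k], hence divides [m], and [coprime_Z] applies. The
    case [j < i] is the same identity with [e] and [q] negative, which is why it was stated for
    integers. *)
Lemma coprime_factor k m i j n : (forall t, t < k -> dvd (t + 1) m) -> i < k -> j < k -> i <> j -> dvd (modulus m i) (n * modulus m j) -> dvd (modulus m i) n.
Proof.
  intros Hk Hi Hj Hij (c & _ & H). unfold modulus in *.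
  apply (f_equal inj) in H. inj_push H.
  assert (Q : exists W : Z, inj n = GRing.mul W (GRing.add (GRing.mul (inj m) (GRing.add (inj i) (GRing.one _))) (GRing.one _))).
  { destruct (lt_total i j) as [L|[L|L]]; [| tauto |]; apply lt_iff in L as [e E];
    destruct (Hk e ltac:(mlia)) as (q & _ & Hq);
    apply (f_equal inj) in E; apply (f_equal inj) in Hq; inj_push E; inj_push Hq; eexists.
    - apply (coprime_Z A _ _ (inj e + 1)%R (inj q) _ (inj c)).
      + rewrite <- Hq. lra.
      + rewrite E in H. lra.
    - apply (coprime_Z A _ _ (- (inj e + 1))%R (- inj q)%R _ (inj c)).
      + rewrite <- Hq. lra.
      + rewrite E in H. rewrite E. lra. }
  destruct Q as [W HW].
  destruct (inj_ge0_ex W) as [w ->].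
  { apply (factor_nonneg A _ _ _ (inj_ge0 n)) with (2 := HW).
    pose proof (inj_ge0 (m * (i + 1))) as P. inj_push P. lra. }
  apply (dvd_intro w); [mlia|]. apply inj_eq.
  revert HW. clear. ZTactics.mpost. lra.
Qed.

(** A stage in building a code: [n] stands for the product of the moduli of the elements of [P]
    below [j], described only through the moduli that divide it. *)
Definition codes (k m : A) (P : A -> Prop) (j n : A) : Prop :=
  0 < n /\ forall x, x < k -> (dvd (modulus m x) n <-> x < j /\ P x).

Lemma codes_0 k m P : 0 < m -> codes k m P 0 1.
Proof.
  intros Hm.
  split; [mlia|]. intros x Hx. split; [|intros []; mlia].
  intros (q & _ & Hq). exfalso. unfold modulus in Hq.
  destruct (zero_or_succ q) as [->|[q' ->]]; [mlia|].
  destruct (lt_iff 0 m) as [Q _]. destruct (Q Hm) as [m' ->].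
  assert (0 < (q' + 1) * ((0 + (m' + 1)) * (x + 1))) by mnia. mnia.
Qed.

Lemma codes_succ k m : 0 < m -> (forall t, t < k -> dvd (t + 1) m) ->
  forall (P : A -> Prop) j n, j < k -> codes k m P j n ->
  exists n', (n' = n \/ n' = n * modulus m j) /\ codes k m P (j + 1) n'.
Proof.
  intros Hm Hk P j n Hj [Hn H]. destruct (classic (P j)) as [Pj|Pj].
  - exists (n * modulus m j). split; [auto|]. split; [unfold modulus; mnia|].
    intros x Hx. destruct (classic (x = j)) as [->|N].
    + split; [intros _; split; [mlia|exact Pj]|]. intros _. apply (dvd_intro n); [unfold modulus; mlia|reflexivity].
    + split.
      * intros Q. apply (coprime_factor k) in Q; auto. apply H in Q as [Q1 Q2]; auto.
        split; [mlia|exact Q2].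
      * intros [Q1 Q2]. destruct (proj2 (H x Hx)) as (q & _ & Hq).
        -- split; [|exact Q2]. apply lt_succ in Q1 as [Q1|Q1]; [exact Q1|tauto].
        -- apply (dvd_intro (q * modulus m j)); [unfold modulus; mlia|]. rewrite <- Hq. mlia.
  - exists n. split; [auto|]. split; [exact Hn|]. intros x Hx. rewrite (H x Hx).
    split; intros [Q1 Q2]; (split; [|exact Q2]); [mlia|].
    apply lt_succ in Q1 as [Q1| ->]; [exact Q1|tauto].
Qed.

Definition Fin_in (x c : A) : Prop :=
  exists k, k < c + 1 /\ exists m, m < c + 1 /\ exists n, n < c + 1 /\
    (c = pr k (pr m n) /\ x < k /\ exists q, q < n + 1 /\ q * (m * (x + 1) + 1) = n).

Lemma delta2_Fin_in : delta2 Fin_in.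
Proof. unfold delta2, Fin_in. pose proof comp2_pr. delta. Qed.

Lemma Fin_in_pr x k m n : Fin_in x (pr k (pr m n)) <-> x < k /\ dvd (m * (x + 1) + 1) n.
Proof.
  split.
  - intros (k' & _ & m' & _ & n' & _ & E & H). apply pr_inj in E as [-> E].
    apply pr_inj in E as [-> ->]. exact H.
  - intros H. exists k. split; [apply pr_le_l|]. exists m.
    pose proof (pr_le_r k (pr m n)). split; [pose proof (pr_le_l m n); mlia|].
    exists n. split; [pose proof (pr_le_r m n); mlia|]. split; [reflexivity|exact H].
Qed.

Lemma Fin_in_lt x c : Fin_in x c -> x < c.
Proof.
  intros (k & _ & m & _ & n & _ & -> & H & _). pose proof (pr_le_l k (pr m n)). mlia.
Qed.

Definition Is_finset (c : A) : Prop :=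
  forall c', c' < c -> exists x, x < c /\ ~ (Fin_in x c' <-> Fin_in x c).

Lemma delta1_Is_finset : delta1 Is_finset.
Proof. unfold delta1, Is_finset. pose proof delta2_Fin_in. delta. Qed.

Lemma finset_ext c c' : Is_finset c -> Is_finset c' -> (forall x, Fin_in x c <-> Fin_in x c') -> c = c'.
Proof.
  intros H H' E. destruct (lt_total c c') as [L|[L|L]]; [|exact L|].
  - destruct (H' _ L) as (x & _ & N). destruct N. apply E.
  - destruct (H _ L) as (x & _ & N). destruct N. symmetry. apply E.
Qed.

Lemma fin_code P b : delta1 P -> exists c, forall x, Fin_in x c <-> x < b /\ P x.
Proof.
  intros HP. destruct (common_multiple b) as (m & Hm & Hb).
  assert (Q : forall j, exists n, j < b + 1 -> codes b m P j n).
  { ind1.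
    - pose proof delta2_dvd. unfold codes, modulus. sigma.
    - exists 1. intros _. now apply codes_0.
    - intros j [n Hn]. destruct (classic (j < b)) as [L|L].
      + destruct (codes_succ b m Hm Hb P j n L (Hn ltac:(mlia))) as (n' & _ & H). eauto.
      + exists 0. mlia. }
  destruct (Q b) as [n Hn]. specialize (Hn ltac:(mlia)). exists (pr b (pr m n)).
  intros x. rewrite Fin_in_pr. split.
  - intros [H1 H2]. now apply (proj2 Hn).
  - intros [H1 H2]. split; [exact H1|]. now apply (proj2 Hn).
Qed.

(** The least code, as [Is_finset] demands. Elements of the set coded by [c] are below [c], and
    those wanted are below [b]; hence comparing both up to [c + b] is enough, and this makes the
    search condition decidable. *)
Definition mkset (b : A) (P : A -> Prop) : A :=
  mu (fun c => forall x, x < c + b -> (Fin_in x c <-> x < b /\ P x)).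

Lemma mkset_aux b P c : (forall x, x < c + b -> (Fin_in x c <-> x < b /\ P x)) <->
  forall x, Fin_in x c <-> x < b /\ P x.
Proof.
  split; [|auto]. intros H x. destruct (classic (x < c + b)) as [L|L]; [auto|].
  split; [intros Q; apply Fin_in_lt in Q; mlia|intros [Q _]; mlia].
Qed.

Lemma mkset_spec b P : delta1 P -> Is_finset (mkset b P) /\
  forall x, Fin_in x (mkset b P) <-> x < b /\ P x.
Proof.
  intros HP.
  destruct (mu_spec (fun c => forall x, x < c + b -> (Fin_in x c <-> x < b /\ P x))) as [H1 H2].
  - pose proof delta2_Fin_in. unfold delta1 in *. delta.
  - destruct (fin_code P b HP) as [c Hc]. exists c. now apply mkset_aux.
  - fold (mkset b P) in *. rewrite mkset_aux in H1. split; [|exact H1].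
    intros c' Hc'. apply NNPP. intros N. apply (H2 _ Hc'). apply mkset_aux. intros x.
    rewrite <- H1. apply NNPP. intros N'. apply N. exists x. split; [|exact N'].
    destruct (classic (Fin_in x c')) as [Q|Q].
    + apply Fin_in_lt in Q. mlia.
    + apply Fin_in_lt. tauto.
Qed.

Lemma Fin_in_mkset b (P : A -> Prop) x : delta1 P -> (Fin_in x (mkset b P) <-> x < b /\ P x).
Proof. intros HP. now apply mkset_spec. Qed.

Lemma comp_mkset f (P : env -> A -> Prop) : comp f -> delta (fun e => P (fun i => e (S i)) (e 0%nat)) ->
  comp (fun e => mkset (f e) (P e)).
Proof.
  intros Hf HP. pose proof delta2_Fin_in. unfold mkset.
  apply (comp_mu (fun e c => forall x, x < c + f e -> (Fin_in x c <-> x < f e /\ P e x))).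
  - pose proof (comp_ren _ S Hf). pose proof (comp_ren _ (fun i => S (S i)) Hf).
    apply (delta_ball (fun e => e 0%nat + f (fun i => e (S i)))
      (fun e x => Fin_in x (e 0%nat) <-> x < f (fun i => e (S i)) /\ P (fun i => e (S i)) x)).
    + apply (comp_app2 (@add A)); [defn|comp|assumption].
    + apply delta_iff; [delta|]. apply delta_and.
      * apply (delta_app2 (@lt A)); [defn|comp|assumption].
      * exact (delta_ren _ (fun i => match i with 0 => 0 | S j => S (S j) end)%nat HP).
  - intros e. destruct (fin_code (P e) (f e)) as [c Hc]; [now apply delta_spec|].
    exists c. auto.
Qed.

(** * Finite sequences *)

Definition Nth (s i x : A) : Prop := Fin_in (pr i x) s.

Lemma delta3_Nth : delta3 Nth.
Proof. unfold delta3, Nth. pose proof comp2_pr. pose proof delta2_Fin_in. delta. Qed.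

Definition Is_seq (s l : A) : Prop :=
  Is_finset s /\
  (forall z, Fin_in z s -> exists i, exists x, z = pr i x /\ i < l) /\
  (forall i, i < l -> exists x, Nth s i x /\ forall y, Nth s i y -> y = x).

Lemma Nth_lt s i x : Nth s i x -> i < s /\ x < s.
Proof.
  intros H. apply Fin_in_lt in H. pose proof (pr_le_l i x). pose proof (pr_le_r i x). mlia.
Qed.

Lemma delta2_Is_seq : delta2 Is_seq.
Proof.
  pose proof comp2_pr. pose proof delta2_Fin_in. pose proof delta3_Nth. pose proof delta1_Is_finset.
  unfold delta2.
  apply (delta_ext (fun e => Is_finset (e 0%nat) /\
    (forall z, z < e 0%nat -> Fin_in z (e 0%nat) -> exists i, i < z + 1 /\ exists x, x < z + 1 /\ (z = pr i x /\ i < e 1%nat)) /\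
    (forall i, i < e 1%nat -> exists x, x < e 0%nat /\ (Nth (e 0%nat) i x /\ forall y, y < e 0%nat -> Nth (e 0%nat) i y -> y = x)))).
  { delta. }
  intros e. unfold Is_seq. split; intros (K1 & K2 & K3); (split; [exact K1|split]).
  - intros z _ Hz. destruct (K2 z Hz) as (i & x & -> & L). exists i. split; [apply pr_le_l|].
    exists x. split; [apply pr_le_r|auto].
  - intros i Hi. destruct (K3 i Hi) as (x & Hx & U). exists x. split; [now apply (Nth_lt _ i)|auto].
  - intros z Hz. destruct (K2 z (Fin_in_lt _ _ Hz) Hz) as (i & _ & x & _ & K). eauto.
  - intros i Hi. destruct (K3 i Hi) as (x & _ & Hx & U). exists x. split; [exact Hx|].
    intros y Hy. apply U; [now apply (Nth_lt _ i)|exact Hy].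
Qed.

(** The value is [s] itself if there is no term [i]. *)
Definition el (s i : A) : A := bmu s (fun x => Nth s i x).

Lemma comp2_el : comp2 el.
Proof. unfold comp2, el. pose proof delta3_Nth. comp. Qed.

Lemma Nth_el s l i x : Is_seq s l -> i < l -> (Nth s i x <-> x = el s i).
Proof.
  intros (_ & _ & H) Hi. destruct (H i Hi) as (y & Hy & U).
  destruct (bmu_spec s (fun x => Nth s i x) y) as [Q _].
  - pose proof delta3_Nth. unfold delta1. delta.
  - exact Hy.
  - now apply (Nth_lt _ i).
  - fold (el s i) in Q. apply U in Q as E. split; [intros Hx; rewrite E; now apply U|now intros ->].
Qed.

Lemma el_Nth s l i : Is_seq s l -> i < l -> Nth s i (el s i).
Proof. intros H Hi. now apply (Nth_el s l). Qed.

Lemma el_lt s l i : Is_seq s l -> i < l -> el s i < s.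
Proof. intros H Hi. apply (Nth_lt s i). now apply (el_Nth s l). Qed.

Lemma Nth_bound s l i x : Is_seq s l -> Nth s i x -> i < l.
Proof.
  intros (_ & H & _) Hx. destruct (H _ Hx) as (i' & x' & E & L).
  apply pr_inj in E as [-> _]. exact L.
Qed.

Lemma seq_ext s s' l : Is_seq s l -> Is_seq s' l -> (forall i, i < l -> el s i = el s' i) -> s = s'.
Proof.
  intros H H' E.
  assert (W : forall t t', Is_seq t l -> Is_seq t' l -> (forall i, i < l -> el t i = el t' i) ->
    forall x, Fin_in x t -> Fin_in x t').
  { intros t t' Ht Ht' Q x Hx. destruct (proj1 (proj2 Ht) x Hx) as (i & y & -> & L).
    change (Nth t' i y). change (Nth t i y) in Hx. apply (Nth_el t' l); auto.
    rewrite <- Q by auto. now apply (Nth_el t l). }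
  apply finset_ext; [apply H|apply H'|]. intros x. split; eapply W; eauto.
  intros i Hi. symmetry. auto.
Qed.

Lemma len_unique s l l' : Is_seq s l -> Is_seq s l' -> l = l'.
Proof.
  assert (W : forall l l', Is_seq s l -> Is_seq s l' -> ~ l < l').
  { intros m m' Hm Hm' L. pose proof (el_Nth s m' m Hm' L) as Q.
    apply (Nth_bound s m) in Q; [mlia|exact Hm]. }
  intros H H'. destruct (lt_total l l') as [L|[L|L]]; [|exact L|]; exfalso.
  - exact (W _ _ H H' L).
  - exact (W _ _ H' H L).
Qed.

Definition len (s : A) : A := bmu (s + 1) (fun l => Is_seq s l).

Lemma comp1_len : comp1 len.
Proof. unfold comp1, len. pose proof delta2_Is_seq. comp. Qed.

Lemma len_le s l : Is_seq s l -> le l s.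
Proof.
  intros H. destruct (zero_or_succ l) as [->|[k ->]]; [mlia|].
  assert (L : k < k + 1) by mlia. pose proof (el_Nth _ _ k H L) as Q. apply Nth_lt in Q. mlia.
Qed.

Lemma len_eq s l : Is_seq s l -> len s = l.
Proof.
  intros H. apply (len_unique s); [|exact H].
  apply (bmu_spec (s + 1) (fun l => Is_seq s l) l); [|exact H|now apply len_le].
  pose proof delta2_Is_seq. unfold delta1. delta.
Qed.

Lemma collection (R : A -> A -> Prop) a : sigma2 R ->
  (forall x, x < a -> exists y, R x y) -> exists w, forall x, x < a -> exists y, y < w /\ R x y.
Proof.
  intros (Q & HQ & H) Ha.
  assert (HR : forall x y, R x y <-> exists z, Q (scons z (scons x (fun _ => y)))).
  { intros x y. exact (H (scons x (fun _ => y))). }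
  destruct (collection0 (fun x u => exists y, y < u /\ exists z, z < u /\ Q (scons z (scons x (fun _ => y)))) a) as [w Hw].
  - def0. eapply def0_ext.
    + apply (def0_ren Q (fun i => match i with 0 => 0 | 1 => 2 | _ => 1 end)%nat HQ).
    + intros e. cbv beta. match goal with |- Q ?a <-> Q ?b => replace b with a; [tauto|] end.
      extensionality i. now destruct i as [|[|i]].
  - intros x Hx. destruct (Ha x Hx) as [y Hy]. apply HR in Hy as [z Hz].
    exists (y + z + 1), y. split; [mlia|]. exists z. split; [mlia|exact Hz].
  - exists w. intros x Hx. destruct (Hw x Hx) as (u & Hu & y & Hy & z & _ & Hz).
    exists y. split; [mlia|]. apply HR. eauto.
Qed.

Lemma comp1_bound (F : A -> A) a : comp1 F -> exists b, forall x, x < a -> F x < b.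
Proof.
  intros HF. destruct (collection (fun x y => y = F x) a) as [w Hw].
  - exact (sigma_ren _ (fun i => match i with 0 => 1 | _ => 0 end)%nat HF).
  - eauto.
  - exists w. intros x Hx. destruct (Hw x Hx) as (y & Hy & ->). exact Hy.
Qed.

Definition mkseq (l : A) (F : A -> A) : A :=
  mkset (mu (fun b => forall i, i < l -> pr i (F i) < b))
    (fun z => exists i, i < l /\ z = pr i (F i)).

Lemma comp1_pr_F (F : A -> A) : comp1 F -> comp1 (fun i => pr i (F i)).
Proof.
  intros H. pose proof comp2_pr.
  apply (comp_app2 pr); [defn|comp|exact H].
Qed.

Lemma mkseq_spec l F : comp1 F ->
  Is_seq (mkseq l F) l /\ forall i, i < l -> el (mkseq l F) i = F i.
Proof.
  intros HF.
  assert (Hb : forall i, i < l -> pr i (F i) < mu (fun b => forall i, i < l -> pr i (F i) < b)).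
  { apply mu_spec.
    - apply (delta_ball (fun _ => l) (fun e i => pr i (F i) < e 0%nat)); [comp|].
      apply (delta_app2 (@lt A)); [defn| |comp]. now apply (comp1_pr_F F) in HF.
    - apply comp1_bound. now apply comp1_pr_F. }
  destruct (mkset_spec (mu (fun b => forall i, i < l -> pr i (F i) < b))
    (fun z => exists i, i < l /\ z = pr i (F i))) as [H1 H2].
  { apply (delta_bex (fun _ => l) (fun e i => e 0%nat = pr i (F i))); [comp|].
    apply (delta_app2 eq); [defn|comp|]. now apply (comp1_pr_F F) in HF. }
  fold (mkseq l F) in *.
  assert (HN : forall i x, Nth (mkseq l F) i x <-> i < l /\ x = F i).
  { intros i x. unfold Nth. rewrite H2. split.
    - intros (_ & j & Hj & E). apply pr_inj in E as [-> ->]. auto.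
    - intros [Hi ->]. split; [auto|eauto]. }
  assert (S : Is_seq (mkseq l F) l).
  { split; [exact H1|]. split.
    - intros z Hz. apply H2 in Hz as (_ & i & Hi & ->). eauto.
    - intros i Hi. exists (F i). split; [now apply HN|]. intros y Hy. now apply HN in Hy. }
  split; [exact S|]. intros i Hi. apply (el_Nth _ _ i S) in Hi. now apply HN in Hi.
Qed.

Lemma mkseq_seq l F : comp1 F -> Is_seq (mkseq l F) l.
Proof. intros H. now apply mkseq_spec. Qed.

Lemma el_mkseq l F i : comp1 F -> i < l -> el (mkseq l F) i = F i.
Proof. intros H. now apply mkseq_spec. Qed.

Lemma comp_mkseq f (F : env -> A -> A) : comp f -> comp (fun e => F (fun i => e (S i)) (e 0%nat)) ->
  comp (fun e => mkseq (f e) (F e)).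
Proof.
  intros Hf HF. pose proof comp2_pr.
  apply (comp_mkset (fun e => mu (fun b => forall i, i < f e -> pr i (F e i) < b))
    (fun e z => exists i, i < f e /\ z = pr i (F e i))).
  - apply (comp_mu (fun e b => forall i, i < f e -> pr i (F e i) < b)).
    + apply (delta_ball (fun e => f (fun i => e (S i))) (fun e i => pr i (F (fun i => e (S i)) i) < e 0%nat)).
      * exact (comp_ren _ S Hf).
      * apply (delta_app2 (@lt A)); [defn| |comp]. apply (comp_app2 pr); [defn|comp|].
        exact (comp_ren _ (fun i => match i with 0 => 0 | S j => S (S j) end)%nat HF).
    + intros e. apply comp1_bound. apply comp1_pr_F.
      now apply comp_spec with (P := fun e i => F e i).
  - apply (delta_bex (fun e => f (fun i => e (S i))) (fun e i => e 0%nat = pr i (F (fun i => e (S i)) i))).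
    + exact (comp_ren _ S Hf).
    + apply (delta_app2 eq); [defn|comp|]. apply (comp_app2 pr); [defn|comp|].
      exact (comp_ren _ (fun i => match i with 0 => 0 | S j => S (S j) end)%nat HF).
Qed.

(** * Primitive recursion, sums and powers *)

Definition prec_trace (a : A) (G : A -> A -> A) (n s : A) : Prop :=
  Is_seq s (n + 1) /\ el s 0 = a /\ forall i, i < n -> el s (i + 1) = G i (el s i).

(** Recursion as a search for the least record of all values up to [n]. Such a record exists by
    Sigma01 induction, which only appends one value at a time. *)
Definition prec (a : A) (G : A -> A -> A) (n : A) : A := el (mu (prec_trace a G n)) n.

Lemma delta_prec_trace (f g h : env -> A) (G : env -> A -> A -> A) :
  comp f -> comp g -> comp h ->
  comp (fun e => G (fun i => e (S (S i))) (e 0%nat) (e 1%nat)) ->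
  delta (fun e => prec_trace (f e) (G e) (g e) (h e)).
Proof.
  intros Hf Hg Hh HG. pose proof delta2_Is_seq. pose proof comp2_el.
  unfold prec_trace. apply delta_and; [|apply delta_and].
  - apply (delta_app2 Is_seq); [defn|exact Hh|].
    apply (comp_app2 (@add A)); [defn|exact Hg|comp].
  - apply (delta_app2 eq); [defn| |exact Hf]. apply (comp_app2 el); [defn|exact Hh|comp].
  - apply (delta_ball g (fun e i => el (h e) (i + 1) = G e i (el (h e) i)) Hg).
    pose proof (comp_ren _ S Hh).
    apply (delta_app2 eq); [defn| |].
    + apply (comp_app2 el); [defn|assumption|comp].
    + apply (comp_subst (fun e y => G (fun i => e (S i)) (e 0%nat) y) (fun e => el (h (fun i => e (S i))) (e 0%nat))).
      * apply (comp_app2 el); [defn|assumption|comp].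
      * exact (comp_ren _ (fun i => match i with 0 => 1 | 1 => 0 | S (S j) => S (S j) end)%nat HG).
Qed.

Lemma prec_trace_ex a G n : comp2 G -> exists s, prec_trace a G n s.
Proof.
  intros HG. pose proof comp2_el. revert n. ind1.
  - apply (sigma_ex (fun e s => prec_trace a G (e 0%nat) s)). apply delta_sigma.
    apply (delta_prec_trace (fun _ => a) (fun e => e 1%nat) (fun e => e 0%nat) (fun _ => G)); comp.
  - exists (mkseq (0 + 1) (fun _ => a)).
    assert (Q : comp1 (fun _ : A => a)) by (unfold comp1; comp).
    split; [now apply mkseq_seq|]. split; [apply el_mkseq; [exact Q|mlia]|]. intros i Hi. mlia.
  - intros n (s & H1 & H2 & H3).
    pose (F := fun i => ite (i < n + 1) (el s i) (G n (el s n))).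
    assert (Q : comp1 F) by (unfold comp1, F; comp).
    exists (mkseq (n + 1 + 1) F). split; [now apply mkseq_seq|]. split.
    + rewrite el_mkseq by (exact Q || mlia). unfold F. rewrite ite_true by mlia. exact H2.
    + intros i Hi. rewrite !el_mkseq by (exact Q || mlia). unfold F.
      destruct (classic (i < n)) as [L|L].
      * rewrite !ite_true by mlia. now apply H3.
      * assert (i = n) by mlia. subst i. rewrite ite_false, ite_true by mlia. reflexivity.
Qed.

Lemma prec_trace_spec a G n : comp2 G -> prec_trace a G n (mu (prec_trace a G n)).
Proof.
  intros HG. apply mu_spec; [|now apply prec_trace_ex].
  apply (delta_prec_trace (fun _ => a) (fun e => n) (fun e => e 0%nat) (fun _ => G)); comp.
Qed.

Lemma prec_trace_agree a G n n' s s' i : comp2 G -> prec_trace a G n s -> prec_trace a G n' s' ->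
  i < n + 1 -> i < n' + 1 -> el s i = el s' i.
Proof.
  intros HG (_ & H2 & H3) (_ & H2' & H3'). pose proof comp2_el. revert i. ind1.
  - sigma.
  - intros _ _. now rewrite H2, H2'.
  - intros i IH L L'. rewrite H3, H3' by mlia. rewrite IH by mlia. reflexivity.
Qed.

Lemma prec_0 a G : comp2 G -> prec a G 0 = a.
Proof. intros HG. apply (prec_trace_spec a G 0 HG). Qed.

Lemma prec_succ a G n : comp2 G -> prec a G (n + 1) = G n (prec a G n).
Proof.
  intros HG. unfold prec. pose proof (prec_trace_spec a G n HG) as H.
  pose proof (prec_trace_spec a G (n + 1) HG) as H'.
  rewrite (prec_trace_agree _ _ _ _ _ _ n HG H H') by mlia. apply H'. mlia.
Qed.

Lemma comp_prec f (G : env -> A -> A -> A) g : comp f ->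
  comp (fun e => G (fun i => e (S (S i))) (e 0%nat) (e 1%nat)) -> comp g ->
  comp (fun e => prec (f e) (G e) (g e)).
Proof.
  intros Hf HG Hg. pose proof comp2_el. unfold prec. apply (comp_app2 el); [defn| |exact Hg].
  apply (comp_mu (fun e s => prec_trace (f e) (G e) (g e) s)).
  - apply (delta_prec_trace (fun e => f (fun i => e (S i))) (fun e => g (fun i => e (S i))) (fun e => e 0%nat)
      (fun e => G (fun i => e (S i)))).
    + exact (comp_ren _ S Hf).
    + exact (comp_ren _ S Hg).
    + comp.
    + exact (comp_ren _ (fun i => match i with 0 => 0 | 1 => 1 | S (S j) => S (S (S j)) end)%nat HG).
  - intros e. apply prec_trace_ex. now apply comp_spec2.
Qed.

Definition sum (l : A) (f : A -> A) : A := prec 0 (fun i acc => acc + f i) l.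

Lemma comp2_sum_step (f : A -> A) : comp1 f -> comp2 (fun i acc => acc + f i).
Proof. intros H. unfold comp2. comp. Qed.

Lemma sum_0 f : comp1 f -> sum 0 f = 0.
Proof. intros H. apply prec_0. now apply comp2_sum_step. Qed.

Lemma sum_succ l f : comp1 f -> sum (l + 1) f = sum l f + f l.
Proof. intros H. unfold sum. rewrite prec_succ; [reflexivity|]. now apply comp2_sum_step. Qed.

Lemma comp_sum g (f : env -> A -> A) : comp g -> comp (fun e => f (fun i => e (S i)) (e 0%nat)) ->
  comp (fun e => sum (g e) (f e)).
Proof.
  intros Hg Hf. apply (comp_prec (fun _ => 0) (fun e i acc => acc + f e i) g); [comp| |exact Hg].
  apply (comp_app2 (@add A)); [defn|comp|].
  exact (comp_ren _ (fun i => match i with 0 => 0 | S j => S (S j) end)%nat Hf).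
Qed.

Definition pow (b n : A) : A := prec 1 (fun _ acc => acc * b) n.

Lemma comp2_pow_step (b : A) : comp2 (fun _ acc : A => acc * b).
Proof. unfold comp2. comp. Qed.

Lemma pow_0 b : pow b 0 = 1.
Proof. apply prec_0, comp2_pow_step. Qed.

Lemma pow_succ b n : pow b (n + 1) = pow b n * b.
Proof. apply (prec_succ 1 (fun _ acc => acc * b) n), comp2_pow_step. Qed.

Lemma comp2_pow : comp2 pow.
Proof.
  apply (comp_prec (fun _ => 1) (fun e _ acc => acc * e 0%nat) (fun e => e 1%nat)); comp.
Qed.

(** The least code of a set of numbers below [k] is at most the code built from a product of moduli,
    and this product has at most [k] factors, each at most [m * k + 1]. It later bounds the
    size-change graphs of a program. *)
Lemma fin_bound k : exists B, forall c, Is_finset c -> (forall x, Fin_in x c -> x < k) -> c < B.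
Proof.
  destruct (common_multiple k) as (m & Hm & Hk).
  exists (pr k (pr m (pow (m * k + 1) k)) + 1). intros c Hc Hx.
  pose proof delta2_Fin_in. pose proof comp2_pow. pose proof delta2_dvd.
  assert (Q : forall j, j < k + 1 -> exists n, n < pow (m * k + 1) j + 1 /\ codes k m (fun x => Fin_in x c) j n).
  { ind1.
    - unfold codes, modulus. sigma.
    - intros _. exists 1. split; [rewrite pow_0; mlia|]. now apply codes_0.
    - intros j IH L. destruct (IH ltac:(mlia)) as (n & Hn & C).
      destruct (codes_succ k m Hm Hk _ j n ltac:(mlia) C) as (n' & E & C').
      exists n'. split; [|exact C']. rewrite pow_succ.
      assert (Hd : le (m * (j + 1) + 1) (m * k + 1)).
      { assert (L' : j < k) by mlia. apply lt_iff in L' as [t ->]. mnia. }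
      revert Hn Hd. generalize (pow (m * k + 1) j). intros p Hn Hd.
      unfold modulus in E. destruct E as [-> | ->].
      + mnia.
      + apply lt_iff in Hn as [u Hu]. assert (Hp : p = n + u) by mlia. subst p.
        unfold le in Hd. apply lt_iff in Hd as [v Hv].
        assert (Hk' : m * k + 1 = m * (j + 1) + 1 + v) by mlia. rewrite Hk'. mnia. }
  destruct (Q k ltac:(mlia)) as (n & Hn & C).
  assert (E : forall x, Fin_in x (pr k (pr m n)) <-> Fin_in x c).
  { intros x. rewrite Fin_in_pr. split.
    - intros [H1' H2]. now apply (proj2 C) in H2.
    - intros H2. split; [auto|]. apply (proj2 C); auto. }
  assert (L : ~ pr k (pr m n) < c).
  { intros L. destruct (Hc _ L) as (x & _ & N). apply N, E. }
  pose proof (pr_mono k (pr m n) k (pr m (pow (m * k + 1) k))) as P.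
  assert (le (pr m n) (pr m (pow (m * k + 1) k))) by (apply pr_mono; [mlia|exact Hn]).
  assert (le k k) by mlia. specialize (P H3 H2). mlia.
Qed.

End Finite.

#[export] Hint Resolve comp2_pr delta2_Fin_in delta1_Is_finset delta3_Nth delta2_Is_seq comp2_el comp1_len comp2_pow : defn.

Ltac comp_extra ::=
  lazymatch goal with
  | |- comp (fun e => mkset (@?f e) (@?P e)) => apply (comp_mkset f P); [comp|delta]
  | |- comp (fun e => mkseq (@?f e) (@?F e)) => apply (comp_mkseq f F); [comp|comp]
  | |- comp (fun e => prec (@?f e) (@?G e) (@?g e)) => apply (comp_prec f G g); [comp|comp|comp]
  | |- comp (fun e => sum (@?g e) (@?f e)) => apply (comp_sum g f); [comp|comp]
  end.

(** * The statement in a model *)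

Section Semantics.
Context {A : model}.
Notation "0" := (@zero A).
Notation "1" := (@one A).
Infix "+" := (@add A).
Infix "*" := (@mul A).
Infix "<" := (@lt A).
Notation "⟨ a , b ⟩" := (pr a b) (at level 0, a at level 99, b at level 99).

Fixpoint num (k : nat) : A :=
  match k with O => 0 | S O => 1 | S k' => num k' + 1 end.

Definition Generated (rule : (A -> Prop) -> A -> Prop) (x : A) : Prop :=
  exists d, Fin_in x d /\ forall y, Fin_in y d -> rule (fun z => Fin_in z d) y.

Definition Ord_lt_rule (M : A -> Prop) (z : A) : Prop :=
  exists a b n m, z = ⟨a, b⟩ /\ Is_seq a n /\ Is_seq b m /\
    ((n < m /\ (forall j, j < n -> exists x, Nth a j x /\ Nth b j x)) \/
     (exists i, i < n /\ i < m /\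
        (forall j, j < i -> exists x, Nth a j x /\ Nth b j x) /\
        (exists x y, Nth a i x /\ Nth b i y /\ M ⟨x, y⟩))).

Definition Ord_lt (a b : A) : Prop := Generated Ord_lt_rule ⟨a, b⟩.

Definition Is_ord_rule (M : A -> Prop) (a : A) : Prop :=
  exists n, Is_seq a n /\
    (forall i, i < n -> exists x, Nth a i x /\ M x) /\
    (forall i x y, i + 1 < n -> Nth a i x -> Nth a (i + 1) y -> y = x \/ Ord_lt y x).

Definition Is_ord (a : A) : Prop := Generated Is_ord_rule a.

Definition Is_omega_exp (a b : A) : Prop := Is_seq b 1 /\ Nth b 0 a.

Fixpoint Is_omega_tower (d : nat) (a : A) : Prop :=
  match d with
  | O => exists z, Is_seq z 0 /\ Is_omega_exp z a
  | S d' => exists b, Is_omega_tower d' b /\ Is_omega_exp b a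
  end.

Definition Wo (a : A) : Prop :=
  ~ (exists F : sets A,
      (forall i, exists x, mem ⟨i, x⟩ F /\ forall y, mem ⟨i, y⟩ F -> y = x) /\
      (forall i x, mem ⟨i, x⟩ F -> Is_ord x) /\
      (forall x, mem ⟨0, x⟩ F -> Ord_lt x a) /\
      (forall i x y, mem ⟨i, x⟩ F -> mem ⟨i + 1, y⟩ F -> Ord_lt y x)).

Definition Wo_omega_tower (d : nat) : Prop := exists a, Is_omega_tower d a /\ Wo a.

Definition E_var (i : A) : A := ⟨num 0, i⟩.
Definition E_succ (i : A) : A := ⟨num 1, i⟩.
Definition E_pred (i : A) : A := ⟨num 2, i⟩.
Definition E_call (f s : A) : A := ⟨num 3, ⟨f, s⟩⟩.
Definition E_op (o s : A) : A := ⟨num 4, ⟨o, s⟩⟩.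
Definition E_if (b e0 e1 : A) : A := ⟨num 5, ⟨b, ⟨e0, e1⟩⟩⟩.

Definition B_eq0 (i : A) : A := ⟨num 0, i⟩.
Definition B_eq1 (i : A) : A := ⟨num 1, i⟩.
Definition B_lt (i j : A) : A := ⟨num 2, ⟨i, j⟩⟩.
Definition B_le (i j : A) : A := ⟨num 3, ⟨i, j⟩⟩.
Definition B_and (b c : A) : A := ⟨num 4, ⟨b, c⟩⟩.
Definition B_or (b c : A) : A := ⟨num 5, ⟨b, c⟩⟩.
Definition B_not (b : A) : A := ⟨num 6, b⟩.

Definition T_num (u : A) : A := ⟨num 0, u⟩.
Definition T_call (f s : A) : A := ⟨num 1, ⟨f, s⟩⟩.
Definition T_op (o s : A) : A := ⟨num 2, ⟨o, s⟩⟩.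

Definition Equation (P f n e : A) : Prop := Nth P f ⟨n, e⟩.

Definition Is_bool_rule (n : A) (M : A -> Prop) (b : A) : Prop :=
  (exists i, i < n /\ (b = B_eq0 i \/ b = B_eq1 i)) \/
  (exists i j, i < n /\ j < n /\ (b = B_lt i j \/ b = B_le i j)) \/
  (exists c d, (b = B_and c d \/ b = B_or c d) /\ M c /\ M d) \/
  (exists c, b = B_not c /\ M c).

Definition Is_bool (n b : A) : Prop := Generated (Is_bool_rule n) b.

Definition Is_arith_rule (P n : A) (M : A -> Prop) (a : A) : Prop :=
  (exists i, i < n /\ (a = E_var i \/ a = E_succ i \/ a = E_pred i)) \/
  (exists f s k e, a = E_call f s /\ Equation P f k e /\ Is_seq s k /\
     (forall i, i < k -> exists x, Nth s i x /\ M x)) \/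
  (exists p s k, a = E_op ⟨p, k⟩ s /\ Is_seq s k /\
     (forall i, i < k -> exists x, Nth s i x /\ M x)).

Definition Is_arith (P n a : A) : Prop := Generated (Is_arith_rule P n) a.

Definition Is_expr_rule (P n : A) (M : A -> Prop) (e : A) : Prop :=
  Is_arith P n e \/
  (exists b e0 e1, e = E_if b e0 e1 /\ Is_bool n b /\ M e0 /\ M e1).

Definition Is_expr (P n e : A) : Prop := Generated (Is_expr_rule P n) e.

Definition Is_program (P : A) : Prop :=
  exists N, Is_seq P N /\ 0 < N /\
    (forall f, f < N -> exists n e, Equation P f n e /\ Is_expr P n e).

Definition Op_value (I : sets A) (o u v : A) : Prop := mem ⟨⟨o, u⟩, v⟩ I.

Definition Is_interpretation (I : sets A) : Prop :=
  forall p k u, Is_seq u k -> exists v, Op_value I ⟨p, k⟩ u v /\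
    forall w, Op_value I ⟨p, k⟩ u w -> w = v.

Definition Truth_value (v : A) (p : Prop) : Prop := (p /\ v = 1) \/ (~ p /\ v = 0).

Definition Bool_val_rule (u : A) (M : A -> Prop) (z : A) : Prop :=
  exists b v, z = ⟨b, v⟩ /\
    ((exists i x, b = B_eq0 i /\ Nth u i x /\ Truth_value v (x = 0)) \/
     (exists i x, b = B_eq1 i /\ Nth u i x /\ Truth_value v (x = 1)) \/
     (exists i j x y, b = B_lt i j /\ Nth u i x /\ Nth u j y /\ Truth_value v (x < y)) \/
     (exists i j x y, b = B_le i j /\ Nth u i x /\ Nth u j y /\
        Truth_value v (x < y \/ x = y)) \/
     (exists c d v0 v1, b = B_and c d /\ M ⟨c, v0⟩ /\ M ⟨d, v1⟩ /\
        Truth_value v (v0 = 1 /\ v1 = 1)) \/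
     (exists c d v0 v1, b = B_or c d /\ M ⟨c, v0⟩ /\ M ⟨d, v1⟩ /\
        Truth_value v (v0 = 1 \/ v1 = 1)) \/
     (exists c v0, b = B_not c /\ M ⟨c, v0⟩ /\ Truth_value v (~ (v0 = 1)))).

Definition Bool_val (u b v : A) : Prop := Generated (Bool_val_rule u) ⟨b, v⟩.

Definition Pointwise (R : A -> A -> Prop) (s s' : A) : Prop :=
  exists k, Is_seq s k /\ Is_seq s' k /\
    (forall i, i < k -> exists x y, Nth s i x /\ Nth s' i y /\ R x y).

Definition Subst_rule (u : A) (M : A -> Prop) (z : A) : Prop :=
  exists e t, z = ⟨e, t⟩ /\
    ((exists i x, e = E_var i /\ Nth u i x /\ t = T_num x) \/
     (exists i x, e = E_succ i /\ Nth u i x /\ t = T_num (x + 1)) \/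
     (exists i x y, e = E_pred i /\ Nth u i x /\
        (x = y + 1 \/ (x = 0 /\ y = 0)) /\ t = T_num y) \/
     (exists f s s', e = E_call f s /\ t = T_call f s' /\
        Pointwise (fun x y => M ⟨x, y⟩) s s') \/
     (exists o s s', e = E_op o s /\ t = T_op o s' /\
        Pointwise (fun x y => M ⟨x, y⟩) s s') \/
     (exists b e0 e1, e = E_if b e0 e1 /\
        ((Bool_val u b 1 /\ M ⟨e0, t⟩) \/ (Bool_val u b 0 /\ M ⟨e1, t⟩)))).

Definition Subst (u e t : A) : Prop := Generated (Subst_rule u) ⟨e, t⟩.

Definition Numerals (u s : A) : Prop := Pointwise (fun x y => y = T_num x) u s.

Definition Step_rule (I : sets A) (P : A) (M : A -> Prop) (z : A) : Prop :=
  exists t t', z = ⟨t, t'⟩ /\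
    ((exists f s u n e, t = T_call f s /\ Equation P f n e /\ Is_seq u n /\
        Numerals u s /\ Subst u e t') \/
     (exists o s u v, t = T_op o s /\ Numerals u s /\ Op_value I o u v /\
        t' = T_num v) \/
     (exists h s s' k i,
        ((t = T_call h s /\ t' = T_call h s') \/
         (t = T_op h s /\ t' = T_op h s')) /\
        Is_seq s k /\ Is_seq s' k /\ i < k /\
        (forall j, j < i -> exists x, Nth s j (T_num x)) /\
        (exists x x', Nth s i x /\ Nth s' i x' /\ M ⟨x, x'⟩) /\
        (forall j, j < k -> ~ (j = i) -> exists x, Nth s j x /\ Nth s' j x))).

Definition Step (I : sets A) (P t t' : A) : Prop := Generated (Step_rule I P) ⟨t, t'⟩.

Definition Reduces (I : sets A) (P t t' : A) : Prop :=
  exists s n, Is_seq s (n + 1) /\ Nth s 0 t /\ Nth s n t' /\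
    (forall i, i < n -> exists x y, Nth s i x /\ Nth s (i + 1) y /\ Step I P x y).

Definition Terminating (I : sets A) (P : A) : Prop :=
  forall n e u s, Equation P 0 n e -> Is_seq u n -> Numerals u s ->
    exists v, Reduces I P (T_call 0 s) (T_num v).

Definition Child (e i e' : A) : Prop :=
  (exists h s, (e = E_call h s \/ e = E_op h s) /\ Nth s i e') \/
  (exists b e0 e1, e = E_if b e0 e1 /\ ((i = 0 /\ e' = e0) \/ (i = 1 /\ e' = e1))).

Definition Subexpr_at (e tau e' : A) : Prop :=
  exists l s, Is_seq tau l /\ Is_seq s (l + 1) /\ Nth s 0 e /\ Nth s l e' /\
    (forall j, j < l -> exists x i y,
       Nth s j x /\ Nth tau j i /\ Nth s (j + 1) y /\ Child x i y).

Definition Call (P f tau g : A) : Prop :=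
  exists n e s, Equation P f n e /\ Subexpr_at e tau (E_call g s).

Definition Transition (I : sets A) (P f u tau g v : A) : Prop :=
  exists n e s s', Equation P f n e /\ Is_seq u n /\
    Subexpr_at e tau (E_call g s) /\
    Subst u (E_call g s) (T_call g s') /\
    Pointwise (fun t x => Reduces I P t (T_num x)) s' v.

Definition Strict_arc (G x y : A) : Prop := Fin_in ⟨⟨x, y⟩, num 1⟩ G.
Definition Weak_arc (G x y : A) : Prop := Fin_in ⟨⟨x, y⟩, num 0⟩ G.

Definition Is_graph (P f g G : A) : Prop :=
  Is_finset G /\
  (exists n e k e', Equation P f n e /\ Equation P g k e' /\
     (forall z, Fin_in z G ->
        exists x y, x < n /\ y < k /\ (z = ⟨⟨x, y⟩, num 1⟩ \/ z = ⟨⟨x, y⟩, num 0⟩))).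

Definition Graph_relates (G u v : A) : Prop :=
  (forall x y, Strict_arc G x y -> exists a b, Nth u x a /\ Nth v y b /\ b < a) /\
  (forall x y, Weak_arc G x y -> exists a b, Nth u x a /\ Nth v y b /\ (b < a \/ b = a)).

Definition Composition (G H K : A) : Prop :=
  (forall x z, Strict_arc K x z <->
     exists y, (Strict_arc G x y /\ (Strict_arc H y z \/ Weak_arc H y z)) \/
           (Weak_arc G x y /\ Strict_arc H y z)) /\
  (forall x z, Weak_arc K x z <->
     (exists y, Weak_arc G x y /\ Weak_arc H y z) /\ ~ Strict_arc K x z).

Definition Assigns (D f tau G : A) : Prop := Fin_in ⟨⟨f, tau⟩, G⟩ D.

Definition Is_description (P D : A) : Prop :=
  forall f tau g, Call P f tau g ->
    (exists G, Assigns D f tau G /\ forall G', Assigns D f tau G' -> G' = G) /\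
    (forall G, Assigns D f tau G -> Is_graph P f g G).

Definition Safe (I : sets A) (P D : A) : Prop :=
  forall f tau g G u v, Call P f tau g -> Assigns D f tau G ->
    Transition I P f u tau g v -> Graph_relates G u v.

Definition In_closure (P D f g G : A) : Prop :=
  exists s n, Is_seq s (n + 1) /\ Nth s n ⟨⟨f, g⟩, G⟩ /\
    (forall i, i < n + 1 -> exists f' g' G', Nth s i ⟨⟨f', g'⟩, G'⟩ /\
       ((exists tau, Call P f' tau g' /\ Assigns D f' tau G') \/
        (exists j k h G0 G1, j < i /\ k < i /\
           Nth s j ⟨⟨f', h⟩, G0⟩ /\ Nth s k ⟨⟨h, g'⟩, G1⟩ /\
           Is_graph P f' g' G' /\ Composition G0 G1 G'))).

Definition Isct (P D : A) : Prop :=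
  forall f G, In_closure P D f f G -> Composition G G G -> exists x, Strict_arc G x x.

Definition Isct_soundness : Prop :=
  forall I : sets A, Is_interpretation I ->
    forall P D, Is_program P -> Is_description P D -> Safe I P D -> Isct P D ->
      Terminating I P.

End Semantics.

(** The predicates above mirror the formulas connective by connective, so [sat] of the sentence,
    with all de Bruijn indices computed, is convertible to the semantic statement. *)
Lemma sat_statement (A : model) (e : nat -> A) E :
  (@Wo_omega_tower A 3 -> @Isct_soundness A) ->
  sat e E (sentence (f_imp (WO_omega_tower 3) ISCT_soundness)).
Proof. intros H. exact H. Qed.

Theorem provable_of_models :
  (forall A : model, @Wo_omega_tower A 3 -> @Isct_soundness A) ->
  provable RCA0 (sentence (f_imp (WO_omega_tower 3) ISCT_soundness)).
Proof.
  intros H. apply completeness; [apply RCA0_sub_closed|].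
  intros A HA e E. exact (sat_statement (Model A (E 0) HA) e E (H (Model A (E 0) HA))).
Qed.

(** * Sums, bounded comprehension, dependent choice, inductive predicates *)

Section Tools.
Context {A : model}.
Notation env := (nat -> dom A).
Notation "0" := (@zero A).
Notation "1" := (@one A).
Infix "+" := (@add A).
Infix "*" := (@mul A).
Infix "<" := (@lt A).

Lemma sum_ext l (f g : A -> A) : comp1 f -> comp1 g -> (forall i, i < l -> f i = g i) ->
  sum l f = sum l g.
Proof.
  intros Hf Hg H. assert (Q : forall k, k < l + 1 -> sum k f = sum k g); [|apply Q; mlia].
  ind1; [sigma| |].
  - intros _. now rewrite !sum_0.
  - intros k IH L. rewrite !sum_succ, IH, H by (assumption || mlia). reflexivity.
Qed.

Lemma sum_le l (f g : A -> A) : comp1 f -> comp1 g -> (forall i, i < l -> le (f i) (g i)) ->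
  le (sum l f) (sum l g).
Proof.
  intros Hf Hg H. assert (Q : forall k, k < l + 1 -> le (sum k f) (sum k g)); [|apply Q; mlia].
  unfold le in *. ind1; [sigma| |].
  - intros _. rewrite !sum_0 by assumption. mlia.
  - intros k IH L. rewrite !sum_succ by assumption. specialize (H k). specialize (IH ltac:(mlia)).
    specialize (H ltac:(mlia)). mlia.
Qed.

(** The effect of changing a single term, written without subtraction. *)
Lemma sum_update l x (f g : A -> A) : comp1 f -> comp1 g ->
  (forall i, i < l -> i <> x -> f i = g i) -> x < l -> sum l f + g x = sum l g + f x.
Proof.
  intros Hf Hg H Hx.
  assert (Q : forall k, k < l + 1 -> (x < k -> sum k f + g x = sum k g + f x) /\ (~ x < k -> sum k f = sum k g));
    [|apply Q; mlia].
  ind1; [sigma| |].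
  - intros _. rewrite !sum_0 by assumption. split; [intros; mlia|reflexivity].
  - intros k IH L. rewrite !sum_succ by assumption. destruct (IH ltac:(mlia)) as [I1 I2]. split.
    + intros Hk. destruct (classic (x = k)) as [<-|N].
      * rewrite I2 by mlia. mlia.
      * assert (Lx : x < k) by (apply lt_succ in Hk as [|]; tauto).
        specialize (I1 Lx). rewrite (H k) by (mlia || auto). mlia.
    + intros Hk. rewrite I2, (H k) by (try intros ->; mlia). reflexivity.
Qed.

Lemma sum_append l k (f : A -> A) : comp1 f -> sum (l + k) f = sum l f + sum k (fun i => f (l + i)).
Proof.
  intros Hf. assert (Hf' : comp1 (fun i => f (l + i))) by (unfold comp1; comp).
  revert k. ind1; [sigma| |].
  - now rewrite add_0_r, sum_0, add_0_r.
  - intros k IH. rewrite add_succ_r, !sum_succ, IH by assumption. mlia.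
Qed.

Lemma comp1_const (c : A) : comp1 (fun _ => c).
Proof. unfold comp1; comp. Qed.

Lemma sum_const l c : sum l (fun _ => c) = l * c.
Proof.
  pose proof (comp1_const c). revert l. ind1; [sigma| |].
  - rewrite sum_0 by assumption. mlia.
  - intros k IH. rewrite sum_succ, IH by assumption. mlia.
Qed.

Lemma sum_mono l l' (f : A -> A) : comp1 f -> le l l' -> le (sum l f) (sum l' f).
Proof.
  intros Hf H. unfold le in H. apply lt_iff in H as [d Hd]. assert (l' = l + d) as -> by mlia.
  rewrite sum_append by assumption. mlia.
Qed.

Lemma sigma1_witness (P : A -> Prop) : sigma1 P ->
  exists W : A -> A -> Prop, delta2 W /\ forall x, P x <-> exists w, W x w.
Proof.
  intros (R & HR & H). exists (fun x w => R (scons w (fun _ => x))). split.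
  - apply def0_delta. eapply def0_ext.
    + apply (def0_ren R (fun i => match i with 0 => 1 | _ => 0 end)%nat HR).
    + intros e. cbv beta. match goal with |- R ?a <-> R ?b => replace b with a; [tauto|] end.
      extensionality i. now destruct i.
  - intros x. exact (H (fun _ => x)).
Qed.

Lemma sigma2_witness (P : A -> A -> Prop) : sigma2 P ->
  exists W : A -> A -> A -> Prop, delta3 W /\ forall x y, P x y <-> exists w, W x y w.
Proof.
  intros (R & HR & H). exists (fun x y w => R (scons w (scons x (fun _ => y)))). split.
  - apply def0_delta. eapply def0_ext.
    + apply (def0_ren R (fun i => match i with 0 => 2 | 1 => 0 | _ => 1 end)%nat HR).
    + intros e. cbv beta. match goal with |- R ?a <-> R ?b => replace b with a; [tauto|] end.
      extensionality i. now destruct i as [|[|i]].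
  - intros x y. exact (H (scons x (fun _ => y))).
Qed.

(** Let [g w] be the number of elements below [b] having a witness below [w]:
    for a [w] maximizing [g w], the elements are those with a witness below [w]. *)
Lemma bounded_comprehension (P : A -> Prop) b : sigma1 P ->
  exists c, Is_finset c /\ forall x, Fin_in x c <-> x < b /\ P x.
Proof.
  intros HP. destruct (sigma1_witness P HP) as (W & HW & H).
  pose (c w x := ite (exists y, y < w /\ W x y) 1 0).
  assert (Hc2 : comp2 c) by (unfold comp2, c; comp).
  pose (g w := sum b (c w)).
  assert (Hg : comp1 g).
  { unfold comp1, g. apply (comp_sum (fun _ => b) (fun e x => c (e 0%nat) x)); comp. }
  assert (Hc : forall w, comp1 (c w)) by (intros w; unfold comp1; comp).
  assert (c0 : forall w x, (exists y, y < w /\ W x y) -> c w x = 1) by (intros; unfold c; now rewrite ite_true).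
  assert (c1 : forall w x, ~ (exists y, y < w /\ W x y) -> c w x = 0) by (intros; unfold c; now rewrite ite_false).
  assert (Bg : forall w, le (g w) b).
  { intros w. enough (le (g w) (sum b (fun _ => 1))) by (rewrite sum_const in *; mlia).
    apply sum_le; [auto|apply comp1_const|]. intros x _.
    destruct (classic (exists y, y < w /\ W x y)) as [Q|Q]; [rewrite c0|rewrite c1]; auto; mlia. }
  (* A maximal value of [g]: if every attained value could be exceeded, Sigma01 induction would
     produce a value above the bound [b]. *)
  assert (Hj : exists j, (exists w, j < g w + 1) /\ ~ exists w, j + 1 < g w + 1).
  { apply NNPP. intros N. assert (Q : forall j, exists w, j < g w + 1).
    { ind1; [sigma|exists 0; mlia|]. intros j IH. apply NNPP. intros N'. apply N. eauto. }
    destruct (Q (b + 1)) as [w Hw]. specialize (Bg w). mlia. }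
  destruct Hj as (j & (w & Hw) & Hmax).
  destruct (mkset_spec b (fun x => exists y, y < w /\ W x y)) as [S1 S2]; [unfold delta1; delta|].
  exists (mkset b (fun x => exists y, y < w /\ W x y)). split; [exact S1|]. intros x. rewrite S2.
  split; intros [Hx Q]; (split; [exact Hx|]).
  - destruct Q as (y & _ & Hy). apply H. eauto.
  - apply NNPP. intros N. apply H in Q as [y Hy]. apply Hmax. exists (w + y + 1).
    (* Here [x] has the witness [y] but none below [w]. Without [x], the count for [w + y + 1] is
       still at least [g w]; with [x] it exceeds the maximum. *)
    pose (c' := fun i => ite (i = x) 0 (c (w + y + 1) i)).
    assert (Hc' : comp1 c') by (unfold comp1, c'; comp).
    assert (L : le (g w) (sum b c')).
    { apply sum_le; auto. intros i _. unfold c'. destruct (classic (i = x)) as [->|Ni].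
      - rewrite ite_true, c1 by auto. mlia.
      - rewrite ite_false by auto. destruct (classic (exists y, y < w /\ W i y)) as [(z & L & Hz)|Q].
        + rewrite !c0; [mlia| |]; exists z; split; auto; mlia.
        + rewrite c1 by auto. mlia. }
    pose proof (sum_update b x c' (c (w + y + 1)) Hc' (Hc _)) as U.
    assert (Ex : c' x = 0) by (unfold c'; now rewrite ite_true). rewrite Ex in U.
    rewrite (c0 (w + y + 1)) in U by (exists y; split; [mlia|auto]).
    fold (g (w + y + 1)) in U. enough (E : sum b c' + 1 = g (w + y + 1) + 0) by (clear U; mlia).
    apply U; [|exact Hx]. intros i _ Ni. unfold c'. now rewrite ite_false.
Qed.

Lemma graph_set (g : A -> A) : comp1 g -> exists F, forall i x, mem (pr i x) F <-> x = g i.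
Proof.
  intros Hg. assert (Q : delta1 (fun z => exists i, i < z + 1 /\ z = pr i (g i))) by (unfold delta1; delta).
  destruct (comprehension (fun z => exists i, i < z + 1 /\ z = pr i (g i))) as [F HF]; [apply Q|apply Q|].
  exists F. intros i x. rewrite HF. split.
  - intros (j & _ & E). apply pr_inj in E as [-> ->]. reflexivity.
  - intros ->. exists i. split; [apply pr_le_l|reflexivity].
Qed.

(** The relation is first made single-valued: [N] takes the successor from the least code of a pair
    of a successor and a witness. Finite traces of [N] then agree wherever both are defined, so [f]
    has a Sigma01 graph and is computable. *)
Lemma dependent_choice (Good : A -> Prop) (Rel : A -> A -> Prop) x0 :
  sigma1 Good -> sigma2 Rel -> Good x0 -> (forall x, Good x -> exists y, Good y /\ Rel x y) ->
  exists f, comp1 f /\ f 0 = x0 /\ forall i, Good (f i) /\ Rel (f i) (f (i + 1)).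
Proof.
  intros HG HR H0 Hstep.
  destruct (sigma2_witness (fun x y => Good y /\ Rel x y)) as (W & HW & HE).
  { unfold sigma2. sigma. }
  pose (C x u := exists y, y < u + 1 /\ exists w, w < u + 1 /\ (u = pr y w /\ W x y w)).
  assert (HC : delta2 C) by (unfold delta2, C; delta).
  pose (N x y := exists w, W x y w /\ forall u, u < pr y w -> ~ C x u).
  assert (HN : sigma2 N) by (unfold sigma2, N; sigma).
  assert (CI : forall x y w, W x y w -> C x (pr y w)).
  { intros x y w Hw. exists y. split; [apply pr_le_l|]. exists w. split; [apply pr_le_r|auto]. }
  assert (Nex : forall x, Good x -> exists y, N x y).
  { intros x Hx. destruct (Hstep x Hx) as [y Hy]. apply HE in Hy as [w Hw].
    destruct (least (C x)) as (u & (y' & _ & w' & _ & -> & Hw') & Hu).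
    - unfold delta1. delta.
    - exists (pr y w). auto.
    - exists y', w'. auto. }
  assert (Nfun : forall x y y', N x y -> N x y' -> y = y').
  { intros x y y' (w & Hw & L) (w' & Hw' & L').
    destruct (lt_total (pr y w) (pr y' w')) as [Q|[Q|Q]].
    - exfalso. exact (L' _ Q (CI _ _ _ Hw)).
    - now apply pr_inj in Q.
    - exfalso. exact (L _ Q (CI _ _ _ Hw')). }
  assert (Ngood : forall x y, N x y -> Good y /\ Rel x y).
  { intros x y (w & Hw & _). apply HE. eauto. }
  pose (T n s := Is_seq s (n + 1) /\ el s 0 = x0 /\ forall i, i < n -> N (el s i) (el s (i + 1))).
  assert (HT : sigma2 T) by (unfold sigma2, T; sigma).
  assert (Tgood : forall n s, T n s -> forall i, i < n + 1 -> Good (el s i)).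
  { intros n s (_ & T0 & TS). ind1; [sigma| |].
    - intros _. now rewrite T0.
    - intros i _ L. apply (Ngood (el s i)). apply TS. mlia. }
  assert (Tex : forall n, exists s, T n s).
  { ind1; [sigma| |].
    - exists (mkseq (0 + 1) (fun _ => x0)). pose proof (comp1_const x0) as Q.
      split; [now apply mkseq_seq|]. split; [apply el_mkseq; [exact Q|mlia]|]. intros i Hi; mlia.
    - intros n (s & Ts). destruct (Nex (el s n)) as [y Hy]; [apply (Tgood n s Ts); mlia|].
      destruct Ts as (T1 & T2 & T3).
      pose (F := fun i => ite (i < n + 1) (el s i) y).
      assert (Q : comp1 F) by (unfold comp1, F; comp).
      exists (mkseq (n + 1 + 1) F). split; [now apply mkseq_seq|]. split.
      + rewrite el_mkseq by (exact Q || mlia). unfold F. now rewrite ite_true by mlia.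
      + intros i Hi. rewrite !el_mkseq by (exact Q || mlia). unfold F.
        destruct (classic (i < n)) as [L|L].
        * rewrite !ite_true by mlia. auto.
        * assert (i = n) as -> by mlia. rewrite ite_true, ite_false by mlia. exact Hy. }
  assert (Tagree : forall n n' s s', T n s -> T n' s' -> forall i, i < n + 1 -> i < n' + 1 -> el s i = el s' i).
  { intros n n' s s' (_ & T2 & T3) (_ & T2' & T3'). ind1; [sigma| |].
    - intros _ _. now rewrite T2, T2'.
    - intros i IH L L'. apply (Nfun (el s i)); [apply T3; mlia|].
      rewrite IH by mlia. apply T3'. mlia. }
  pose (f n := epsilon (inhabits 0) (fun x => exists s, T n s /\ x = el s n)).
  assert (Hf : forall n, exists s, T n s /\ f n = el s n).
  { intros n. apply (epsilon_spec (inhabits 0) (fun x => exists s, T n s /\ x = el s n)).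
    destruct (Tex n) as [s Hs]. eauto. }
  assert (Ef : forall n s, T n s -> f n = el s n).
  { intros n s Hs. destruct (Hf n) as (s' & Hs' & ->). apply (Tagree n n); auto; mlia. }
  exists f. split; [|split].
  - apply (sigma_ext (fun e => exists s, T (e 1%nat) s /\ e 0%nat = el s (e 1%nat))); [sigma|].
    intros e. split; [intros ->; apply Hf|]. intros (s & Hs & ->). symmetry. now apply Ef.
  - destruct (Hf 0) as (s & Hs & ->). apply Hs.
  - intros i. destruct (Hf (i + 1)) as (s & Hs & ->). destruct (Hf i) as (s' & Hs' & ->).
    rewrite (Tagree i (i + 1) s' s Hs' Hs) by mlia. split; [apply (Tgood (i + 1) s Hs); mlia|].
    apply Ngood. apply Hs. mlia.
Qed.

Lemma generated_elim (rule : (A -> Prop) -> A -> Prop) x :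
  (forall M M' y, (forall z : A, M z -> M' z) -> rule M y -> rule M' y) ->
  Generated rule x -> rule (Generated rule) x.
Proof.
  intros Hmono (d & Hx & Hd). apply (Hmono (fun z => Fin_in z d)); [|auto].
  intros z Hz. now exists d.
Qed.

(** Each premise has its own derivation. Collection bounds these codes by some [w], and since being
    a derivation is only Sigma01, bounded comprehension is needed to gather the derivations below
    [w] into one set [c]. *)
Lemma generated_intro (rule : (A -> Prop) -> A -> Prop) (P : A -> Prop) b x :
  (forall M M' y, (forall z : A, M z -> M' z) -> rule M y -> rule M' y) ->
  sigma2 (fun d y => rule (fun z => Fin_in z d) y) ->
  delta1 P -> (forall z, P z -> z < b /\ Generated rule z) -> rule P x -> Generated rule x.
Proof.
  intros Hmono Hrule HP H Hx.
  assert (Hcl : sigma1 (fun d => forall y, y < d -> Fin_in y d -> rule (fun z => Fin_in z d) y)).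
  { unfold sigma1. apply (sigma_ball (fun e => e 0%nat) (fun e y => Fin_in y (e 0%nat) -> rule (fun z => Fin_in z (e 0%nat)) y)); [comp|].
    apply sigma_imp; [delta|]. exact (sigma_ren _ (fun i => match i with 0 => 1 | _ => 0 end)%nat Hrule). }
  destruct (collection (fun z d => P z -> Fin_in z d /\ forall y, y < d -> Fin_in y d -> rule (fun z => Fin_in z d) y) b) as [w Hw].
  - unfold sigma2. apply sigma_imp; [delta|]. apply sigma_and; [sigma|].
    exact (sigma_ren _ (fun i => 1%nat) Hcl).
  - intros z _. destruct (classic (P z)) as [Q|Q]; [|exists 0; tauto].
    destruct (H z Q) as (_ & d & Hz & Hd). exists d. auto.
  - destruct (bounded_comprehension _ w Hcl) as (c & _ & Hc).
    (* The union of all derivations below [w], together with [x], is again a derivation because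
       rules are monotone. *)
    pose (D := mkset (w + x + 1) (fun y => y = x \/ exists d, d < c /\ (Fin_in d c /\ Fin_in y d))).
    assert (HD : forall y, Fin_in y D <-> y < w + x + 1 /\ (y = x \/ exists d, d < c /\ (Fin_in d c /\ Fin_in y d))).
    { intros y. refine (proj2 (mkset_spec _ _ _) y). unfold delta1. delta. }
    assert (Sub : forall d, Fin_in d c -> forall y, Fin_in y d -> Fin_in y D).
    { intros d Hd y Hy. apply HD. split.
      - apply Fin_in_lt in Hy. apply Hc in Hd. mlia.
      - right. exists d. split; [now apply Fin_in_lt|auto]. }
    exists D. split; [apply HD; split; [mlia|auto]|]. intros y Hy. destruct (proj1 (HD y) Hy) as [_ [E|(d & _ & Hd & Hy')]]; [subst y|].
    + apply (Hmono P); [|exact Hx]. intros z Hz. destruct (H z Hz) as [Lz _].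
      destruct (Hw z Lz) as (d & Ld & Q). destruct (Q Hz) as [Q1 Q2].
      apply (Sub d); [apply Hc; auto|exact Q1].
    + apply (Hmono (fun z => Fin_in z d)); [now apply Sub|].
      apply Hc in Hd as [_ Hd]. apply Hd; [now apply Fin_in_lt|exact Hy'].
Qed.

Lemma sigma_fin_ball (f : env -> A) (P : env -> A -> Prop) :
  comp f -> sigma (fun e => P (fun i => e (S i)) (e 0%nat)) ->
  sigma (fun e => forall x, Fin_in x (f e) -> P e x).
Proof.
  intros Hf HP. apply (sigma_ext (fun e => forall x, x < f e -> Fin_in x (f e) -> P e x)).
  - apply (sigma_ball f (fun e x => Fin_in x (f e) -> P e x) Hf). apply sigma_imp; [|exact HP].
    apply (delta_app2 Fin_in); [defn|comp|]. exact (comp_ren _ S Hf).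
  - intros e. split; [auto|]. intros Q x Hx. apply Q; [now apply Fin_in_lt|exact Hx].
Qed.

Lemma delta_fin_ball (f : env -> A) (P : env -> A -> Prop) :
  comp f -> delta (fun e => P (fun i => e (S i)) (e 0%nat)) ->
  delta (fun e => forall x, Fin_in x (f e) -> P e x).
Proof.
  intros Hf HP. apply (delta_ext (fun e => forall x, x < f e -> Fin_in x (f e) -> P e x)).
  - apply (delta_ball f (fun e x => Fin_in x (f e) -> P e x) Hf). apply delta_imp; [|exact HP].
    apply (delta_app2 Fin_in); [defn|comp|]. exact (comp_ren _ S Hf).
  - intros e. split; [auto|]. intros Q x Hx. apply Q; [now apply Fin_in_lt|exact Hx].
Qed.

End Tools.

Ltac sigma_extra ::=
  lazymatch goal with
  | |- sigma (fun e => forall x, Fin_in x (@?f e) -> @?P e x) => apply (sigma_fin_ball f P); [comp|sigma]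
  end.
Ltac delta_extra ::=
  lazymatch goal with
  | |- delta (fun e => forall x, Fin_in x (@?f e) -> @?P e x) => apply (delta_fin_ball f P); [comp|delta]
  end.

Set Bullet Behavior "Strict Subproofs".

(** * Ordinal notations *)

Section Ordinals.
Context {A : model}.
Notation env := (nat -> dom A).
Notation "0" := (@zero A).
Notation "1" := (@one A).
Infix "+" := (@add A).
Infix "*" := (@mul A).
Infix "<" := (@lt A).

Lemma Ord_lt_rule_mono (M M' : A -> Prop) y :
  (forall z, M z -> M' z) -> Ord_lt_rule M y -> Ord_lt_rule M' y.
Proof.
  intros HM (a & b & n & m & E & Ha & Hb & H). exists a, b, n, m.
  split; [exact E|]. split; [exact Ha|]. split; [exact Hb|].
  destruct H as [H|(i & H1 & H2 & H3 & x & z & H4 & H5 & H6)]; [now left|right].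
  exists i. repeat (split; [assumption|]). exists x, z. auto.
Qed.

Lemma Ord_lt_rule_sigma : sigma2 (fun d y : A => Ord_lt_rule (fun z => Fin_in z d) y).
Proof. unfold sigma2, Ord_lt_rule. sigma. Qed.

Lemma sigma2_Ord_lt : sigma2 (@Ord_lt A).
Proof. unfold sigma2, Ord_lt, Generated, Ord_lt_rule. sigma. Qed.

Lemma Nth_same a b n m j : Is_seq a n -> Is_seq b m -> j < n -> j < m -> el a j = el b j ->
  exists x, Nth a j x /\ Nth b j x.
Proof.
  intros Ha Hb Hn Hm E. exists (el a j). split; [now apply (el_Nth a n)|].
  rewrite E. now apply (el_Nth b m).
Qed.

Lemma Ord_lt_prefix a b n m : Is_seq a n -> Is_seq b m -> n < m ->
  (forall j, j < n -> el a j = el b j) -> Ord_lt a b.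
Proof.
  intros Ha Hb L H. apply (generated_intro _ (fun _ => False) 0).
  - apply Ord_lt_rule_mono.
  - apply Ord_lt_rule_sigma.
  - apply delta_false.
  - tauto.
  - exists a, b, n, m. split; [reflexivity|]. split; [exact Ha|]. split; [exact Hb|]. left.
    split; [exact L|]. intros j Hj. apply (Nth_same a b n m); auto. mlia.
Qed.

Lemma Ord_lt_diff a b n m i : Is_seq a n -> Is_seq b m -> i < n -> i < m ->
  (forall j, j < i -> el a j = el b j) -> Ord_lt (el a i) (el b i) -> Ord_lt a b.
Proof.
  intros Ha Hb Ln Lm H Hi.
  apply (generated_intro _ (fun z => z = pr (el a i) (el b i)) (pr (el a i) (el b i) + 1)).
  - apply Ord_lt_rule_mono.
  - apply Ord_lt_rule_sigma.
  - unfold delta1. delta.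
  - intros z ->. split; [mlia|exact Hi].
  - exists a, b, n, m. split; [reflexivity|]. split; [exact Ha|]. split; [exact Hb|]. right.
    exists i. split; [exact Ln|]. split; [exact Lm|]. split.
    + intros j Hj. apply (Nth_same a b n m); auto; mlia.
    + exists (el a i), (el b i). split; [now apply (el_Nth a n)|]. split; [now apply (el_Nth b m)|reflexivity].
Qed.

Lemma Is_ord_rule_mono (M M' : A -> Prop) y :
  (forall z, M z -> M' z) -> Is_ord_rule M y -> Is_ord_rule M' y.
Proof.
  intros HM (n & Hn & H1 & H2). exists n. split; [exact Hn|]. split; [|exact H2].
  intros i Hi. destruct (H1 i Hi) as (x & Hx & Mx). eauto.
Qed.

Lemma Is_ord_rule_sigma : sigma2 (fun d y : A => Is_ord_rule (fun z => Fin_in z d) y).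
Proof.
  pose proof sigma2_Ord_lt. unfold sigma2, Is_ord_rule.
  apply (sigma_ext (fun e => exists n, Is_seq (e 1%nat) n /\
    (forall i, i < n -> exists x, Nth (e 1%nat) i x /\ Fin_in x (e 0%nat)) /\
    (forall i, i < n -> forall x, x < e 1%nat -> forall y, y < e 1%nat -> i + 1 < n ->
       Nth (e 1%nat) i x -> Nth (e 1%nat) (i + 1) y -> y = x \/ Ord_lt y x))); [sigma|].
  intros e. split; intros (n & H1 & H2 & H3); exists n; (split; [exact H1|]; split; [exact H2|]).
  - intros i _ x _ y _. apply H3.
  - intros i x y L Hx Hy. apply (H3 i); auto; try mlia; eapply Nth_lt; eauto.
Qed.

Lemma Is_ord_intro a n : Is_seq a n -> (forall i, i < n -> Is_ord (el a i)) ->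
  (forall i, i + 1 < n -> el a (i + 1) = el a i \/ Ord_lt (el a (i + 1)) (el a i)) -> Is_ord a.
Proof.
  intros Ha H1 H2. apply (generated_intro _ (fun z => exists i, i < n /\ z = el a i) a).
  - apply Is_ord_rule_mono.
  - apply Is_ord_rule_sigma.
  - unfold delta1. delta.
  - intros z (i & Hi & ->). split; [now apply (el_lt a n)|exact (H1 i Hi)].
  - exists n. split; [exact Ha|]. split.
    + intros i Hi. exists (el a i). split; [now apply (el_Nth a n)|eauto].
    + intros i x y L Hx Hy. apply (Nth_el a n) in Hx; [|exact Ha|mlia].
      apply (Nth_el a n) in Hy; [|exact Ha|mlia]. subst. auto.
Qed.

(** The sequence [x 0, ..., x 0, x 1, ..., x 1, ...], with [c r] copies of [x r]
    for [r < l]: the notation of [sum ω^(x r) * (c r)]. *)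
Definition expand (l : A) (x c : A -> A) : A :=
  mkseq (sum l c) (fun p => x (bmu l (fun r => p < sum (r + 1) c))).

Lemma comp_expand f (x c : env -> A -> A) : comp f ->
  comp (fun e => x (fun i => e (S i)) (e 0%nat)) -> comp (fun e => c (fun i => e (S i)) (e 0%nat)) ->
  comp (fun e => expand (f e) (x e) (c e)).
Proof.
  intros Hf Hx Hc.
  apply (comp_mkseq (fun e => sum (f e) (c e)) (fun e p => x e (bmu (f e) (fun r => p < sum (r + 1) (c e))))).
  - now apply comp_sum.
  - apply (comp_subst (fun e y => x (fun i => e (S i)) y)
      (fun e => bmu (f (fun i => e (S i))) (fun r => e 0%nat < sum (r + 1) (c (fun i => e (S i)))))).
    + apply (comp_bmu (fun e => f (fun i => e (S i)))
        (fun e r => e 0%nat < sum (r + 1) (c (fun i => e (S i))))); [exact (comp_ren _ S Hf)|].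
      apply (delta_app2 (@lt A)); [defn|comp|].
      apply (comp_sum (fun e => e 0%nat + 1) (fun e r => c (fun i => e (S (S i))) r)); [comp|].
      exact (comp_ren _ (fun i => match i with 0 => 0 | S j => S (S (S j)) end)%nat Hc).
    + exact (comp_ren _ (fun i => match i with 0 => 0 | S j => S (S j) end)%nat Hx).
Qed.

Lemma expand_comp1 (l : A) (x c : A -> A) (Hx : comp1 x) (Hc : comp1 c) : comp1 (fun p => x (bmu l (fun r => p < sum (r + 1) c))).
Proof.
  apply (comp_app1 x); [exact Hx|].
  apply (comp_bmu (fun _ => l) (fun e r => e 0%nat < sum (r + 1) c)); comp || delta.
Qed.

Lemma expand_seq (l : A) (x c : A -> A) (Hx : comp1 x) (Hc : comp1 c) : Is_seq (expand l x c) (sum l c).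
Proof. now apply mkseq_seq, expand_comp1. Qed.

Lemma el_expand (l : A) (x c : A -> A) (Hx : comp1 x) (Hc : comp1 c) r p : r < l -> le (sum r c) p -> p < sum (r + 1) c -> el (expand l x c) p = x r.
Proof.
  intros Hr H1 H2. unfold expand.
  assert (Hp : p < sum l c) by (pose proof (sum_mono (r + 1) l c Hc ltac:(mlia)); mlia).
  rewrite el_mkseq by (now apply expand_comp1 || exact Hp). f_equal.
  destruct (bmu_spec l (fun r => p < sum (r + 1) c) r) as [Q1 Q2]; [unfold delta1; delta|exact H2|exact Hr|].
  revert Q1 Q2. generalize (bmu l (fun r => p < sum (r + 1) c)). intros r' Q1 Q2.
  destruct (classic (r' < r)) as [L|L]; [|mlia].
  pose proof (sum_mono (r' + 1) r c Hc ltac:(mlia)). mlia.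
Qed.

Lemma run_of (l : A) (c : A -> A) (Hc : comp1 c) p : p < sum l c -> exists r, r < l /\ le (sum r c) p /\ p < sum (r + 1) c.
Proof.
  intros Hp. destruct (least (fun r => p < sum (r + 1) c)) as (r & H1 & H2).
  - unfold delta1. delta.
  - destruct (zero_or_succ l) as [->|[k ->]]; [|eauto]. rewrite sum_0 in Hp by exact Hc. mlia.
  - exists r. assert (L : le (sum r c) p).
    { destruct (zero_or_succ r) as [->|[k ->]].
      - rewrite sum_0 by exact Hc. mlia.
      - specialize (H2 k ltac:(mlia)). mlia. }
    split; [|auto]. destruct (classic (r < l)) as [|N]; [assumption|].
    pose proof (sum_mono l r c Hc ltac:(mlia)). mlia.
Qed.

Lemma expand_is_ord (l : A) (x c : A -> A) (Hx : comp1 x) (Hc : comp1 c) :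
  (forall r, r < l -> Is_ord (x r) /\ 0 < c r) ->
  (forall r, r + 1 < l -> Ord_lt (x (r + 1)) (x r)) -> Is_ord (expand l x c).
Proof.
  intros H1 H2. apply (Is_ord_intro _ (sum l c) (expand_seq l x c Hx Hc)).
  - intros p Hp. destruct (run_of l c Hc p Hp) as (r & Lr & L1 & L2).
    rewrite (el_expand l x c Hx Hc r p) by assumption. now apply H1.
  - intros p Hp. destruct (run_of l c Hc p ltac:(mlia)) as (r & Lr & L1 & L2).
    rewrite (el_expand l x c Hx Hc r p) by assumption.
    destruct (classic (p + 1 < sum (r + 1) c)) as [L|L].
    + left. apply el_expand; [assumption|assumption|assumption|mlia|assumption].
    + right. assert (E : p + 1 = sum (r + 1) c) by mlia.
      assert (Lr' : r + 1 < l).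
      { destruct (classic (r + 1 < l)) as [|N]; [assumption|]. assert (l = r + 1) as -> by mlia. mlia. }
      rewrite (el_expand l x c Hx Hc (r + 1) (p + 1)); [now apply H2|assumption|mlia|].
      rewrite sum_succ by exact Hc. destruct (H1 (r + 1) Lr') as [_ P]. mlia.
Qed.

Lemma expand_lt_prefix l x c l' x' c' : comp1 x -> comp1 c -> comp1 x' -> comp1 c' ->
  l < l' -> (forall r, r < l -> x r = x' r /\ c r = c' r) -> 0 < c' l ->
  Ord_lt (expand l x c) (expand l' x' c').
Proof.
  intros Hx Hc Hx' Hc' L H Hl.
  assert (S : forall r, r < l + 1 -> sum r c = sum r c').
  { intros r Hr. apply sum_ext; auto. intros i Hi. apply H. mlia. }
  apply (Ord_lt_prefix _ _ (sum l c) (sum l' c')); try now apply expand_seq.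
  - pose proof (sum_mono (l + 1) l' c' Hc' ltac:(mlia)) as Q. rewrite sum_succ in Q by exact Hc'.
    rewrite S by mlia. mlia.
  - intros p Hp. destruct (run_of l c Hc p Hp) as (r & Lr & L1 & L2).
    rewrite (el_expand l x c Hx Hc r p) by assumption.
    rewrite (el_expand l' x' c' Hx' Hc' r p); [now apply H|mlia| |]; rewrite <- S by mlia; assumption.
Qed.

(** The sequences agree to the end of run [q] of the first one. There the second still has the
    exponent [x' q], while the first either stops or goes on with a smaller exponent. So lowering
    one coefficient pays for arbitrary later terms. *)
Lemma expand_lt_run l x c l' x' c' q : comp1 x -> comp1 c -> comp1 x' -> comp1 c' ->
  q < l -> q < l' -> (forall r, r < q -> x r = x' r /\ c r = c' r) -> x q = x' q -> c q < c' q ->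
  (q + 1 < l -> 0 < c (q + 1) /\ Ord_lt (x (q + 1)) (x' q)) ->
  Ord_lt (expand l x c) (expand l' x' c').
Proof.
  intros Hx Hc Hx' Hc' L L' H Eq Lc Hn.
  assert (S : forall r, r < q + 1 -> sum r c = sum r c').
  { intros r Hr. apply sum_ext; auto. intros i Hi. apply H. mlia. }
  assert (Sq : sum (q + 1) c < sum (q + 1) c').
  { rewrite !sum_succ, S by (assumption || mlia). mlia. }
  assert (Same : forall p, p < sum (q + 1) c -> el (expand l x c) p = el (expand l' x' c') p).
  { intros p Hp. destruct (run_of (q + 1) c Hc p Hp) as (r & Lr & L1 & L2).
    rewrite (el_expand l x c Hx Hc r p) by (assumption || mlia).
    destruct (classic (r = q)) as [->|N].
    - rewrite (el_expand l' x' c' Hx' Hc' q p); [exact Eq|exact L'| |mlia]. rewrite <- S by mlia. exact L1.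
    - assert (Lr' : r < q) by (apply lt_succ in Lr as [|]; tauto).
      rewrite (el_expand l' x' c' Hx' Hc' r p); [now apply H|mlia| |]; rewrite <- S by mlia; assumption. }
  assert (Len' : sum (q + 1) c < sum l' c').
  { pose proof (sum_mono (q + 1) l' c' Hc' ltac:(mlia)). mlia. }
  assert (E' : el (expand l' x' c') (sum (q + 1) c) = x' q).
  { apply el_expand; auto. rewrite <- S by mlia. pose proof (sum_mono q (q + 1) c Hc ltac:(mlia)). mlia. }
  destruct (classic (q + 1 < l)) as [Lq|Lq].
  - destruct (Hn Lq) as [P O].
    assert (Sl : sum (q + 1) c < sum (q + 1 + 1) c) by (rewrite (sum_succ (q + 1)) by exact Hc; mlia).
    apply (Ord_lt_diff _ _ (sum l c) (sum l' c') (sum (q + 1) c)); try now apply expand_seq.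
    + pose proof (sum_mono (q + 1 + 1) l c Hc ltac:(mlia)). mlia.
    + exact Len'.
    + exact Same.
    + rewrite E', (el_expand l x c Hx Hc (q + 1)); auto. mlia.
  - assert (l = q + 1) as -> by mlia.
    apply (Ord_lt_prefix _ _ (sum (q + 1) c) (sum l' c')); try now apply expand_seq.
    + exact Len'.
    + exact Same.
Qed.

Lemma comp2_sub : comp2 (@sub A).
Proof.
  apply (sigma_ext (fun e => e 1%nat = e 2%nat + e 0%nat \/ (e 1%nat < e 2%nat /\ e 0%nat = 0))); [sigma|].
  intros e. split.
  - intros ->. apply sub_spec.
  - destruct (sub_spec (e 1%nat) (e 2%nat)); intros [|]; mlia.
Qed.

Lemma sub_le a b : le b a -> sub a b + b = a.
Proof. intros H. destruct (sub_spec a b); mlia. Qed.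

(** * Natural numbers and ordinals below ω^ω *)

Definition nil : A := mkseq 0 (fun _ => 0).
(** The notation of the natural number [e], as a sum of [e] copies of ω^0; [e] may be
    nonstandard. *)
Definition zeros (e : A) : A := mkseq e (fun _ => nil).

Lemma nil_seq : Is_seq nil 0.
Proof. apply mkseq_seq, comp1_const. Qed.
Lemma zeros_seq e : Is_seq (zeros e) e.
Proof. apply mkseq_seq, comp1_const. Qed.
Lemma el_zeros e i : i < e -> el (zeros e) i = nil.
Proof. intros H. apply (el_mkseq e (fun _ => nil)); [apply comp1_const|exact H]. Qed.
Lemma comp1_zeros : comp1 zeros.
Proof. unfold comp1, zeros. comp. Qed.

Lemma zeros_lt e e' : e < e' -> Ord_lt (zeros e) (zeros e').
Proof.
  intros H. apply (Ord_lt_prefix _ _ e e'); try apply zeros_seq; auto.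
  intros j Hj. rewrite !el_zeros; mlia.
Qed.

Lemma nil_is_ord : Is_ord nil.
Proof. apply (Is_ord_intro _ 0 nil_seq); intros; mlia. Qed.

Lemma zeros_is_ord e : Is_ord (zeros e).
Proof.
  apply (Is_ord_intro _ e (zeros_seq e)).
  - intros i Hi. rewrite el_zeros by exact Hi. apply nil_is_ord.
  - intros i Hi. left. rewrite !el_zeros by mlia. reflexivity.
Qed.

(** The notation of [sum_(r <= K) ω^(K - r) * (m r + 1)]; adding 1 to the
    coefficients avoids empty runs. *)
Definition alpha (K m : A) : A :=
  expand (K + 1) (fun r => zeros (sub K r)) (fun r => el m r + 1).

Lemma alpha_comp K : comp1 (fun r => zeros (sub K r)).
Proof. pose proof comp2_sub. pose proof comp1_zeros. unfold comp1. comp. Qed.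
Lemma alpha_comp' m : comp1 (fun r => el m r + 1).
Proof. unfold comp1. comp. Qed.

Lemma comp2_alpha : comp2 alpha.
Proof.
  pose proof comp2_sub. pose proof comp1_zeros.
  apply (comp_expand (fun e => e 0%nat + 1) (fun e r => zeros (sub (e 0%nat) r)) (fun e r => el (e 1%nat) r + 1)); comp.
Qed.

Lemma alpha_is_ord K m : Is_ord (alpha K m).
Proof.
  unfold alpha. apply (expand_is_ord _ _ _ (alpha_comp K) (alpha_comp' m)).
  - intros r _. split; [apply zeros_is_ord|mlia].
  - intros r Hr. apply zeros_lt. pose proof (sub_le K r ltac:(mlia)).
    pose proof (sub_le K (r + 1) ltac:(mlia)). mlia.
Qed.

Definition Lex_lt (K m m' : A) : Prop :=
  exists r, r < K + 1 /\ (forall i, i < r -> el m i = el m' i) /\ el m r < el m' r.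

Lemma delta3_Lex_lt : delta3 Lex_lt.
Proof. unfold delta3, Lex_lt. delta. Qed.

Lemma alpha_lt K m m' : Lex_lt K m m' -> Ord_lt (alpha K m) (alpha K m').
Proof.
  intros (r & Lr & H & L). unfold alpha.
  apply (expand_lt_run _ _ _ _ _ _ r (alpha_comp K) (alpha_comp' m) (alpha_comp K) (alpha_comp' m')); auto.
  - intros i Hi. rewrite H by exact Hi. auto.
  - mlia.
  - intros L'. split; [mlia|]. apply zeros_lt. pose proof (sub_le K r ltac:(mlia)).
    pose proof (sub_le K (r + 1) ltac:(mlia)). mlia.
Qed.

Lemma lt_omega_exp s n a b : Is_seq s n -> Is_omega_exp a b -> (0 < n -> Ord_lt (el s 0) a) -> Ord_lt s b.
Proof.
  intros Hs [Hb Ha] H. assert (L : 0 < 1) by mlia.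
  apply (Nth_el b 1 0 a Hb L) in Ha. subst a.
  destruct (classic (0 < n)) as [P|P].
  - apply (Ord_lt_diff _ _ n 1 0); auto. intros j Hj. mlia.
  - apply (Ord_lt_prefix _ _ n 1); auto; [mlia|]. intros j Hj. mlia.
Qed.

(** A notation is below ω^a once its leading exponent is below a. Descending through leading
    exponents, it remains to see that α is below ω^ω, the number [K] below ω, and finally [nil]
    below 1. *)
Lemma expand_lt_omega_3 K l mm c a : comp1 mm -> comp1 c -> 0 < l -> 0 < c 0 ->
  Is_omega_tower 3 a -> Ord_lt (expand l (fun i => alpha K (mm i)) c) a.
Proof.
  intros Hm Hc Hl Hc0 (b & (b' & (b'' & (z & Hz & E0) & E1) & E2) & E3).
  assert (Ha : comp1 (fun i => alpha K (mm i))) by (pose proof comp2_alpha; unfold comp1; comp).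
  apply (lt_omega_exp _ (sum l c) b); [now apply expand_seq|exact E3|]. intros _.
  assert (P : forall c : A -> A, comp1 c -> sum (0 + 1) c = c 0).
  { intros c' Hc'. rewrite sum_succ, sum_0 by exact Hc'. mlia. }
  rewrite (el_expand l _ c Ha Hc 0 0); [|exact Hl|rewrite sum_0 by exact Hc; mlia|rewrite P by exact Hc; exact Hc0].
  apply (lt_omega_exp _ _ b' b (expand_seq _ _ _ (alpha_comp K) (alpha_comp' _)) E2). intros _.
  unfold alpha. rewrite (el_expand _ _ _ (alpha_comp K) (alpha_comp' (mm 0)) 0 0);
    [|mlia|rewrite sum_0 by apply alpha_comp'; mlia|rewrite P by apply alpha_comp'; mlia].
  apply (lt_omega_exp _ _ b'' b' (zeros_seq _) E1). intros L.
  rewrite el_zeros by exact L.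
  apply (lt_omega_exp _ _ z b'' nil_seq E0). intros L'. mlia.
Qed.

End Ordinals.

#[export] Hint Resolve sigma2_Ord_lt comp2_sub comp1_zeros comp2_alpha delta3_Lex_lt : defn.

(** * Reductions and values *)

Lemma and_imp (P P' Q Q' : Prop) : (P -> P') -> (Q -> Q') -> P /\ Q -> P' /\ Q'.
Proof. tauto. Qed.
Lemma or_imp (P P' Q Q' : Prop) : (P -> P') -> (Q -> Q') -> P \/ Q -> P' \/ Q'.
Proof. tauto. Qed.

Ltac mono HM :=
  lazymatch goal with
  | |- ?P -> ?P => exact (fun h => h)
  | |- _ /\ _ -> _ /\ _ => apply and_imp; mono HM
  | |- _ \/ _ -> _ \/ _ => apply or_imp; mono HM
  | |- ex _ -> ex _ => let x := fresh in let H := fresh in intros [x H]; exists x; revert H; mono HM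
  | |- (forall x : _, _) -> (forall x : _, _) =>
      let H := fresh in let x := fresh in intros H x; generalize (H x); mono HM
  | |- _ -> _ => apply HM
  end.

Ltac ind_strong :=
  match goal with |- forall x, @?P x => refine (sigma_strong_ind P _ _); cbv beta end.

Section Reductions.
Context {A : model}.
Notation env := (nat -> dom A).
Notation "0" := (@zero A).
Notation "1" := (@one A).
Infix "+" := (@add A).
Infix "*" := (@mul A).
Infix "<" := (@lt A).

Definition monotone (rule : (A -> Prop) -> A -> Prop) : Prop :=
  forall M M' y, (forall z, M z -> M' z) -> rule M y -> rule M' y.

Lemma Is_arith_rule_mono P n : monotone (Is_arith_rule P n).
Proof. intros M M' y HM. unfold Is_arith_rule. mono HM. Qed.
Lemma Is_expr_rule_mono P n : monotone (Is_expr_rule P n).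
Proof. intros M M' y HM. unfold Is_expr_rule. mono HM. Qed.
Lemma Bool_val_rule_mono u : monotone (Bool_val_rule u).
Proof. intros M M' y HM. unfold Bool_val_rule. mono HM. Qed.
Lemma Subst_rule_mono u : monotone (Subst_rule u).
Proof. intros M M' y HM. unfold Subst_rule, Pointwise. mono HM. Qed.
Lemma Step_rule_mono I P : monotone (Step_rule I P).
Proof. intros M M' y HM. unfold Step_rule. mono HM. Qed.

Lemma comp1_E_var : comp1 (@E_var A). Proof. unfold comp1, E_var; comp. Qed.
Lemma comp1_E_succ : comp1 (@E_succ A). Proof. unfold comp1, E_succ; comp. Qed.
Lemma comp1_E_pred : comp1 (@E_pred A). Proof. unfold comp1, E_pred; comp. Qed.
Lemma comp2_E_call : comp2 (@E_call A). Proof. unfold comp2, E_call; comp. Qed.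
Lemma comp2_E_op : comp2 (@E_op A). Proof. unfold comp2, E_op; comp. Qed.
Lemma comp3_E_if : comp3 (@E_if A). Proof. unfold comp3, E_if; comp. Qed.
Lemma comp1_B_eq0 : comp1 (@B_eq0 A). Proof. unfold comp1, B_eq0; comp. Qed.
Lemma comp1_B_eq1 : comp1 (@B_eq1 A). Proof. unfold comp1, B_eq1; comp. Qed.
Lemma comp2_B_lt : comp2 (@B_lt A). Proof. unfold comp2, B_lt; comp. Qed.
Lemma comp2_B_le : comp2 (@B_le A). Proof. unfold comp2, B_le; comp. Qed.
Lemma comp2_B_and : comp2 (@B_and A). Proof. unfold comp2, B_and; comp. Qed.
Lemma comp2_B_or : comp2 (@B_or A). Proof. unfold comp2, B_or; comp. Qed.
Lemma comp1_B_not : comp1 (@B_not A). Proof. unfold comp1, B_not; comp. Qed.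
Lemma comp1_T_num : comp1 (@T_num A). Proof. unfold comp1, T_num; comp. Qed.
Lemma comp2_T_call : comp2 (@T_call A). Proof. unfold comp2, T_call; comp. Qed.
Lemma comp2_T_op : comp2 (@T_op A). Proof. unfold comp2, T_op; comp. Qed.
Lemma delta4_Equation : delta4 (@Equation A). Proof. unfold delta4, Equation; delta. Qed.

End Reductions.

#[export] Hint Resolve comp1_E_var comp1_E_succ comp1_E_pred comp2_E_call comp2_E_op comp3_E_if
  comp1_B_eq0 comp1_B_eq1 comp2_B_lt comp2_B_le comp2_B_and comp2_B_or comp1_B_not
  comp1_T_num comp2_T_call comp2_T_op delta4_Equation : defn.

Section Reductions.
Context {A : model}.
Notation env := (nat -> dom A).
Notation "0" := (@zero A).
Notation "1" := (@one A).
Infix "+" := (@add A).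
Infix "*" := (@mul A).
Infix "<" := (@lt A).

(** * The predicates on programs and terms are Sigma01 *)

Lemma sigma2_Is_bool : sigma2 (@Is_bool A).
Proof. unfold sigma2, Is_bool, Generated, Is_bool_rule. sigma. Qed.
Lemma sigma3_Is_arith : sigma3 (@Is_arith A).
Proof. unfold sigma3, Is_arith, Generated, Is_arith_rule. sigma. Qed.
Lemma sigma3_Is_expr : sigma3 (@Is_expr A).
Proof.
  pose proof sigma2_Is_bool. pose proof sigma3_Is_arith.
  unfold sigma3, Is_expr, Generated, Is_expr_rule. sigma.
Qed.
Lemma Bool_val_rule_sigma u : sigma2 (fun d y : A => Bool_val_rule u (fun z => Fin_in z d) y).
Proof. unfold sigma2, Bool_val_rule, Truth_value. sigma. Qed.
Lemma sigma3_Bool_val : sigma3 (@Bool_val A).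
Proof. unfold sigma3, Bool_val, Generated, Bool_val_rule, Truth_value. sigma. Qed.
Lemma Subst_rule_sigma u : sigma2 (fun d y : A => Subst_rule u (fun z => Fin_in z d) y).
Proof. pose proof sigma3_Bool_val. unfold sigma2, Subst_rule, Pointwise. sigma. Qed.
Lemma sigma3_Subst : sigma3 (@Subst A).
Proof. pose proof sigma3_Bool_val. unfold sigma3, Subst, Generated, Subst_rule, Pointwise. sigma. Qed.
Lemma Step_rule_sigma I P : sigma2 (fun d y : A => Step_rule I P (fun z => Fin_in z d) y).
Proof.
  pose proof sigma3_Subst. unfold sigma2, Step_rule, Numerals, Pointwise, Op_value. sigma.
Qed.
Lemma sigma3_Step I : sigma3 (@Step A I).
Proof.
  pose proof sigma3_Subst. unfold sigma3, Step, Generated, Step_rule, Numerals, Pointwise, Op_value. sigma.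
Qed.
Lemma sigma3_Reduces I : sigma3 (@Reduces A I).
Proof. pose proof (sigma3_Step I). unfold sigma3, Reduces. sigma. Qed.
Lemma sigma3_Child : sigma3 (@Child A).
Proof. unfold sigma3, Child. sigma. Qed.
Lemma sigma3_Subexpr_at : sigma3 (@Subexpr_at A).
Proof. pose proof sigma3_Child. unfold sigma3, Subexpr_at. sigma. Qed.
Lemma sigma4_Call : sigma4 (@Call A).
Proof. pose proof sigma3_Subexpr_at. unfold sigma4, Call. sigma. Qed.

End Reductions.

#[export] Hint Resolve sigma2_Is_bool sigma3_Is_arith sigma3_Is_expr sigma3_Bool_val sigma3_Subst
  sigma3_Step sigma3_Reduces sigma3_Child sigma3_Subexpr_at sigma4_Call : defn.

Section Reductions.
Context {A : model}.
Notation env := (nat -> dom A).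
Notation "0" := (@zero A).
Notation "1" := (@one A).
Infix "+" := (@add A).
Infix "*" := (@mul A).
Infix "<" := (@lt A).

Lemma num_succ k : @num A (S k) = num k + 1.
Proof. destruct k; simpl; [mlia|reflexivity]. Qed.

Lemma num_lt j k : Nat.lt j k -> @num A j < num k.
Proof. induction 1; rewrite num_succ; mlia. Qed.

Lemma num_inj j k : @num A j = num k -> j = k.
Proof.
  intros H. destruct (Nat.lt_trichotomy j k) as [L|[L|L]]; [|exact L|]; apply num_lt in L; mlia.
Qed.

Lemma num_pos k : 0 < @num A (S k).
Proof. rewrite num_succ. mlia. Qed.

Definition fst (z : A) : A := bmu (z + 1) (fun a => exists b, b < z + 1 /\ z = pr a b).
Definition snd (z : A) : A := bmu (z + 1) (fun b => exists a, a < z + 1 /\ z = pr a b).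

Lemma comp1_fst : comp1 fst. Proof. unfold comp1, fst. comp. Qed.
Lemma comp1_snd : comp1 snd. Proof. unfold comp1, snd. comp. Qed.

Lemma fst_pr a b : fst (pr a b) = a.
Proof.
  destruct (bmu_spec (pr a b + 1) (fun a' => exists b', b' < pr a b + 1 /\ pr a b = pr a' b') a) as [(b' & _ & E) _].
  - unfold delta1. delta.
  - exists b. split; [apply pr_le_r|reflexivity].
  - apply pr_le_l.
  - apply pr_inj in E as [E _]. symmetry. exact E.
Qed.

Lemma snd_pr a b : snd (pr a b) = b.
Proof.
  destruct (bmu_spec (pr a b + 1) (fun b' => exists a', a' < pr a b + 1 /\ pr a b = pr a' b') b) as [(a' & _ & E) _].
  - unfold delta1. delta.
  - exists a. split; [apply pr_le_l|reflexivity].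
  - apply pr_le_r.
  - apply pr_inj in E as [_ E]. symmetry. exact E.
Qed.

(** Collection bounds, for all [i] at once, the codes of pairs of an element and a witness; below
    this bound the least such code can be computed. *)
Lemma seq_choice (R : A -> A -> Prop) k : sigma2 R -> (forall i, i < k -> exists x, R i x) ->
  exists s, Is_seq s k /\ forall i, i < k -> R i (el s i).
Proof.
  intros HR H. destruct (sigma2_witness R HR) as (W & HW & HE). pose proof comp1_fst.
  pose (C i u := exists x, x < u + 1 /\ exists w, w < u + 1 /\ (u = pr x w /\ W i x w)).
  assert (HC : delta2 C) by (unfold delta2, C; delta).
  destruct (collection C k) as [B HB].
  - exact (delta_sigma _ HC).
  - intros i Hi. destruct (H i Hi) as [x Hx]. apply HE in Hx as [w Hw]. exists (pr x w), x.
    split; [apply pr_le_l|]. exists w. split; [apply pr_le_r|auto].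
  - assert (Q : comp1 (fun i => fst (bmu B (C i)))) by (unfold comp1; comp).
    exists (mkseq k (fun i => fst (bmu B (C i)))). split; [now apply mkseq_seq|].
    intros i Hi. rewrite el_mkseq by assumption. destruct (HB i Hi) as (u & Lu & Hu).
    destruct (bmu_spec B (C i) u) as [(x & _ & w & _ & E & Hw) _]; [unfold delta1; delta|exact Hu|exact Lu|].
    rewrite E, fst_pr. apply HE. eauto.
Qed.

Lemma Bool_val_intro (u b v : A) (P : A -> Prop) B : delta1 P ->
  (forall z, P z -> z < B /\ Generated (Bool_val_rule u) z) ->
  Bool_val_rule u P (pr b v) -> Bool_val u b v.
Proof. intros HP H1 H2. exact (generated_intro _ P B _ (Bool_val_rule_mono u) (Bool_val_rule_sigma u) HP H1 H2). Qed.

Lemma truth_value_ex (p : Prop) : exists v : A, (v = 0 \/ v = 1) /\ Truth_value v p.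
Proof. destruct (classic p) as [H|H]; [exists 1|exists 0]; unfold Truth_value; auto. Qed.

Lemma pr_tag_lt k (x y : A) : le x y -> x < pr (@num A (S k)) y.
Proof. intros H. pose proof (pr_lt_r (num (S k)) y (num_pos k)). mlia. Qed.

Definition pair_pred (z z' x : A) : Prop := x = z \/ x = z'.

(** Strong induction on the codes in a fixed derivation [d], as premises have smaller codes. The
    decidable hypothesis [Fin_in y d] takes the place of [Is_bool n y], which as a premise would
    spoil the Sigma01 form of the induction statement. *)
Lemma bool_value (n u b : A) : Is_seq u n -> Is_bool n b -> exists v : A, (v = 0 \/ v = 1) /\ Bool_val u b v.
Proof.
  intros Hu (d & Hb & Hd).
  assert (Q : forall y, Fin_in y d -> exists v, (v = 0 \/ v = 1) /\ Bool_val u y v); [|auto].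
  ind_strong; [unfold sigma1; sigma|]. intros y IH Hy.
  assert (Hat : forall v, (v = 0 \/ v = 1) -> Bool_val_rule u (fun _ => False) (pr y v) -> exists v, (v = 0 \/ v = 1) /\ Bool_val u y v).
  { intros v Hv R. exists v. split; [exact Hv|]. apply (Bool_val_intro u y v (fun _ => False) 0); [apply delta_false|tauto|exact R]. }
  assert (Hpair : forall c c' v v' w, Bool_val u c v -> Bool_val u c' v' -> (w = 0 \/ w = 1) ->
    Bool_val_rule u (pair_pred (pr c v) (pr c' v')) (pr y w) -> exists v, (v = 0 \/ v = 1) /\ Bool_val u y v).
  { intros c c' v v' w H1 H2 Hw R. exists w. split; [exact Hw|].
    apply (Bool_val_intro u y w (pair_pred (pr c v) (pr c' v')) (pr c v + pr c' v' + 1)).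
    - unfold delta1, pair_pred. delta.
    - intros z [->| ->]; (split; [mlia|assumption]).
    - exact R. }
  destruct (Hd y Hy) as [(i & Hi & E)|[(i & j & Hi & Hj & E)|[(c & c' & E & Hc & Hc')|(c & E & Hc)]]].
  - destruct E as [-> | ->].
    + destruct (truth_value_ex (el u i = 0)) as (v & Hv & T). apply (Hat v Hv).
      exists (B_eq0 i), v. split; [reflexivity|]. left. exists i, (el u i). split; [reflexivity|].
      split; [now apply (el_Nth u n)|exact T].
    + destruct (truth_value_ex (el u i = 1)) as (v & Hv & T). apply (Hat v Hv).
      exists (B_eq1 i), v. split; [reflexivity|]. right; left. exists i, (el u i). split; [reflexivity|].
      split; [now apply (el_Nth u n)|exact T].
  - destruct E as [-> | ->].
    + destruct (truth_value_ex (el u i < el u j)) as (v & Hv & T). apply (Hat v Hv).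
      exists (B_lt i j), v. split; [reflexivity|]. right; right; left. exists i, j, (el u i), (el u j).
      split; [reflexivity|]. split; [now apply (el_Nth u n)|]. split; [now apply (el_Nth u n)|exact T].
    + destruct (truth_value_ex (el u i < el u j \/ el u i = el u j)) as (v & Hv & T). apply (Hat v Hv).
      exists (B_le i j), v. split; [reflexivity|]. right; right; right; left. exists i, j, (el u i), (el u j).
      split; [reflexivity|]. split; [now apply (el_Nth u n)|]. split; [now apply (el_Nth u n)|exact T].
  - assert (Lc : c < y /\ c' < y).
    { pose proof (pr_le_l c c'). pose proof (pr_le_r c c').
      destruct E as [-> | ->]; split; apply pr_tag_lt; assumption. }
    destruct (IH c (proj1 Lc) Hc) as (v & Hv & V). destruct (IH c' (proj2 Lc) Hc') as (v' & Hv' & V').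
    destruct E as [-> | ->].
    + destruct (truth_value_ex (v = 1 /\ v' = 1)) as (w & Hw & T). apply (Hpair c c' v v' w V V' Hw).
      exists (B_and c c'), w. split; [reflexivity|]. do 4 right; left. exists c, c', v, v'.
      split; [reflexivity|]. split; [now left|]. split; [now right|exact T].
    + destruct (truth_value_ex (v = 1 \/ v' = 1)) as (w & Hw & T). apply (Hpair c c' v v' w V V' Hw).
      exists (B_or c c'), w. split; [reflexivity|]. do 5 right; left. exists c, c', v, v'.
      split; [reflexivity|]. split; [now left|]. split; [now right|exact T].
  - assert (Lc : c < y) by (subst y; apply pr_tag_lt; mlia).
    destruct (IH c Lc Hc) as (v & Hv & V). subst y.
    destruct (truth_value_ex (~ (v = 1))) as (w & Hw & T). apply (Hpair c c v v w V V Hw).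
    exists (B_not c), w. split; [reflexivity|]. do 6 right. exists c, v.
    split; [reflexivity|]. split; [now left|exact T].
Qed.

Lemma Subst_intro (u e t : A) (P : A -> Prop) B : delta1 P ->
  (forall z, P z -> z < B /\ Generated (Subst_rule u) z) ->
  Subst_rule u P (pr e t) -> Subst u e t.
Proof. intros HP H1 H2. exact (generated_intro _ P B _ (Subst_rule_mono u) (Subst_rule_sigma u) HP H1 H2). Qed.

Lemma Subst_atom (u e t : A) : Subst_rule u (fun _ => False) (pr e t) -> Subst u e t.
Proof. intros H. apply (Subst_intro u e t (fun _ => False) 0); [apply delta_false|tauto|exact H]. Qed.

Lemma Subst_var (u i x : A) : Nth u i x -> Subst u (E_var i) (T_num x).
Proof. intros H. apply Subst_atom. exists (E_var i), (T_num x). split; [reflexivity|]. left. eauto. Qed.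

Lemma Subst_succ (u i x : A) : Nth u i x -> Subst u (E_succ i) (T_num (x + 1)).
Proof. intros H. apply Subst_atom. exists (E_succ i), (T_num (x + 1)). split; [reflexivity|]. right; left. eauto. Qed.

Lemma Subst_pred (u i x : A) : Nth u i x -> exists y : A, Subst u (E_pred i) (T_num y).
Proof.
  intros H.
  assert (Q : exists y : A, x = y + 1 \/ (x = 0 /\ y = 0)).
  { destruct (zero_or_succ x) as [->|[k ->]]; eauto. }
  destruct Q as [y Hy]. exists y. apply Subst_atom. exists (E_pred i), (T_num y). split; [reflexivity|].
  right; right; left. exists i, x, y. auto.
Qed.

Lemma Subst_args_pred (u s s' k : A) : Is_seq s k -> Is_seq s' k ->
  (forall i, i < k -> Subst u (el s i) (el s' i)) ->
  exists (P : A -> Prop) B, delta1 P /\ (forall z, P z -> z < B /\ Generated (Subst_rule u) z) /\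
    Pointwise (fun x y => P (pr x y)) s s'.
Proof.
  intros Hs Hs' H. exists (fun z => exists i, i < k /\ z = pr (el s i) (el s' i)), (pr s s' + 1).
  split; [unfold delta1; delta|]. split.
  - intros z (i & Hi & ->). split; [|now apply H]. apply pr_mono.
    + pose proof (el_lt s k i Hs Hi). mlia.
    + pose proof (el_lt s' k i Hs' Hi). mlia.
  - exists k. split; [exact Hs|]. split; [exact Hs'|]. intros i Hi. exists (el s i), (el s' i).
    split; [now apply (el_Nth s k)|]. split; [now apply (el_Nth s' k)|eauto].
Qed.

Lemma Subst_call (u f s s' k : A) : Is_seq s k -> Is_seq s' k ->
  (forall i, i < k -> Subst u (el s i) (el s' i)) -> Subst u (E_call f s) (T_call f s').
Proof.
  intros Hs Hs' H. destruct (Subst_args_pred u s s' k Hs Hs' H) as (P & B & HP & H1 & H2).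
  apply (Subst_intro _ _ _ P B HP H1). exists (E_call f s), (T_call f s'). split; [reflexivity|].
  do 3 right; left. exists f, s, s'. auto.
Qed.

Lemma Subst_op (u f s s' k : A) : Is_seq s k -> Is_seq s' k ->
  (forall i, i < k -> Subst u (el s i) (el s' i)) -> Subst u (E_op f s) (T_op f s').
Proof.
  intros Hs Hs' H. destruct (Subst_args_pred u s s' k Hs Hs' H) as (P & B & HP & H1 & H2).
  apply (Subst_intro _ _ _ P B HP H1). exists (E_op f s), (T_op f s'). split; [reflexivity|].
  do 4 right; left. exists f, s, s'. auto.
Qed.

Lemma Subst_if (u b e0 e1 t : A) : (Bool_val u b 1 /\ Subst u e0 t) \/ (Bool_val u b 0 /\ Subst u e1 t) ->
  Subst u (E_if b e0 e1) t.
Proof.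
  intros H.
  destruct H as [[H1 H2]|[H1 H2]].
  - apply (Subst_intro _ _ _ (fun z => z = pr e0 t) (pr e0 t + 1)); [unfold delta1; delta| |].
    + intros z ->. split; [mlia|exact H2].
    + exists (E_if b e0 e1), t. split; [reflexivity|]. do 5 right. exists b, e0, e1. auto.
  - apply (Subst_intro _ _ _ (fun z => z = pr e1 t) (pr e1 t + 1)); [unfold delta1; delta| |].
    + intros z ->. split; [mlia|exact H2].
    + exists (E_if b e0 e1), t. split; [reflexivity|]. do 5 right. exists b, e0, e1. auto.
Qed.

(** * One-step reductions and reduction sequences *)

Lemma Step_intro I (P t t' : A) (Q : A -> Prop) B : delta1 Q ->
  (forall z, Q z -> z < B /\ Generated (Step_rule I P) z) ->
  Step_rule I P Q (pr t t') -> Step I P t t'.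
Proof. intros HP H1 H2. exact (generated_intro _ Q B _ (Step_rule_mono I P) (Step_rule_sigma I P) HP H1 H2). Qed.

Lemma Step_call I (P f s u n e t : A) : Equation P f n e -> Is_seq u n -> Numerals u s -> Subst u e t ->
  Step I P (T_call f s) t.
Proof.
  intros. apply (Step_intro I P _ _ (fun _ => False) 0); [apply delta_false|tauto|].
  exists (T_call f s), t. split; [reflexivity|]. left. exists f, s, u, n, e. auto.
Qed.

Lemma Step_op I (P o s u v : A) : Numerals u s -> Op_value I o u v -> Step I P (T_op o s) (T_num v).
Proof.
  intros. apply (Step_intro I P _ _ (fun _ => False) 0); [apply delta_false|tauto|].
  exists (T_op o s), (T_num v). split; [reflexivity|]. right; left. exists o, s, u, v. auto.
Qed.

Definition application (c : A -> A) : Prop :=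
  exists h, (forall s, c s = T_call h s) \/ (forall s, c s = T_op h s).

Lemma application_comp c : application c -> comp1 c.
Proof.
  intros (h & H). unfold comp1. destruct H as [H|H].
  - replace (fun e : env => c (e 0%nat)) with (fun e : env => T_call h (e 0%nat)) by (extensionality e; auto). comp.
  - replace (fun e : env => c (e 0%nat)) with (fun e : env => T_op h (e 0%nat)) by (extensionality e; auto). comp.
Qed.

Definition upd (s k i x : A) : A := mkseq k (fun j => ite (j = i) x (el s j)).

Lemma upd_comp1 (s i x : A) : comp1 (fun j => ite (j = i) x (el s j)).
Proof. unfold comp1. comp. Qed.

Lemma comp4_upd : comp4 upd.
Proof. unfold comp4, upd. comp. Qed.

Lemma upd_seq (s k i x : A) : Is_seq (upd s k i x) k.
Proof. apply mkseq_seq, upd_comp1. Qed.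

Lemma el_upd_same (s k i x : A) : i < k -> el (upd s k i x) i = x.
Proof. intros H. unfold upd. rewrite el_mkseq by (apply upd_comp1 || exact H). now rewrite ite_true. Qed.

Lemma el_upd_other (s k i j x : A) : j < k -> j <> i -> el (upd s k i x) j = el s j.
Proof. intros H N. unfold upd. rewrite el_mkseq by (apply upd_comp1 || exact H). now rewrite ite_false. Qed.

Lemma Step_arg I P (c : A -> A) (s k i x y : A) : application c -> i < k -> (forall j, j < i -> exists z, el s j = T_num z) ->
  Step I P x y -> Step I P (c (upd s k i x)) (c (upd s k i y)).
Proof.
  intros (h & Hc) Hi Hnum Hxy.
  apply (Step_intro I P _ _ (fun z => z = pr x y) (pr x y + 1)); [unfold delta1; delta| |].
  - intros z ->. split; [mlia|exact Hxy].
  - exists (c (upd s k i x)), (c (upd s k i y)). split; [reflexivity|]. right; right.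
    exists h, (upd s k i x), (upd s k i y), k, i.
    split; [destruct Hc as [Hc|Hc]; rewrite !Hc; auto|].
    split; [apply upd_seq|]. split; [apply upd_seq|]. split; [exact Hi|]. split; [|split].
    + intros j Hj. destruct (Hnum j Hj) as [z Hz]. exists z. apply (Nth_el _ k); [apply upd_seq|mlia|].
      rewrite el_upd_other; [now symmetry|mlia|intros ->; mlia].
    + exists x, y. split; [|split; [|reflexivity]]; apply (Nth_el _ k); try apply upd_seq; auto;
        symmetry; now apply el_upd_same.
    + intros j Hj N. exists (el s j). split; apply (Nth_el _ k); try apply upd_seq; auto;
        symmetry; now apply el_upd_other.
Qed.

Lemma Reduces_refl I (P t : A) : Reduces I P t t.
Proof.
  exists (mkseq (0 + 1) (fun _ => t)), 0.
  assert (S : Is_seq (mkseq (0 + 1) (fun _ => t)) (0 + 1)) by apply mkseq_seq, comp1_const.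
  assert (N : Nth (mkseq (0 + 1) (fun _ => t)) 0 t).
  { apply (Nth_el _ (0 + 1)); [exact S|mlia|]. symmetry. apply (el_mkseq (0 + 1) (fun _ => t)); [apply comp1_const|mlia]. }
  split; [exact S|]. split; [exact N|]. split; [exact N|]. intros i Hi. mlia.
Qed.

Lemma Reduces_snoc I (P t t' t'' : A) : Reduces I P t t' -> Step I P t' t'' -> Reduces I P t t''.
Proof.
  intros (s & n & Hs & H0 & Hn & Hst) H.
  pose (F := fun i => ite (i < n + 1) (el s i) t'').
  assert (HF : comp1 F) by (unfold comp1, F; comp).
  pose proof (mkseq_seq (n + 1 + 1) F HF) as S.
  assert (N : forall i x, i < n + 1 + 1 -> x = F i -> Nth (mkseq (n + 1 + 1) F) i x).
  { intros i x Hi ->. apply (Nth_el _ (n + 1 + 1)); auto. symmetry. now apply el_mkseq. }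
  assert (F1 : forall i, i < n + 1 -> F i = el s i) by (intros; unfold F; now rewrite ite_true).
  assert (F2 : F (n + 1) = t'') by (unfold F; rewrite ite_false; [reflexivity|mlia]).
  assert (E : forall i x, i < n + 1 -> Nth s i x -> x = F i).
  { intros i x Hi Hx. rewrite F1 by exact Hi. now apply (Nth_el s (n + 1)). }
  exists (mkseq (n + 1 + 1) F), (n + 1). split; [exact S|]. split; [|split].
  - apply N; [mlia|]. apply E; [mlia|exact H0].
  - apply N; [mlia|]. now symmetry.
  - intros i Hi. destruct (classic (i < n)) as [L|L].
    + destruct (Hst i L) as (x & y & Hx & Hy & Q). exists x, y.
      split; [apply N; [mlia|]; apply E; [mlia|exact Hx]|].
      split; [apply N; [mlia|]; apply E; [mlia|exact Hy]|exact Q].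
    + assert (i = n) as -> by mlia. exists t', t''.
      split; [apply N; [mlia|]; apply E; [mlia|exact Hn]|]. split; [apply N; [mlia|now symmetry]|exact H].
Qed.

Lemma Reduces_ind I (P t t' : A) (Q : A -> Prop) : sigma1 Q -> Q t ->
  (forall x y, Q x -> Step I P x y -> Q y) -> Reduces I P t t' -> Q t'.
Proof.
  intros HQ H0 HS (s & n & Hs & N0 & Nn & Hst).
  assert (K : forall i, i < n + 1 -> Q (el s i)).
  { ind1; [sigma| |].
    - intros _. apply (Nth_el s (n + 1)) in N0; [now rewrite <- N0|exact Hs|mlia].
    - intros i IH L. destruct (Hst i ltac:(mlia)) as (x & y & Hx & Hy & Sxy).
      apply (Nth_el s (n + 1)) in Hx; [|exact Hs|mlia]. apply (Nth_el s (n + 1)) in Hy; [|exact Hs|mlia].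
      subst. apply (HS (el s i)); [apply IH; mlia|exact Sxy]. }
  apply (Nth_el s (n + 1)) in Nn; [rewrite Nn; apply K; mlia|exact Hs|mlia].
Qed.

Lemma Reduces_trans I (P t t' t'' : A) : Reduces I P t t' -> Reduces I P t' t'' -> Reduces I P t t''.
Proof.
  intros H. apply Reduces_ind; [unfold sigma1; sigma|exact H|]. intros x y. apply Reduces_snoc.
Qed.

Lemma Reduces_step I (P t t' : A) : Step I P t t' -> Reduces I P t t'.
Proof. apply Reduces_snoc, Reduces_refl. Qed.

Lemma upd_self (s k i : A) : Is_seq s k -> upd s k i (el s i) = s.
Proof.
  intros Hs. apply (seq_ext _ _ k); [apply upd_seq|exact Hs|]. intros j Hj.
  destruct (classic (j = i)) as [->|N]; [now apply el_upd_same|now apply el_upd_other].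
Qed.

Lemma Reduces_arg I P (c : A -> A) (s k i x : A) : application c -> Is_seq s k -> i < k ->
  (forall j, j < i -> exists z, el s j = T_num z) ->
  Reduces I P (el s i) x -> Reduces I P (c s) (c (upd s k i x)).
Proof.
  intros Hc Hs Hi Hnum. pose proof comp4_upd. pose proof (application_comp c Hc).
  apply (Reduces_ind I P (el s i) x (fun x => Reduces I P (c s) (c (upd s k i x)))).
  - unfold sigma1. sigma.
  - rewrite upd_self by exact Hs. apply Reduces_refl.
  - intros y z Hy Hyz. apply (Reduces_snoc _ _ _ _ _ Hy). now apply Step_arg.
Qed.

Definition nums (v k : A) : A := mkseq k (fun i => T_num (el v i)).

Lemma nums_comp1 (v : A) : comp1 (fun i => T_num (el v i)).
Proof. unfold comp1. comp. Qed.

Lemma nums_numerals (v k : A) : Is_seq v k -> Numerals v (nums v k).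
Proof.
  intros Hv. assert (S : Is_seq (nums v k) k) by apply mkseq_seq, nums_comp1.
  exists k. split; [exact Hv|]. split; [exact S|]. intros i Hi. exists (el v i), (T_num (el v i)).
  split; [now apply (el_Nth v k)|]. split; [|reflexivity]. apply (Nth_el _ k); auto.
  symmetry. apply (el_mkseq k (fun i => T_num (el v i))); [apply nums_comp1|exact Hi].
Qed.

(** Arguments are evaluated from left to right, as the leftmost strategy requires: in [mix j] the
    first [j] of them have been replaced with numerals. *)
Lemma Reduces_args I P (c : A -> A) (s v k : A) : application c -> Is_seq s k ->
  (forall i, i < k -> Reduces I P (el s i) (T_num (el v i))) -> Reduces I P (c s) (c (nums v k)).
Proof.
  intros Hc Hs H. pose proof (application_comp c Hc).
  pose (F j i := ite (i < j) (T_num (el v i)) (el s i)).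
  assert (HF : comp2 F) by (unfold comp2, F; comp).
  assert (HF1 : forall j, comp1 (F j)) by (intros; unfold comp1; comp).
  pose (mix j := mkseq k (F j)).
  assert (Hmix : comp1 mix) by (unfold comp1, mix; comp).
  assert (Smix : forall j, Is_seq (mix j) k) by (intros; now apply mkseq_seq).
  assert (Emix : forall j i, i < k -> el (mix j) i = F j i) by (intros; now apply el_mkseq).
  assert (Q : forall j, j < k + 1 -> Reduces I P (c s) (c (mix j))).
  { ind1; [sigma| |].
    - intros _. replace (mix 0) with s; [apply Reduces_refl|].
      apply (seq_ext _ _ k); auto. intros i Hi. rewrite Emix by exact Hi. unfold F. rewrite ite_false; [reflexivity|mlia].
    - intros j IH L. apply (Reduces_trans _ _ _ _ _ (IH ltac:(mlia))).
      replace (mix (j + 1)) with (upd (mix j) k j (T_num (el v j))).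
      + apply Reduces_arg; auto; [mlia| |].
        * intros i Hi. rewrite Emix by mlia. unfold F. rewrite ite_true by exact Hi. eauto.
        * rewrite Emix by mlia. unfold F. rewrite ite_false by mlia. apply H. mlia.
      + apply (seq_ext _ _ k); auto; [apply upd_seq|]. intros i Hi. rewrite (Emix (j + 1)) by exact Hi.
        destruct (classic (i = j)) as [->|N].
        * rewrite el_upd_same by exact Hi. unfold F. rewrite ite_true; [reflexivity|mlia].
        * rewrite el_upd_other, Emix by assumption. unfold F.
          destruct (classic (i < j)) as [L'|L'].
          -- rewrite !ite_true; [reflexivity|mlia|exact L'].
          -- rewrite !ite_false; [reflexivity| |exact L']. intros L''. apply lt_succ in L'' as [|]; auto. }
  replace (nums v k) with (mix k); [apply Q; mlia|].
  apply (seq_ext _ _ k); auto; [apply mkseq_seq, nums_comp1|]. intros i Hi. rewrite Emix by exact Hi.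
  unfold F. rewrite ite_true by exact Hi. symmetry. apply (el_mkseq k (fun i => T_num (el v i))); [apply nums_comp1|exact Hi].
Qed.

End Reductions.

#[export] Hint Resolve comp1_fst comp1_snd comp4_upd : defn.

(** * Evaluation of a function body *)

Section Nodes.
Context {A : model}.
Notation env := (nat -> dom A).
Notation "0" := (@zero A).
Notation "1" := (@one A).
Infix "+" := (@add A).
Infix "*" := (@mul A).
Infix "<" := (@lt A).

Lemma Nth_unique (s l i x y : A) : Is_seq s l -> Nth s i x -> Nth s i y -> x = y.
Proof.
  intros Hs Hx Hy. pose proof (Nth_bound s l i x Hs Hx) as L.
  apply (Nth_el s l) in Hx, Hy; auto. congruence.
Qed.

Definition snoc (s l x : A) : A := mkseq (l + 1) (fun i => ite (i < l) (el s i) x).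

Lemma snoc_comp1 (s l x : A) : comp1 (fun i => ite (i < l) (el s i) x).
Proof. unfold comp1. comp. Qed.

Lemma snoc_seq (s l x : A) : Is_seq (snoc s l x) (l + 1).
Proof. apply mkseq_seq, snoc_comp1. Qed.

Lemma el_snoc_old (s l x i : A) : i < l -> el (snoc s l x) i = el s i.
Proof. intros H. unfold snoc. rewrite el_mkseq by (apply snoc_comp1 || mlia). now rewrite ite_true. Qed.

Lemma el_snoc_new (s l x : A) : el (snoc s l x) l = x.
Proof. unfold snoc. rewrite el_mkseq by (apply snoc_comp1 || mlia). rewrite ite_false; [reflexivity|mlia]. Qed.

Lemma Nth_snoc_old (s l x i y : A) : Is_seq s l -> Nth s i y -> Nth (snoc s l x) i y.
Proof.
  intros Hs Hy. pose proof (Nth_bound s l i y Hs Hy) as L. apply (Nth_el s l) in Hy; auto.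
  apply (Nth_el _ (l + 1)); [apply snoc_seq|mlia|]. now rewrite el_snoc_old.
Qed.

Lemma Nth_snoc_new (s l x : A) : Nth (snoc s l x) l x.
Proof. apply (Nth_el _ (l + 1)); [apply snoc_seq|mlia|]. now rewrite el_snoc_new. Qed.

Definition Node (P f z : A) : Prop :=
  exists n e tau, Equation P f n e /\ Subexpr_at e tau z.

Lemma sigma3_Node : sigma3 Node.
Proof. unfold sigma3, Node. sigma. Qed.

Lemma node_root (P f n e : A) : Equation P f n e -> Node P f e.
Proof.
  intros H. exists n, e, (mkseq 0 (fun _ => 0)). split; [exact H|].
  exists 0, (snoc (mkseq 0 (fun _ => 0)) 0 e).
  split; [apply mkseq_seq, comp1_const|]. split; [apply snoc_seq|].
  split; [apply Nth_snoc_new|]. split; [apply Nth_snoc_new|]. intros j Hj. mlia.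
Qed.

Lemma node_child (P f z i y : A) : Node P f z -> Child z i y -> Node P f y.
Proof.
  intros (n & e & tau & He & l & s & Htau & Hs & H0 & Hl & H) Hc.
  exists n, e, (snoc tau l i). split; [exact He|].
  exists (l + 1), (snoc s (l + 1) y). split; [apply snoc_seq|]. split; [apply snoc_seq|].
  split; [now apply Nth_snoc_old|]. split; [apply Nth_snoc_new|].
  intros j Hj. destruct (classic (j < l)) as [L|L].
  - destruct (H j L) as (x & i' & y' & Hx & Hi & Hy & C). exists x, i', y'.
    repeat split; try (now apply Nth_snoc_old); exact C.
  - assert (j = l) as -> by mlia. exists z, i, y. split; [now apply Nth_snoc_old|].
    split; [apply Nth_snoc_new|]. split; [apply Nth_snoc_new|exact Hc].
Qed.

(** The arguments of an application are arithmetic expressions, whereas the branches of a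
    conditional are arbitrary ones; the disjunction is a property inherited by all
    subexpressions. *)
Definition Wf (P n z : A) : Prop := Is_expr P n z \/ Is_arith P n z.

Lemma Wf_cases (P n z : A) : Wf P n z ->
  (exists i, i < n /\ (z = E_var i \/ z = E_succ i \/ z = E_pred i)) \/
  (exists f s k e, z = E_call f s /\ Equation P f k e /\ Is_seq s k /\
     forall i, i < k -> Is_arith P n (el s i)) \/
  (exists p s k, z = E_op (pr p k) s /\ Is_seq s k /\ forall i, i < k -> Is_arith P n (el s i)) \/
  (exists b e0 e1, z = E_if b e0 e1 /\ Is_bool n b /\ Is_expr P n e0 /\ Is_expr P n e1).
Proof.
  assert (Har : Is_arith P n z ->
    (exists i, i < n /\ (z = E_var i \/ z = E_succ i \/ z = E_pred i)) \/
    (exists f s k e, z = E_call f s /\ Equation P f k e /\ Is_seq s k /\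
       forall i, i < k -> Is_arith P n (el s i)) \/
    (exists p s k, z = E_op (pr p k) s /\ Is_seq s k /\ forall i, i < k -> Is_arith P n (el s i))).
  { intros H. apply (generated_elim _ _ (Is_arith_rule_mono P n)) in H.
    destruct H as [H|[(f & s & k & e & E & He & Hs & H)|(p & s & k & E & Hs & H)]].
    - now left.
    - right; left. exists f, s, k, e. split; [exact E|]. split; [exact He|]. split; [exact Hs|].
      intros i Hi. destruct (H i Hi) as (x & Hx & Ax). apply (Nth_el s k) in Hx; auto. now subst x.
    - right; right. exists p, s, k. split; [exact E|]. split; [exact Hs|].
      intros i Hi. destruct (H i Hi) as (x & Hx & Ax). apply (Nth_el s k) in Hx; auto. now subst x. }
  intros [H|H].
  - apply (generated_elim _ _ (Is_expr_rule_mono P n)) in H as [H|H].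
    + apply Har in H. tauto.
    + do 3 right. exact H.
  - apply Har in H. tauto.
Qed.

Ltac tag_clash E :=
  exfalso; apply pr_inj in E as [E _]; apply num_inj in E; discriminate E.

Lemma Child_call (g s i y : A) : Child (E_call g s) i y -> Nth s i y.
Proof.
  intros [(h & s' & [E|E] & H)|(b & e0 & e1 & E & _)]; try tag_clash E.
  apply pr_inj in E as [_ E]. apply pr_inj in E as [_ ->]. exact H.
Qed.

Lemma Child_op (o s i y : A) : Child (E_op o s) i y -> Nth s i y.
Proof.
  intros [(h & s' & [E|E] & H)|(b & e0 & e1 & E & _)]; try tag_clash E.
  apply pr_inj in E as [_ E]. apply pr_inj in E as [_ ->]. exact H.
Qed.

Lemma Child_if (b e0 e1 i y : A) : Child (E_if b e0 e1) i y -> y = e0 \/ y = e1.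
Proof.
  intros [(h & s' & [E|E] & H)|(b' & e0' & e1' & E & H)]; try tag_clash E.
  apply pr_inj in E as [_ E]. apply pr_inj in E as [_ E]. apply pr_inj in E as [-> ->]. tauto.
Qed.

Lemma Child_lt (z i y : A) : Child z i y -> y < z.
Proof.
  intros [(h & s & E & H)|(b & e0 & e1 & -> & H)].
  - apply Nth_lt in H as [_ H]. pose proof (pr_le_r h s).
    destruct E as [-> | ->]; apply pr_tag_lt; mlia.
  - pose proof (pr_le_l e0 e1). pose proof (pr_le_r e0 e1). pose proof (pr_le_r b (pr e0 e1)).
    apply pr_tag_lt. destruct H as [[_ ->]|[_ ->]]; mlia.
Qed.

Lemma Wf_child (P n z i y : A) : Wf P n z -> Child z i y -> Wf P n y.
Proof.
  intros H C. destruct (Wf_cases P n z H) as [(j & _ & E)|[(f & s & k & e & -> & _ & Hs & Ha)|[(p & s & k & -> & Hs & Ha)|(b & e0 & e1 & -> & _ & H0 & H1)]]].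
  - destruct C as [(h & s' & [->| ->] & _)|(b & e0 & e1 & -> & _)]; destruct E as [E|[E|E]]; tag_clash E.
  - apply Child_call in C. pose proof (Nth_bound s k i y Hs C) as L.
    apply (Nth_el s k) in C; auto. subst y. right. auto.
  - apply Child_op in C. pose proof (Nth_bound s k i y Hs C) as L.
    apply (Nth_el s k) in C; auto. subst y. right. auto.
  - apply Child_if in C as [->| ->]; now left.
Qed.

Lemma Equation_unique (P N f n e n' e' : A) : Is_seq P N -> Equation P f n e -> Equation P f n' e' ->
  n = n' /\ e = e'.
Proof. intros HP H H'. apply pr_inj. exact (Nth_unique P N f _ _ HP H H'). Qed.

(** Induction along the path from the body to [z], on which well-formedness is inherited and codes
    decrease. The bound makes the set of subexpressions finite and lets the counter stop at the
    body. *)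
Lemma node_wf (P N f n e z : A) : Is_seq P N -> Equation P f n e -> Is_expr P n e -> Node P f z ->
  Wf P n z /\ le z e.
Proof.
  intros HP He Hex (n' & e' & tau & He' & l & s & _ & Hs & H0 & Hl & H).
  destruct (Equation_unique P N f n e n' e' HP He He') as [<- <-].
  assert (Q : forall j, j < l + 1 -> Wf P n (el s j) /\ el s j < e + 1).
  { unfold Wf. ind1; [sigma| |].
    - intros L. apply (Nth_el s (l + 1)) in H0; auto. rewrite <- H0. split; [now left|mlia].
    - intros j IH L. destruct (IH ltac:(mlia)) as [W Lj]. destruct (H j ltac:(mlia)) as (x & i & y & Hx & _ & Hy & C).
      apply (Nth_el s (l + 1)) in Hx; [|exact Hs|mlia]. apply (Nth_el s (l + 1)) in Hy; [|exact Hs|exact L].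
      subst x y. split; [exact (Wf_child _ _ _ _ _ W C)|]. apply Child_lt in C. mlia. }
  apply (Nth_el s (l + 1)) in Hl; [|exact Hs|mlia]. subst z. apply Q. mlia.
Qed.

Definition Val (I : sets A) (P u z v : A) : Prop :=
  exists t, Subst u z t /\ Reduces I P t (T_num v).

Lemma sigma4_Val I : sigma4 (Val I).
Proof. unfold sigma4, Val. sigma. Qed.

(** The part of [Transition] that concerns the call expression [z] itself, regardless of its
    position in the body. *)
Definition Link (I : sets A) (P u z g v : A) : Prop :=
  exists s s', z = E_call g s /\ Subst u z (T_call g s') /\
    Pointwise (fun t x => Reduces I P t (T_num x)) s' v.

Lemma sigma4_Link I P : sigma4 (Link I P).
Proof. unfold sigma4, Link, Pointwise. sigma. Qed.

Lemma val_atom I (P n u z : A) : Is_seq u n ->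
  (exists i, i < n /\ (z = E_var i \/ z = E_succ i \/ z = E_pred i)) -> exists v, Val I P u z v.
Proof.
  intros Hu (i & Hi & E). pose proof (el_Nth u n i Hu Hi) as H. destruct E as [->|[->| ->]].
  - exists (el u i), (T_num (el u i)). split; [now apply Subst_var|apply Reduces_refl].
  - exists (el u i + 1), (T_num (el u i + 1)). split; [now apply Subst_succ|apply Reduces_refl].
  - destruct (Subst_pred u i _ H) as [y Hy]. exists y, (T_num y). split; [exact Hy|apply Reduces_refl].
Qed.

Lemma val_args I (P u s k : A) : Is_seq s k -> (forall i, i < k -> exists v, Val I P u (el s i) v) ->
  exists s' v, Is_seq s' k /\ Is_seq v k /\ forall i, i < k ->
    Subst u (el s i) (el s' i) /\ Reduces I P (el s' i) (T_num (el v i)).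
Proof.
  intros Hs H.
  destruct (seq_choice (fun i x => exists t v, x = pr t v /\ Subst u (el s i) t /\ Reduces I P t (T_num v)) k) as (q & Hq & Q).
  - unfold sigma2. sigma.
  - intros i Hi. destruct (H i Hi) as (v & t & H1 & H2). exists (pr t v), t, v. auto.
  - assert (C1 : comp1 (fun i => fst (el q i))) by (unfold comp1; comp).
    assert (C2 : comp1 (fun i => snd (el q i))) by (unfold comp1; comp).
    exists (mkseq k (fun i => fst (el q i))), (mkseq k (fun i => snd (el q i))).
    split; [now apply mkseq_seq|]. split; [now apply mkseq_seq|].
    intros i Hi. rewrite !el_mkseq by assumption. destruct (Q i Hi) as (t & v & -> & H1 & H2).
    rewrite fst_pr, snd_pr. auto.
Qed.

Lemma val_op I (P u p s k : A) : Is_interpretation I -> Is_seq s k ->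
  (forall i, i < k -> exists v, Val I P u (el s i) v) -> exists v, Val I P u (E_op (pr p k) s) v.
Proof.
  intros HI Hs H. destruct (val_args I P u s k Hs H) as (s' & v & Hs' & Hv & Q).
  destruct (HI p k v Hv) as (w & Hw & _). exists w, (T_op (pr p k) s'). split.
  - apply (Subst_op u _ s s' k Hs Hs'). intros i Hi. now apply Q.
  - apply (Reduces_trans _ _ _ (T_op (pr p k) (nums v k))).
    + apply (Reduces_args I P (T_op (pr p k)) s' v k); [exists (pr p k); auto|exact Hs'|].
      intros i Hi. now apply Q.
    + apply Reduces_step, (Step_op I P _ _ v); [now apply nums_numerals|exact Hw].
Qed.

(** Both branches are assumed to have values because the counter passes through all subexpressions,
    including those of the branch not taken. Calls made there are transitions too, since
    [Transition] does not look at conditions; so they are covered by safety. *)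
Lemma val_if I (P n u b e0 e1 : A) : Is_seq u n -> Is_bool n b ->
  (exists v, Val I P u e0 v) -> (exists v, Val I P u e1 v) -> exists v, Val I P u (E_if b e0 e1) v.
Proof.
  intros Hu Hb (v0 & t0 & S0 & R0) (v1 & t1 & S1 & R1).
  destruct (bool_value n u b Hu Hb) as (v & [->| ->] & B).
  - exists v1, t1. split; [apply Subst_if; auto|exact R1].
  - exists v0, t0. split; [apply Subst_if; auto|exact R0].
Qed.

Lemma link_exists I (P u g s k : A) : Is_seq s k ->
  (forall i, i < k -> exists v, Val I P u (el s i) v) ->
  exists v, Is_seq v k /\ Link I P u (E_call g s) g v.
Proof.
  intros Hs H. destruct (val_args I P u s k Hs H) as (s' & v & Hs' & Hv & Q).
  exists v. split; [exact Hv|]. exists s, s'. split; [reflexivity|]. split.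
  - apply (Subst_call u g s s' k Hs Hs'). intros i Hi. now apply Q.
  - exists k. split; [exact Hs'|]. split; [exact Hv|]. intros i Hi. exists (el s' i), (el v i).
    split; [now apply (el_Nth s' k)|]. split; [now apply (el_Nth v k)|now apply Q].
Qed.

Lemma val_call I (P u z g v n e w : A) : Link I P u z g v -> Equation P g n e -> Is_seq v n ->
  Val I P v e w -> Val I P u z w.
Proof.
  intros (s & s' & -> & S & k & Hs' & Hv & H) He Hv' (t & St & Rt).
  pose proof (len_unique v k n Hv Hv') as <-.
  exists (T_call g s'). split; [exact S|].
  apply (Reduces_trans _ _ _ (T_call g (nums v k))).
  - apply (Reduces_args I P (T_call g) s' v k); [exists g; auto|exact Hs'|].
    intros i Hi. destruct (H i Hi) as (x & y & Hx & Hy & R).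
    apply (Nth_el s' k) in Hx; auto. apply (Nth_el v k) in Hy; auto. now subst.
  - apply (Reduces_trans _ _ _ t); [|exact Rt].
    apply Reduces_step, (Step_call I P g _ v k e); auto. now apply nums_numerals.
Qed.

Lemma link_transition I (P f u z g v n e : A) : Equation P f n e -> Is_seq u n -> Node P f z ->
  (forall n' e', Equation P f n' e' -> n' = n /\ e' = e) ->
  Link I P u z g v -> exists tau, Call P f tau g /\ Transition I P f u tau g v.
Proof.
  intros He Hu (n' & e' & tau & He' & Ht) U (s & s' & -> & S & Hp).
  destruct (U _ _ He') as [-> ->]. exists tau. split.
  - exists n, e, s. auto.
  - exists n, e, s, s'. auto.
Qed.

End Nodes.

#[export] Hint Resolve sigma3_Node sigma4_Val sigma4_Link : defn.

(** * The abstract machine *)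

Section Machine.
Context {A : model}.
Notation env := (nat -> dom A).
Notation "0" := (@zero A).
Notation "1" := (@one A).
Infix "+" := (@add A).
Infix "*" := (@mul A).
Infix "<" := (@lt A).

(** A frame of the stack: the function [f], its arguments [u], the counter [n]
    running through the codes of the subexpressions of the body of [f], and
    the rank [m] of the history of calls. *)
Definition frame (f u n m : A) : A := pr (pr f u) (pr n m).
Definition ff (x : A) : A := fst (fst x).
Definition fu (x : A) : A := snd (fst x).
Definition fn (x : A) : A := fst (snd x).
Definition fm (x : A) : A := snd (snd x).

Lemma comp1_ff : comp1 ff. Proof. unfold comp1, ff. comp. Qed.
Lemma comp1_fu : comp1 fu. Proof. unfold comp1, fu. comp. Qed.
Lemma comp1_fn : comp1 fn. Proof. unfold comp1, fn. comp. Qed.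
Lemma comp1_fm : comp1 fm. Proof. unfold comp1, fm. comp. Qed.

Lemma ff_frame f u n m : ff (frame f u n m) = f.
Proof. unfold ff, frame. now rewrite !fst_pr. Qed.
Lemma fu_frame f u n m : fu (frame f u n m) = u.
Proof. unfold fu, frame. now rewrite fst_pr, snd_pr. Qed.
Lemma fn_frame f u n m : fn (frame f u n m) = n.
Proof. unfold fn, frame. now rewrite snd_pr, fst_pr. Qed.
Lemma fm_frame f u n m : fm (frame f u n m) = m.
Proof. unfold fm, frame. now rewrite !snd_pr. Qed.

(** Here [Q] will be the finite set of pairs of a function and a subexpression of its body.
    Membership in it is decidable, so the implication is Sigma01; with [Node] as the premise it
    would not evidently be. *)
Definition Done (I : sets A) (P Q f u n : A) : Prop :=
  forall z, z < n -> Fin_in (pr f z) Q -> exists v, Val I P u z v.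

(** The counter runs from 0 to [e + 1]: the body [e] is the last subexpression, and its value is
    known once the counter has passed it. *)
Definition Frame (P : A) (R : A -> A -> A -> Prop) (x e : A) : Prop :=
  exists n, Equation P (ff x) n e /\ Is_seq (fu x) n /\ fn x < e + (1 + 1) /\ R (ff x) (fu x) (fm x).

Definition Top (I : sets A) (P Q : A) R (x : A) : Prop :=
  exists e, Frame P R x e /\ Done I P Q (ff x) (fu x) (fn x).

(** A frame waiting for the value of the call [z], which the next frame [y] computes. Its counter is
    advanced already when the call is made, so that its cost falls at the push; only the
    subexpressions below [z] are known to have values. *)
Definition Mid (I : sets A) (P Q : A) R (K x y : A) : Prop :=
  exists e z, Frame P R x e /\ fn x = z + 1 /\ Done I P Q (ff x) (fu x) z /\
    Fin_in (pr (ff x) z) Q /\ Link I P (fu x) z (ff y) (fu y) /\ Lex_lt K (fm y) (fm x).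

Definition Good (I : sets A) (P Q : A) R (K u0 s : A) : Prop :=
  exists k, Is_seq s (k + 1) /\ Top I P Q R (el s k) /\
    (forall i, i < k -> Mid I P Q R K (el s i) (el s (i + 1))) /\
    ff (el s 0) = 0 /\ fu (el s 0) = u0.

(** The coefficient of the frame in the measure. It is positive even for a frame whose counter has
    reached [e + 1], because [expand] needs nonempty runs. *)
Definition cost (P x : A) : A := sub (snd (el P (ff x)) + (1 + 1)) (fn x).

Definition measure (P K s : A) : A :=
  expand (len s) (fun i => alpha K (fm (el s i))) (fun i => cost P (el s i)).

Lemma Good_sigma I P Q R (K u0 : A) : sigma3 R -> sigma1 (Good I P Q R K u0).
Proof.
  intros HR. pose proof comp1_ff. pose proof comp1_fu. pose proof comp1_fn. pose proof comp1_fm.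
  unfold sigma1, Good, Top, Mid, Frame, Done. sigma.
Qed.

Lemma comp2_cost : comp2 cost.
Proof. pose proof comp1_ff. pose proof comp1_fn. unfold comp2, cost. comp. Qed.

Lemma rank_comp1 (K s : A) : comp1 (fun i => alpha K (fm (el s i))).
Proof. pose proof comp1_fm. unfold comp1. comp. Qed.
Lemma cost_comp1 (P s : A) : comp1 (fun i => cost P (el s i)).
Proof. pose proof comp2_cost. unfold comp1. comp. Qed.

Lemma measure_comp1 P K : comp1 (measure P K).
Proof.
  pose proof comp1_fm. pose proof comp2_cost.
  apply (comp_expand (fun e => len (e 0%nat)) (fun e i => alpha K (fm (el (e 0%nat) i)))
    (fun e i => cost P (el (e 0%nat) i))); comp.
Qed.

Lemma cost_eq P N R x e : Is_seq P N -> Frame P R x e -> cost P x + fn x = e + (1 + 1).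
Proof.
  intros HP (n & He & _ & L & _). unfold cost.
  assert (E : el P (ff x) = pr n e).
  { symmetry. apply (Nth_el P N); [exact HP|exact (Nth_bound P N _ _ HP He)|exact He]. }
  rewrite E, snd_pr. apply sub_le. mlia.
Qed.

Lemma cost_pos P N R x e : Is_seq P N -> Frame P R x e -> 0 < cost P x.
Proof. intros HP H. pose proof (cost_eq P N R x e HP H). destruct H as (n & _ & _ & L & _). mlia. Qed.

Lemma Good_frames I P Q R (K s k : A) : Is_seq s (k + 1) -> Top I P Q R (el s k) ->
  (forall i, i < k -> Mid I P Q R K (el s i) (el s (i + 1))) ->
  forall i, i < k + 1 -> exists e, Frame P R (el s i) e.
Proof.
  intros Hs (e & HT & _) HM i Hi. destruct (classic (i < k)) as [L|L].
  - destruct (HM i L) as (e' & z & H & _). eauto.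
  - assert (i = k) as -> by mlia. eauto.
Qed.

Lemma measure_is_ord I P N Q R (K u0 s : A) : Is_seq P N -> Good I P Q R K u0 s -> Is_ord (measure P K s).
Proof.
  intros HP (k & Hs & HT & HM & _). unfold measure. rewrite (len_eq s (k + 1) Hs).
  apply (expand_is_ord _ _ _ (rank_comp1 K s) (cost_comp1 P s)).
  - intros r Hr. split; [apply alpha_is_ord|].
    destruct (Good_frames I P Q R K s k Hs HT HM r Hr) as [e He]. exact (cost_pos P N R _ e HP He).
  - intros r Hr. apply alpha_lt. destruct (HM r ltac:(mlia)) as (_ & _ & _ & _ & _ & _ & _ & H). exact H.
Qed.

Lemma Mid_ext I P Q R (K x y y' : A) : ff y = ff y' -> fu y = fu y' -> fm y = fm y' ->
  Mid I P Q R K x y -> Mid I P Q R K x y'.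
Proof. unfold Mid. now intros -> -> ->. Qed.

Lemma Good_advance I P N Q R (K u0 s k : A) : Is_seq P N -> Is_seq s (k + 1) ->
  (forall i, i < k -> Mid I P Q R K (el s i) (el s (i + 1))) ->
  ff (el s 0) = 0 -> fu (el s 0) = u0 ->
  forall e y, Frame P R (el s k) e ->
  ff y = ff (el s k) -> fu y = fu (el s k) -> fm y = fm (el s k) -> fn (el s k) < fn y ->
  Top I P Q R y ->
  Good I P Q R K u0 (snoc s k y) /\ Ord_lt (measure P K (snoc s k y)) (measure P K s).
Proof.
  intros HP Hs HM Hf Hu e y He Ef Eu Em Ln HT.
  assert (E : forall i, i < k -> el (snoc s k y) i = el s i) by (intros; now apply el_snoc_old).
  assert (Ek : el (snoc s k y) k = y) by apply el_snoc_new.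
  split.
  - exists k. split; [apply snoc_seq|]. split; [now rewrite Ek|]. split.
    + intros i Hi. rewrite E by exact Hi. destruct (classic (i + 1 < k)) as [L|L].
      * rewrite E by exact L. now apply HM.
      * assert (Ei : i + 1 = k) by mlia. rewrite Ei, Ek. specialize (HM i Hi). rewrite Ei in HM.
        revert HM. apply Mid_ext; auto.
    + destruct (zero_or_succ k) as [Z|[k' Z]].
      * rewrite Z in *. rewrite Ek. rewrite Ef, Eu. auto.
      * rewrite E by mlia. auto.
  - unfold measure. rewrite (len_eq s (k + 1) Hs), (len_eq _ (k + 1) (snoc_seq s k y)).
    apply (expand_lt_run _ _ _ _ _ _ k); try apply rank_comp1; try apply cost_comp1; try mlia.
    + intros r Hr. rewrite E by exact Hr. auto.
    + now rewrite Ek, Em.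
    + rewrite Ek. destruct HT as (e' & HT & _).
      pose proof (cost_eq P N R _ _ HP HT). pose proof (cost_eq P N R _ _ HP He).
      assert (e' = e) as ->.
      { destruct HT as (n1 & H1 & _), He as (n2 & H2 & _). rewrite Ef in H1.
        now destruct (Equation_unique P N _ _ _ _ _ HP H1 H2). }
      mlia.
Qed.

(** The cost of the calling frame falls and the new term has a smaller exponent, as the rank has
    decreased. So the measure falls, whatever the cost of the new frame is. *)
Lemma Good_push I P N Q R (K u0 s k : A) : Is_seq P N -> Is_seq s (k + 1) ->
  (forall i, i < k -> Mid I P Q R K (el s i) (el s (i + 1))) ->
  ff (el s 0) = 0 -> fu (el s 0) = u0 ->
  forall e x y, Frame P R (el s k) e ->
  ff x = ff (el s k) -> fu x = fu (el s k) -> fm x = fm (el s k) -> fn (el s k) < fn x ->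
  Mid I P Q R K x y -> Top I P Q R y ->
  Good I P Q R K u0 (snoc (snoc s k x) (k + 1) y) /\
  Ord_lt (measure P K (snoc (snoc s k x) (k + 1) y)) (measure P K s).
Proof.
  intros HP Hs HM Hf Hu e x y He Ef Eu Em Ln Hxy HT.
  pose (t := snoc (snoc s k x) (k + 1) y). fold t.
  assert (E : forall i, i < k -> el t i = el s i).
  { intros i Hi. unfold t. rewrite !el_snoc_old by mlia. reflexivity. }
  assert (Ek : el t k = x) by (unfold t; rewrite el_snoc_old by mlia; apply el_snoc_new).
  assert (Ek1 : el t (k + 1) = y) by apply el_snoc_new.
  assert (St : Is_seq t (k + 1 + 1)) by apply snoc_seq.
  split.
  - exists (k + 1). split; [exact St|]. split; [now rewrite Ek1|]. split.
    + intros i Hi. destruct (classic (i < k)) as [L|L].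
      * rewrite E by exact L. destruct (classic (i + 1 < k)) as [L'|L'].
        -- rewrite E by exact L'. now apply HM.
        -- assert (Ei : i + 1 = k) by mlia. rewrite Ei, Ek. specialize (HM i L). rewrite Ei in HM.
           revert HM. apply Mid_ext; auto.
      * assert (i = k) as -> by mlia. now rewrite Ek, Ek1.
    + destruct (zero_or_succ k) as [Z|[k' Z]].
      * rewrite Z in *. rewrite Ek. rewrite Ef, Eu. auto.
      * rewrite E by mlia. auto.
  - unfold measure. rewrite (len_eq s (k + 1) Hs), (len_eq t _ St).
    apply (expand_lt_run _ _ _ _ _ _ k); try apply rank_comp1; try apply cost_comp1; try mlia.
    + intros r Hr. rewrite E by exact Hr. auto.
    + now rewrite Ek, Em.
    + rewrite Ek. destruct Hxy as (e' & z & HT' & _).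
      pose proof (cost_eq P N R _ _ HP HT'). pose proof (cost_eq P N R _ _ HP He).
      assert (e' = e) as ->.
      { destruct HT' as (n1 & H1 & _), He as (n2 & H2 & _). rewrite Ef in H1.
        now destruct (Equation_unique P N _ _ _ _ _ HP H1 H2). }
      mlia.
    + intros _. rewrite Ek1. split.
      * destruct HT as (e' & HT & _). exact (cost_pos P N R _ _ HP HT).
      * apply alpha_lt. rewrite <- Em. destruct Hxy as (? & ? & _ & _ & _ & _ & _ & Hlex). exact Hlex.
Qed.

(** The measure loses its last term. The caller becomes the top frame without any change, since its
    counter was advanced at the call. *)
Lemma Good_pop I P N Q R (K u0 s k : A) : Is_seq P N -> Is_seq s (k + 1 + 1) ->
  (forall i, i < k + 1 -> Mid I P Q R K (el s i) (el s (i + 1))) ->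
  ff (el s 0) = 0 -> fu (el s 0) = u0 -> Top I P Q R (el s (k + 1)) ->
  Top I P Q R (el s k) ->
  exists t, Good I P Q R K u0 t /\ Ord_lt (measure P K t) (measure P K s).
Proof.
  intros HP Hs HM Hf Hu HT HT'. exists (snoc s k (el s k)).
  assert (E : forall i, i < k + 1 -> el (snoc s k (el s k)) i = el s i).
  { intros i Hi. destruct (classic (i < k)) as [L|L]; [now apply el_snoc_old|].
    assert (i = k) as -> by mlia. apply el_snoc_new. }
  split.
  - exists k. split; [apply snoc_seq|]. split; [rewrite E by mlia; exact HT'|]. split.
    + intros i Hi. rewrite !E by mlia. apply HM. mlia.
    + rewrite E by mlia. auto.
  - unfold measure. rewrite (len_eq s _ Hs), (len_eq _ (k + 1) (snoc_seq s k (el s k))).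
    apply expand_lt_prefix; try apply rank_comp1; try apply cost_comp1; try mlia.
    + intros r Hr. rewrite E by exact Hr. auto.
    + destruct HT as (e' & HT & _). exact (cost_pos P N R _ _ HP HT).
Qed.

Definition rank_init (P : A) (R : A -> A -> A -> Prop) : Prop :=
  forall n e u, Equation P 0 n e -> Is_seq u n -> exists m, R 0 u m.

(** Together with [rank_init] this is all that the machine uses of size-change termination; the
    forest of slots provides such an [R]. *)
Definition rank_descent (I : sets A) (P K : A) (R : A -> A -> A -> Prop) : Prop :=
  forall f u m tau g v n e k e', R f u m -> Equation P f n e -> Is_seq u n ->
    Equation P g k e' -> Is_seq v k ->
    Call P f tau g -> Transition I P f u tau g v -> exists m', R g v m' /\ Lex_lt K m' m.

Lemma Done_succ I P Q f u n : Done I P Q f u n -> (Fin_in (pr f n) Q -> exists v, Val I P u n v) ->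
  Done I P Q f u (n + 1).
Proof. intros H Hn z Hz Hq. apply lt_succ in Hz as [Hz| ->]; auto. Qed.

(** Only a completed entry frame has no successor, and it would give a value of [e0]. Otherwise a
    call pushes a frame, a completed frame is popped, and in all other cases the counter advances,
    values of compound subexpressions being obtained from those of their children. *)
Lemma Good_step I P N Q R (K n0 e0 u0 s : A) :
  Is_interpretation I -> Is_seq P N ->
  (forall f, f < N -> exists n e, Equation P f n e /\ Is_expr P n e) ->
  (forall f z, Fin_in (pr f z) Q <-> Node P f z) ->
  rank_descent I P K R -> Equation P 0 n0 e0 -> ~ (exists v, Val I P u0 e0 v) ->
  Good I P Q R K u0 s -> exists t, Good I P Q R K u0 t /\ Ord_lt (measure P K t) (measure P K s).
Proof.
  intros HI HP Hexpr HQ Hdesc He0 Hdiv (k & Hs & HT & HM & Hf & Hu).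
  destruct (HT) as (e & HF & HD).
  destruct (HF) as (n & He & Hun & Ln & HR).
  assert (Hex : Is_expr P n e).
  { destruct (Hexpr (ff (el s k)) (Nth_bound P N _ _ HP He)) as (n' & e' & H1 & H2).
    destruct (Equation_unique P N _ _ _ _ _ HP He H1) as [-> ->]. exact H2. }
  destruct (classic (fn (el s k) < e + 1)) as [L|L].
  - assert (Adv : (Fin_in (pr (ff (el s k)) (fn (el s k))) Q -> exists v, Val I P (fu (el s k)) (fn (el s k)) v) ->
      exists t, Good I P Q R K u0 t /\ Ord_lt (measure P K t) (measure P K s)).
    { intros Hv. pose (y := frame (ff (el s k)) (fu (el s k)) (fn (el s k) + 1) (fm (el s k))).
      exists (snoc s k y).
      apply (Good_advance I P N Q R K u0 s k HP Hs HM Hf Hu e y HF); unfold y;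
        rewrite ?ff_frame, ?fu_frame, ?fn_frame, ?fm_frame; auto; [mlia|].
      exists e. unfold Frame. rewrite ff_frame, fu_frame, fn_frame, fm_frame. split.
      - exists n. split; [exact He|]. split; [exact Hun|]. split; [mlia|exact HR].
      - now apply Done_succ. }
    destruct (classic (Fin_in (pr (ff (el s k)) (fn (el s k))) Q)) as [HQn|HQn]; [|apply Adv; tauto].
    pose proof (proj1 (HQ _ _) HQn) as Hnode.
    destruct (node_wf P N _ n e _ HP He Hex Hnode) as [HW _].
    assert (Hch : forall i y, Child (fn (el s k)) i y -> exists v, Val I P (fu (el s k)) y v).
    { intros i y C. apply HD; [now apply (Child_lt _ i)|]. apply HQ. exact (node_child _ _ _ _ _ Hnode C). }
    destruct (Wf_cases _ _ _ HW) as [Hat|[(g & a & j & e' & E & He' & Ha & _)|[(p & a & j & E & Ha & _)|(b & x0 & x1 & E & Hb & _ & _)]]].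
    + apply Adv. intros _. exact (val_atom I P n _ _ Hun Hat).
    + destruct (link_exists I P (fu (el s k)) g a j Ha) as (v & Hv & HL).
      { intros i Hi. apply (Hch i). rewrite E. left. exists g, a. split; [auto|]. now apply (el_Nth a j). }
      rewrite <- E in HL.
      destruct (link_transition I P _ _ _ g v n e He Hun Hnode) as (tau & HC & HTr); [|exact HL|].
      { intros n' e'' H'. destruct (Equation_unique P N _ _ _ _ _ HP He H'). auto. }
      destruct (Hdesc _ _ _ tau g v n e j e' HR He Hun He' Hv HC HTr) as (m' & HR' & Hlex).
      pose (x := frame (ff (el s k)) (fu (el s k)) (fn (el s k) + 1) (fm (el s k))).
      pose (y := frame g v 0 m').
      exists (snoc (snoc s k x) (k + 1) y).
      apply (Good_push I P N Q R K u0 s k HP Hs HM Hf Hu e x y HF); unfold x, y;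
        rewrite ?ff_frame, ?fu_frame, ?fn_frame, ?fm_frame; auto; [mlia| |].
      * exists e, (fn (el s k)). unfold Frame.
        rewrite !ff_frame, !fu_frame, !fn_frame, !fm_frame.
        split; [exists n; split; [exact He|]; split; [exact Hun|]; split; [mlia|exact HR]|]. auto.
      * exists e'. unfold Frame. rewrite !ff_frame, !fu_frame, !fn_frame, !fm_frame. split.
        -- exists j. split; [exact He'|]. split; [exact Hv|]. split; [mlia|exact HR'].
        -- intros z Hz. mlia.
    + apply Adv. intros _. rewrite E. apply val_op; [exact HI|exact Ha|].
      intros i Hi. apply (Hch i). rewrite E. left. exists (pr p j), a. split; [auto|]. now apply (el_Nth a j).
    + apply Adv. intros _. rewrite E. apply (val_if I P n _ b x0 x1 Hun Hb).
      * apply (Hch 0). rewrite E. right. exists b, x0, x1. auto.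
      * apply (Hch 1). rewrite E. right. exists b, x0, x1. auto.
  (* The counter has passed [e], so the body has a value: this contradicts [Hdiv] if the frame is
     the bottom one, and otherwise is the value awaited by the frame below. *)
  - assert (Hval : exists v, Val I P (fu (el s k)) e v).
    { apply HD; [mlia|]. apply HQ. exact (node_root _ _ _ _ He). }
    destruct (zero_or_succ k) as [->|[j ->]].
    + exfalso. apply Hdiv. rewrite Hf in He. destruct (Equation_unique P N _ _ _ _ _ HP He0 He) as [_ ->].
      now rewrite <- Hu.
    + apply (Good_pop I P N Q R K u0 s j HP Hs HM Hf Hu HT).
      destruct (HM j ltac:(mlia)) as (e1 & z & HF1 & En & HD1 & HQ1 & HL & _).
      exists e1. split; [exact HF1|]. rewrite En. apply Done_succ; [exact HD1|]. intros _.
      destruct Hval as [w Hw]. exists w. exact (val_call I P _ _ _ _ n e w HL He Hun Hw).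
Qed.

Theorem machine I P K R : @Wo_omega_tower A 3 -> Is_interpretation I -> Is_program P -> sigma3 R ->
  rank_init P R -> rank_descent I P K R -> Terminating I P.
Proof.
  intros (a & Ha & HWo) HI (N & HP & _ & Hexpr) HR Hinit Hdesc n0 e0 u0 s0 He0 Hu0 Hs0.
  enough (Hv : exists v, Val I P u0 e0 v).
  { destruct Hv as (v & t & Ht & Rt). exists v. apply (Reduces_trans _ _ _ t); [|exact Rt].
    apply Reduces_step, (Step_call I P 0 s0 u0 n0 e0); auto. }
  apply NNPP. intros Hdiv.
  (* Positions of functions and subexpressions of bodies are below [P], whence the bound on the
     pairs. *)
  destruct (bounded_comprehension (fun x => exists f z, x = pr f z /\ Node P f z) (pr P P + 1)) as (Q & _ & HQ').
  { unfold sigma1. sigma. }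
  assert (HQ : forall f z, Fin_in (pr f z) Q <-> Node P f z).
  { intros f z. rewrite HQ'. split.
    - intros (_ & f' & z' & E & H). apply pr_inj in E as [-> ->]. exact H.
    - intros H. split; [|eauto]. destruct (H) as (n & e & tau & He & _).
      destruct (Hexpr f (Nth_bound P N _ _ HP He)) as (n' & e' & H1 & H2).
      destruct (Equation_unique P N _ _ _ _ _ HP He H1) as [-> ->].
      destruct (node_wf P N f n' e' z HP H1 H2 H) as [_ L].
      apply Nth_lt in He as [Lf Le]. pose proof (pr_le_r n' e').
      apply (pr_mono f z P P); mlia. }
  destruct (Hinit n0 e0 u0 He0 Hu0) as [m0 Hm0].
  pose (x0 := frame 0 u0 0 m0). pose proof (comp1_const x0) as Cx.
  assert (G0 : Good I P Q R K u0 (mkseq (0 + 1) (fun _ => x0))).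
  { assert (E : el (mkseq (0 + 1) (fun _ => x0)) 0 = x0) by (apply (el_mkseq (0 + 1) (fun _ => x0)); [exact Cx|mlia]).
    exists 0. split; [now apply mkseq_seq|]. rewrite E. split; [|split; [intros i Hi; mlia|]].
    - exists e0. unfold Frame, x0. rewrite ff_frame, fu_frame, fn_frame, fm_frame. split.
      + exists n0. split; [exact He0|]. split; [exact Hu0|]. split; [mlia|exact Hm0].
      + intros z Hz. mlia.
    - unfold x0. rewrite ff_frame, fu_frame. auto. }
  pose proof (measure_comp1 P K) as CM.
  (* Since the machine can always make a step, there is an infinite computable run; the set of pairs
     of its measures is what [Wo] forbids. *)
  destruct (dependent_choice (Good I P Q R K u0) (fun s t => Ord_lt (measure P K t) (measure P K s))
    (mkseq (0 + 1) (fun _ => x0)) (Good_sigma I P Q R K u0 HR)) with (2 := G0) as (f & Cf & _ & Hf').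
  - unfold sigma2. sigma.
  - intros s Hs. exact (Good_step I P N Q R K n0 e0 u0 s HI HP Hexpr HQ Hdesc He0 Hdiv Hs).
  - destruct (graph_set (fun i => measure P K (f i))) as [F HF]; [unfold comp1; comp|].
    apply HWo. exists F. split; [|split; [|split]].
    + intros i. exists (measure P K (f i)). split; [now apply HF|]. intros y Hy. now apply HF in Hy.
    + intros i x Hx. apply HF in Hx as ->. apply (measure_is_ord I P N Q R K u0); [exact HP|apply Hf'].
    + intros x Hx. apply HF in Hx as ->. destruct (Hf' 0) as [(k & Hs & HT & HM & _) _].
      unfold measure. rewrite (len_eq _ _ Hs).
      apply (expand_lt_omega_3 K (k + 1) (fun i => fm (el (f 0) i))); auto; try mlia.
      * pose proof comp1_fm. unfold comp1. comp.
      * apply cost_comp1.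
      * destruct (Good_frames I P Q R K (f 0) k Hs HT HM 0 ltac:(mlia)) as [e He].
        exact (cost_pos P N R _ e HP He).
    + intros i x y Hx Hy. apply HF in Hx as ->. apply HF in Hy as ->. apply Hf'.
Qed.

End Machine.

(** * Size-change graphs *)

Section Graphs.
Context {A : model}.
Notation env := (nat -> dom A).
Notation "0" := (@zero A).
Notation "1" := (@one A).
Infix "+" := (@add A).
Infix "*" := (@mul A).
Infix "<" := (@lt A).

Lemma delta3_Strict_arc : delta3 (@Strict_arc A).
Proof. unfold delta3, Strict_arc. delta. Qed.
Lemma delta3_Weak_arc : delta3 (@Weak_arc A).
Proof. unfold delta3, Weak_arc. delta. Qed.

Lemma arc_lt (G x y t : A) : Fin_in (pr (pr x y) t) G -> x < G /\ y < G.
Proof.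
  intros H. apply Fin_in_lt in H. pose proof (pr_le_l (pr x y) t). pose proof (pr_le_l x y).
  pose proof (pr_le_r x y). mlia.
Qed.

(** The condition for strict arcs in [Composition], with a bound on the middle vertex that makes it
    decidable. *)
Definition Strict_path (G H x w : A) : Prop :=
  exists y, y < G /\ ((Strict_arc G x y /\ (Strict_arc H y w \/ Weak_arc H y w)) \/
                      (Weak_arc G x y /\ Strict_arc H y w)).
Definition Weak_path (G H x w : A) : Prop :=
  exists y, y < G /\ (Weak_arc G x y /\ Weak_arc H y w).

Lemma delta4_Strict_path : delta4 Strict_path.
Proof. pose proof delta3_Strict_arc. pose proof delta3_Weak_arc. unfold delta4, Strict_path. delta. Qed.
Lemma delta4_Weak_path : delta4 Weak_path.
Proof. pose proof delta3_Strict_arc. pose proof delta3_Weak_arc. unfold delta4, Weak_path. delta. Qed.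

Lemma Strict_path_iff (G H x w : A) : Strict_path G H x w <->
  exists y, (Strict_arc G x y /\ (Strict_arc H y w \/ Weak_arc H y w)) \/ (Weak_arc G x y /\ Strict_arc H y w).
Proof.
  split; [intros (y & _ & Q); eauto|]. intros (y & Q). exists y. split; [|exact Q].
  destruct Q as [[Q _]|[Q _]]; exact (proj2 (arc_lt _ _ _ _ Q)).
Qed.

Lemma Weak_path_iff (G H x w : A) : Weak_path G H x w <-> exists y, Weak_arc G x y /\ Weak_arc H y w.
Proof.
  split; [intros (y & _ & Q); eauto|]. intros (y & Q). exists y. split; [|exact Q].
  destruct Q as [Q _]; exact (proj2 (arc_lt _ _ _ _ Q)).
Qed.

Lemma path_lt (G H x w : A) : Strict_path G H x w \/ Weak_path G H x w -> x < G /\ w < H.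
Proof.
  intros [(y & _ & [[Q [Q'|Q']]|[Q Q']])|(y & _ & Q & Q')];
    apply arc_lt in Q, Q'; tauto.
Qed.

Definition gcomp (G H : A) : A :=
  mkset (pr (pr G H) 1 + 1) (fun z => exists x, x < G /\ exists w, w < H /\
    ((z = pr (pr x w) (num 1) /\ Strict_path G H x w) \/
     (z = pr (pr x w) (num 0) /\ (Weak_path G H x w /\ ~ Strict_path G H x w)))).

Lemma comp2_gcomp : comp2 gcomp.
Proof.
  pose proof delta4_Strict_path. pose proof delta4_Weak_path. unfold comp2, gcomp. comp.
Qed.

Lemma Fin_in_gcomp (G H z : A) : Fin_in z (gcomp G H) <-> exists x w,
  (z = pr (pr x w) (num 1) /\ Strict_path G H x w) \/
  (z = pr (pr x w) (num 0) /\ (Weak_path G H x w /\ ~ Strict_path G H x w)).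
Proof.
  unfold gcomp. rewrite Fin_in_mkset.
  - split; [intros (_ & x & _ & w & _ & Q); eauto|].
    intros (x & w & Q). assert (L : x < G /\ w < H) by (apply path_lt; tauto).
    destruct L as [Lx Lw]. split; [|exists x; split; [exact Lx|exists w; auto]].
    assert (le (pr x w) (pr G H)) by (apply pr_mono; mlia).
    destruct Q as [[-> _]|[-> _]]; apply pr_mono; simpl; auto; mlia.
  - pose proof delta4_Strict_path. pose proof delta4_Weak_path. unfold delta1. delta.
Qed.

Lemma gcomp_finset (G H : A) : Is_finset (gcomp G H).
Proof.
  apply mkset_spec. pose proof delta4_Strict_path. pose proof delta4_Weak_path. unfold delta1. delta.
Qed.

Lemma Strict_gcomp (G H x w : A) : Strict_arc (gcomp G H) x w <-> Strict_path G H x w.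
Proof.
  unfold Strict_arc. rewrite Fin_in_gcomp. split; [|eauto].
  intros (x' & w' & [[E Q]|[E _]]); apply pr_inj in E as [E E'].
  - apply pr_inj in E as [-> ->]. exact Q.
  - apply num_inj in E'. discriminate.
Qed.

Lemma Weak_gcomp (G H x w : A) : Weak_arc (gcomp G H) x w <-> Weak_path G H x w /\ ~ Strict_path G H x w.
Proof.
  unfold Weak_arc. rewrite Fin_in_gcomp. split; [|eauto].
  intros (x' & w' & [[E _]|[E Q]]); apply pr_inj in E as [E E'].
  - apply num_inj in E'. discriminate.
  - apply pr_inj in E as [-> ->]. exact Q.
Qed.

Lemma gcomp_composition (G H : A) : Composition G H (gcomp G H).
Proof.
  split; intros x z.
  - rewrite Strict_gcomp. apply Strict_path_iff.
  - rewrite Weak_gcomp, Weak_path_iff, Strict_gcomp. reflexivity.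
Qed.

Lemma gcomp_ext (G H G' H' : A) :
  (forall x w, Strict_path G H x w <-> Strict_path G' H' x w) ->
  (forall x w, ~ Strict_path G H x w -> (Weak_path G H x w <-> Weak_path G' H' x w)) ->
  gcomp G H = gcomp G' H'.
Proof.
  intros HS HW. apply finset_ext; try apply gcomp_finset. intros z. rewrite !Fin_in_gcomp.
  split; intros (x & w & [[E Q]|(E & Q & Q')]); exists x, w.
  - left. now rewrite <- HS.
  - right. rewrite <- HS. split; [exact E|]. split; [now apply HW|exact Q'].
  - left. now rewrite HS.
  - right. rewrite HS. split; [exact E|]. split; [apply HW; [now rewrite HS|exact Q]|exact Q'].
Qed.

(** Both sides have a strict arc from [x] to [w] when there is a path in
    [G], [H], [L] with a strict arc, and otherwise a weak one when there is a
    path of weak arcs. *)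
Lemma gcomp_assoc (G H L : A) : gcomp (gcomp G H) L = gcomp G (gcomp H L).
Proof.
  (* Up to strictness, the arcs of a composition are exactly the paths of length two; a weak arc is
     only ever displaced by a strict one. *)
  assert (any : forall G H x w, Strict_arc (gcomp G H) x w \/ Weak_arc (gcomp G H) x w <->
    exists y, (Strict_arc G x y \/ Weak_arc G x y) /\ (Strict_arc H y w \/ Weak_arc H y w)).
  { intros G' H' x w. rewrite Strict_gcomp, Weak_gcomp, Weak_path_iff. split.
    - rewrite Strict_path_iff. intros [(y & Q)|[(y & Q) _]]; exists y; tauto.
    - intros (y & Q1 & Q2). destruct (classic (Strict_path G' H' x w)) as [S|S]; [tauto|]. right.
      split; [|exact S]. exists y. rewrite Strict_path_iff in S.
      split; apply NNPP; intros N; apply S; exists y; tauto. }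
  assert (S1 : forall x w, Strict_path (gcomp G H) L x w <-> exists y z,
    (Strict_arc G x y \/ Weak_arc G x y) /\ (Strict_arc H y z \/ Weak_arc H y z) /\
    (Strict_arc L z w \/ Weak_arc L z w) /\ (Strict_arc G x y \/ Strict_arc H y z \/ Strict_arc L z w)).
  { intros x w. rewrite Strict_path_iff. split.
    - intros (z & [[Q1 Q2]|[Q1 Q2]]).
      + apply Strict_gcomp, Strict_path_iff in Q1 as (y & Q1). exists y, z. tauto.
      + destruct (proj1 (any G H x z)) as (y & Q3 & Q4); [tauto|]. exists y, z. tauto.
    - intros (y & z & Q1 & Q2 & Q3 & Q4). exists z.
      destruct (proj2 (any G H x z)) as [Q|Q]; [eauto|tauto|].
      destruct Q4 as [Q4|[Q4|Q4]]; [| |tauto];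
        left; (split; [|exact Q3]); apply Strict_gcomp, Strict_path_iff; exists y; tauto. }
  assert (S2 : forall x w, Strict_path G (gcomp H L) x w <-> exists y z,
    (Strict_arc G x y \/ Weak_arc G x y) /\ (Strict_arc H y z \/ Weak_arc H y z) /\
    (Strict_arc L z w \/ Weak_arc L z w) /\ (Strict_arc G x y \/ Strict_arc H y z \/ Strict_arc L z w)).
  { intros x w. rewrite Strict_path_iff. split.
    - intros (y & [[Q1 Q2]|[Q1 Q2]]).
      + apply any in Q2 as (z & Q3 & Q4). exists y, z. tauto.
      + apply Strict_gcomp, Strict_path_iff in Q2 as (z & Q2). exists y, z. tauto.
    - intros (y & z & Q1 & Q2 & Q3 & Q4). exists y.
      destruct (proj2 (any H L y w)) as [Q|Q]; [eauto|tauto|].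
      destruct Q4 as [Q4|Q4]; [tauto|].
      assert (S : Strict_arc (gcomp H L) y w) by (apply Strict_gcomp, Strict_path_iff; exists z; tauto).
      tauto. }
  apply gcomp_ext.
  - intros x w. now rewrite S1, S2.
  - intros x w N. rewrite !Weak_path_iff. split.
    + intros (z & Q1 & Q2). apply Weak_gcomp in Q1 as [Q1 _]. apply Weak_path_iff in Q1 as (y & Q1 & Q3).
      exists y. split; [exact Q1|]. apply Weak_gcomp. split; [apply Weak_path_iff; eauto|].
      intros S. apply N, S1. apply Strict_path_iff in S as (z' & S). exists y, z'. tauto.
    + intros (y & Q1 & Q2). apply Weak_gcomp in Q2 as [Q2 _]. apply Weak_path_iff in Q2 as (z & Q2 & Q3).
      exists z. split; [|exact Q3]. apply Weak_gcomp. split; [apply Weak_path_iff; eauto|].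
      intros S. apply N, S1. apply Strict_path_iff in S as (y' & S). exists y', z. tauto.
Qed.

Lemma Is_graph_gcomp (P N f h g G H : A) : Is_seq P N -> Is_graph P f h G -> Is_graph P h g H ->
  Is_graph P f g (gcomp G H).
Proof.
  intros HP (_ & n & e & k & e' & He & He' & HG) (_ & k2 & e2 & l & e3 & He2 & He3 & HH).
  split; [apply gcomp_finset|]. exists n, e, l, e3. split; [exact He|]. split; [exact He3|].
  assert (BG : forall x y t, Fin_in (pr (pr x y) t) G -> x < n).
  { intros x y t Q. apply HG in Q as (x' & y' & L & _ & [E|E]);
      apply pr_inj in E as [E _]; apply pr_inj in E as [-> _]; exact L. }
  assert (BH : forall x y t, Fin_in (pr (pr x y) t) H -> y < l).
  { intros x y t Q. apply HH in Q as (x' & y' & _ & L & [E|E]);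
      apply pr_inj in E as [E _]; apply pr_inj in E as [_ ->]; exact L. }
  intros z Hz. apply Fin_in_gcomp in Hz as (x & w & Q). exists x, w.
  assert (L : x < n /\ w < l).
  { assert (Q' : Strict_path G H x w \/ Weak_path G H x w) by tauto.
    destruct Q' as [(y & _ & [[Q1 [Q2|Q2]]|[Q1 Q2]])|(y & _ & Q1 & Q2)];
      (split; [exact (BG _ _ _ Q1)|exact (BH _ _ _ Q2)]). }
  tauto.
Qed.

Lemma delta3_Composition : delta3 (@Composition A).
Proof.
  pose proof delta3_Strict_arc. pose proof delta3_Weak_arc.
  pose proof delta4_Strict_path. pose proof delta4_Weak_path. unfold delta3.
  apply (delta_ext (fun e => forall x, x < e 0%nat + e 2%nat -> forall z, z < e 1%nat + e 2%nat ->
    (Strict_arc (e 2%nat) x z <-> Strict_path (e 0%nat) (e 1%nat) x z) /\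
    (Weak_arc (e 2%nat) x z <-> Weak_path (e 0%nat) (e 1%nat) x z /\ ~ Strict_arc (e 2%nat) x z))); [delta|].
  intros e. unfold Composition. split.
  - intros [H1' H2'] x _ z _. rewrite Strict_path_iff, Weak_path_iff. auto.
  - intros Q.
    assert (Q' : forall x z, (Strict_arc (e 2%nat) x z <-> Strict_path (e 0%nat) (e 1%nat) x z) /\
      (Weak_arc (e 2%nat) x z <-> Weak_path (e 0%nat) (e 1%nat) x z /\ ~ Strict_arc (e 2%nat) x z)).
    { intros x z. destruct (classic (x < e 0%nat + e 2%nat /\ z < e 1%nat + e 2%nat)) as [[L1 L2]|N]; [auto|].
      assert (B1 : Strict_arc (e 2%nat) x z \/ Weak_arc (e 2%nat) x z -> False).
      { intros B. apply N. assert (x < e 2%nat /\ z < e 2%nat) by (destruct B as [B|B]; exact (arc_lt _ _ _ _ B)). mlia. }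
      assert (B2 : Strict_path (e 0%nat) (e 1%nat) x z \/ Weak_path (e 0%nat) (e 1%nat) x z -> False).
      { intros B. apply N. apply path_lt in B. mlia. }
      tauto. }
    split; intros x z; destruct (Q' x z) as [Q1 Q2].
    + rewrite Q1. apply Strict_path_iff.
    + rewrite Q2, Weak_path_iff. reflexivity.
Qed.

Lemma sigma4_Is_graph : sigma4 (@Is_graph A).
Proof. unfold sigma4, Is_graph. sigma. Qed.

Lemma sigma5_In_closure : sigma5 (@In_closure A).
Proof.
  pose proof delta3_Composition. pose proof sigma4_Is_graph. unfold sigma5, In_closure, Assigns. sigma.
Qed.

Lemma closure_base (P D f tau g G : A) : Call P f tau g -> Assigns D f tau G -> In_closure P D f g G.
Proof.
  intros HC HA. pose (x := pr (pr f g) G). exists (snoc (mkseq 0 (fun _ => 0)) 0 x), 0.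
  split; [apply snoc_seq|]. split; [apply Nth_snoc_new|].
  intros i Hi. assert (i = 0) as -> by mlia. exists f, g, G. split; [apply Nth_snoc_new|]. left. eauto.
Qed.

(** The graph of the call and then the composition are appended to the sequence witnessing the
    closure. *)
Lemma closure_comp (P D f h tau g G H : A) : In_closure P D f h G -> Call P h tau g -> Assigns D h tau H ->
  Is_graph P f g (gcomp G H) -> In_closure P D f g (gcomp G H).
Proof.
  intros (s & n & Hs & Hn & HI) HC HA HG.
  pose (s1 := snoc s (n + 1) (pr (pr h g) H)). pose (s2 := snoc s1 (n + 1 + 1) (pr (pr f g) (gcomp G H))).
  assert (S1 : Is_seq s1 (n + 1 + 1)) by apply snoc_seq.
  assert (N1 : forall i x, Nth s i x -> Nth s2 i x).
  { intros i x Hx. apply Nth_snoc_old; [exact S1|]. now apply Nth_snoc_old. }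
  assert (N2 : Nth s2 (n + 1) (pr (pr h g) H)).
  { apply Nth_snoc_old; [exact S1|]. apply Nth_snoc_new. }
  exists s2, (n + 1 + 1). split; [apply snoc_seq|]. split; [apply Nth_snoc_new|].
  intros i Hi. destruct (classic (i < n + 1)) as [L|L].
  - destruct (HI i L) as (f' & g' & G' & Hx & Q). exists f', g', G'. split; [auto|].
    destruct Q as [Q|(j & k & h' & G0 & G1 & Lj & Lk & Hj & Hk & Q)]; [now left|right].
    exists j, k, h', G0, G1. auto 10.
  - destruct (classic (i < n + 1 + 1)) as [L'|L'].
    + assert (i = n + 1) as -> by mlia. exists h, g, H. split; [exact N2|]. left. eauto.
    + assert (i = n + 1 + 1) as -> by mlia. exists f, g, (gcomp G H). split; [apply Nth_snoc_new|]. right.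
      exists n, (n + 1), h, G, H. split; [mlia|]. split; [mlia|]. split; [auto|]. split; [exact N2|].
      split; [exact HG|apply gcomp_composition].
Qed.

(** * Colours and their composition *)

Definition colour (f g G : A) : A := pr (pr f g) G.
Definition src (c : A) : A := fst (fst c).
Definition tgt (c : A) : A := snd (fst c).
Definition gr (c : A) : A := snd c.

Lemma src_colour f g G : src (colour f g G) = f.
Proof. unfold src, colour. now rewrite !fst_pr. Qed.
Lemma tgt_colour f g G : tgt (colour f g G) = g.
Proof. unfold tgt, colour. now rewrite fst_pr, snd_pr. Qed.
Lemma gr_colour f g G : gr (colour f g G) = G.
Proof. unfold gr, colour. now rewrite snd_pr. Qed.

Lemma comp3_colour : comp3 colour. Proof. unfold comp3, colour. comp. Qed.
Lemma comp1_src : comp1 src. Proof. unfold comp1, src. comp. Qed.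
Lemma comp1_tgt : comp1 tgt. Proof. unfold comp1, tgt. comp. Qed.
Lemma comp1_gr : comp1 gr. Proof. unfold comp1, gr. comp. Qed.

(** Defined also when the target of [c] is not the source of [d], so that associativity holds
    without side conditions. *)
Definition dcomp (c d : A) : A := colour (src c) (tgt d) (gcomp (gr c) (gr d)).

Lemma dcomp_assoc c d e : dcomp (dcomp c d) e = dcomp c (dcomp d e).
Proof. unfold dcomp. now rewrite !src_colour, !tgt_colour, !gr_colour, gcomp_assoc. Qed.

Lemma comp2_dcomp : comp2 dcomp.
Proof.
  pose proof comp3_colour. pose proof comp1_src. pose proof comp1_tgt. pose proof comp1_gr.
  pose proof comp2_gcomp. unfold comp2, dcomp. comp.
Qed.

(** Composition of optional colours: 0 is the identity and [c + 1] is the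
    colour [c]. *)
Definition cmp (x y : A) : A :=
  ite (x = 0) y (ite (y = 0) x (dcomp (sub x 1) (sub y 1) + 1)).

Lemma comp2_cmp : comp2 cmp.
Proof. pose proof comp2_dcomp. unfold comp2, cmp. comp. Qed.

Lemma sub_1 (x : A) : sub (x + 1) 1 = x.
Proof. rewrite add_comm. apply sub_add. Qed.

Lemma cmp_0_l y : cmp 0 y = y.
Proof. unfold cmp. now rewrite ite_true. Qed.
Lemma cmp_0_r x : cmp x 0 = x.
Proof.
  unfold cmp. destruct (classic (x = 0)) as [->|N]; [now rewrite ite_true|].
  now rewrite ite_false, ite_true.
Qed.
Lemma cmp_succ c d : cmp (c + 1) (d + 1) = dcomp c d + 1.
Proof. unfold cmp. rewrite !ite_false, !sub_1 by mlia. reflexivity. Qed.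

Lemma cmp_assoc x y z : cmp (cmp x y) z = cmp x (cmp y z).
Proof.
  destruct (zero_or_succ x) as [->|[a ->]]; [now rewrite !cmp_0_l|].
  destruct (zero_or_succ y) as [->|[b ->]]; [now rewrite cmp_0_l, cmp_0_r|].
  destruct (zero_or_succ z) as [->|[c ->]]; [now rewrite !cmp_0_r|].
  now rewrite !cmp_succ, dcomp_assoc.
Qed.

Definition Col (P c : A) : Prop := exists f g G, c = colour f g G /\ Is_graph P f g G.

Lemma Col_sigma P : sigma1 (Col P).
Proof. pose proof sigma4_Is_graph. pose proof comp3_colour. unfold sigma1, Col. sigma. Qed.

Lemma Col_dcomp (P N c d : A) : Is_seq P N -> Col P c -> Col P d -> tgt c = src d -> Col P (dcomp c d).
Proof.
  intros HP (f & g & G & -> & HG) (f' & g' & H & -> & HH). rewrite tgt_colour, src_colour. intros <-.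
  unfold dcomp. rewrite src_colour, tgt_colour, !gr_colour. exists f, g', (gcomp G H). split; [reflexivity|].
  exact (Is_graph_gcomp P N f g g' G H HP HG HH).
Qed.

(** A graph is a set of pairs of an arc and a tag, with parameters below [P], so [fin_bound]
    applies. This [K] becomes the length of the slots and bounds the coordinates of the ranks. *)
Lemma Col_bound (P : A) : exists K, forall c, Col P c -> c < K.
Proof.
  destruct (fin_bound (pr (pr P P) 1 + 1)) as [B HB].
  exists (pr (pr P P) B + 1). intros c (f & g & G & -> & Hfin & n & e & k & e' & He & He' & HG).
  assert (L : f < P /\ n < P).
  { apply Nth_lt in He. pose proof (pr_le_l n e). mlia. }
  assert (L' : g < P /\ k < P).
  { apply Nth_lt in He'. pose proof (pr_le_l k e'). mlia. }
  assert (LB : G < B).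
  { apply (HB G Hfin). intros z Hz. apply HG in Hz as (x & y & Lx & Ly & E).
    assert (le (pr x y) (pr P P)) by (apply pr_mono; mlia).
    destruct E as [-> | ->]; apply pr_mono; simpl; auto; mlia. }
  apply pr_mono; [apply pr_mono; mlia|mlia].
Qed.

End Graphs.

#[export] Hint Resolve delta3_Strict_arc delta3_Weak_arc comp2_gcomp sigma4_Is_graph sigma5_In_closure
  comp3_colour comp1_src comp1_tgt comp1_gr comp2_dcomp comp2_cmp : defn.

(** * Ranks of histories of calls *)

Section Slots.
Context {A : model}.
Notation env := (nat -> dom A).
Notation "0" := (@zero A).
Notation "1" := (@one A).
Infix "+" := (@add A).
Infix "*" := (@mul A).
Infix "<" := (@lt A).

(** A slot assigns to each colour [d < K] either 0 ("unset") or an entry: the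
    optional colour [r] of the calls since [d] was set, and a bound [b]. *)
Definition entry (r b : A) : A := pr r b + 1.
Definition rr (y : A) : A := fst (sub y 1).
Definition bb (y : A) : A := snd (sub y 1).

Lemma rr_entry r b : rr (entry r b) = r.
Proof. unfold rr, entry. now rewrite sub_1, fst_pr. Qed.
Lemma bb_entry r b : bb (entry r b) = b.
Proof. unfold bb, entry. now rewrite sub_1, snd_pr. Qed.
Lemma entry_neq0 r b : entry r b <> 0.
Proof. unfold entry. mlia. Qed.

Lemma comp2_entry : comp2 entry. Proof. unfold comp2, entry. comp. Qed.
Lemma comp1_rr : comp1 rr. Proof. unfold comp1, rr. comp. Qed.
Lemma comp1_bb : comp1 bb. Proof. unfold comp1, bb. comp. Qed.

Definition has_loop (d : A) : Prop := exists x, x < gr d /\ Strict_arc (gr d) x x.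
(** Without a loop the value is the default [gr d]. Such a colour can be set, but is not set anew
    while it is set, so its stored bound then stays constant. *)
Definition loop (d : A) : A := bmu (gr d) (fun x => Strict_arc (gr d) x x).

Lemma delta1_has_loop : delta1 has_loop. Proof. unfold delta1, has_loop. delta. Qed.
Lemma comp1_loop : comp1 loop. Proof. unfold comp1, loop. comp. Qed.

Lemma loop_arc d : has_loop d -> Strict_arc (gr d) (loop d) (loop d).
Proof.
  intros (x & Hx & H). apply (bmu_spec (gr d) (fun x => Strict_arc (gr d) x x) x); auto.
  unfold delta1. delta.
Qed.

Lemma has_loop_intro d x : Strict_arc (gr d) x x -> has_loop d.
Proof. intros H. exists x. split; [exact (proj1 (arc_lt _ _ _ _ H))|exact H]. Qed.

Definition Matches (K q h : A) : Prop := forall d, d < K -> ~ el q d = 0 -> cmp (rr (el q d)) h = d + 1.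

Lemma delta3_Matches : delta3 Matches.
Proof. pose proof comp1_rr. unfold delta3, Matches. delta. Qed.

Definition slot (x : A) : A := sub x 1.
Lemma comp1_slot : comp1 slot. Proof. unfold comp1, slot. comp. Qed.
Lemma slot_succ q : slot (q + 1) = q. Proof. apply sub_1. Qed.

(** When [d] was set, [b] was the value of the argument [loop d], which is why
    the arcs of [r] starting at [loop d] bound the present arguments [u]. *)
Definition Entry_ok (P D CS f u d y : A) : Prop :=
  (rr y = 0 \/ exists c, rr y = c + 1 /\ Fin_in c CS /\ In_closure P D (src c) (tgt c) (gr c) /\ tgt c = f) /\
  (has_loop d -> (rr y = 0 -> le (el u (loop d)) (bb y)) /\
     forall c, c < rr y -> rr y = c + 1 -> forall z, z < gr c ->
       (Strict_arc (gr c) (loop d) z -> el u z < bb y) /\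
       (Weak_arc (gr c) (loop d) z -> le (el u z) (bb y))).

Definition Slots_ok (K P D CS f u L l : A) : Prop :=
  forall i, i < l -> ~ el L i = 0 -> forall d, d < K -> ~ el (slot (el L i)) d = 0 ->
    Entry_ok P D CS f u d (el (slot (el L i)) d).

(** Whatever the composite [c] of the calls to come, some slot is such that [c]
    would complete all its set colours. *)
Definition Cover (K CS f L l : A) : Prop :=
  forall c, c < K -> Fin_in c CS -> src c = f ->
    exists i, i < l /\ (~ el L i = 0 /\ Matches K (slot (el L i)) (c + 1)).

Definition setcount (K q : A) : A := sum K (fun d => ite (el q d = 0) 0 1).
Definition bsum (K q : A) : A := sum K (fun d => ite (el q d = 0) 0 (bb (el q d))).
Definition weight (K r x : A) : A :=
  ite (~ x = 0 /\ setcount K (slot x) = r) (pow (K + 1) (bsum K (slot x))) 0.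
(** Coefficient [r] counts the slots with [r] colours set, the one of bound sum
    [b] with weight [(K + 1) ^ b]. *)
Definition coefs (K L : A) : A :=
  mkseq (K + 1) (fun r => sum (len L) (fun i => weight K r (el L i))).

Lemma comp2_setcount : comp2 setcount. Proof. unfold comp2, setcount. comp. Qed.
Lemma comp2_bsum : comp2 bsum. Proof. pose proof comp1_bb. unfold comp2, bsum. comp. Qed.
Lemma comp3_weight : comp3 weight.
Proof. pose proof comp2_setcount. pose proof comp2_bsum. pose proof comp1_slot. unfold comp3, weight. comp. Qed.
Lemma comp2_coefs : comp2 coefs.
Proof. pose proof comp3_weight. unfold comp2, coefs. comp. Qed.

Lemma setcount_comp1 q : comp1 (fun d => ite (el q d = 0) 0 1).
Proof. unfold comp1. comp. Qed.
Lemma bsum_comp1 q : comp1 (fun d => ite (el q d = 0) 0 (bb (el q d))).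
Proof. pose proof comp1_bb. unfold comp1. comp. Qed.
Lemma weight_comp1 K r L : comp1 (fun i => weight K r (el L i)).
Proof. pose proof comp3_weight. unfold comp1. comp. Qed.

Lemma setcount_le K q : le (setcount K q) K.
Proof.
  enough (H : le (setcount K q) (sum K (fun _ => 1))) by (rewrite sum_const in H; mlia).
  apply sum_le; [apply setcount_comp1|apply comp1_const|]. intros i _.
  destruct (classic (el q i = 0)); [rewrite ite_true by assumption|rewrite ite_false by assumption]; mlia.
Qed.

Lemma el_coefs K L l r : Is_seq L l -> r < K + 1 -> el (coefs K L) r = sum l (fun i => weight K r (el L i)).
Proof.
  intros HL Hr. unfold coefs. rewrite el_mkseq.
  - now rewrite (len_eq L l HL).
  - pose proof comp3_weight. unfold comp1. comp.
  - exact Hr.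
Qed.

(** * Slots after a call *)

Definition upslot (K c q : A) : A :=
  mkseq K (fun d => ite (el q d = 0) 0 (entry (cmp (rr (el q d)) (c + 1)) (bb (el q d)))).

Lemma upslot_comp1 c q : comp1 (fun d => ite (el q d = 0) 0 (entry (cmp (rr (el q d)) (c + 1)) (bb (el q d)))).
Proof. pose proof comp2_entry. pose proof comp1_rr. pose proof comp1_bb. unfold comp1. comp. Qed.

Lemma comp3_upslot : comp3 upslot.
Proof. pose proof comp2_entry. pose proof comp1_rr. pose proof comp1_bb. unfold comp3, upslot. comp. Qed.

Lemma el_upslot_unset (K c q d : A) : d < K -> el q d = 0 -> el (upslot K c q) d = 0.
Proof. intros Hd H. unfold upslot. rewrite el_mkseq by (apply upslot_comp1 || exact Hd). now rewrite ite_true. Qed.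

Lemma el_upslot_set (K c q d : A) : d < K -> ~ el q d = 0 ->
  el (upslot K c q) d = entry (cmp (rr (el q d)) (c + 1)) (bb (el q d)).
Proof. intros Hd H. unfold upslot. rewrite el_mkseq by (apply upslot_comp1 || exact Hd). now rewrite ite_false. Qed.

Lemma el_upslot_neq0 (K c q d : A) : d < K -> (~ el (upslot K c q) d = 0 <-> ~ el q d = 0).
Proof.
  intros Hd. destruct (classic (el q d = 0)) as [E|E].
  - rewrite el_upslot_unset by assumption. tauto.
  - rewrite el_upslot_set by assumption. split; [tauto|]. intros _. apply entry_neq0.
Qed.

Lemma setcount_upslot K c q : setcount K (upslot K c q) = setcount K q.
Proof.
  apply sum_ext; try apply setcount_comp1. intros d Hd. destruct (classic (el q d = 0)) as [E|E].
  - rewrite el_upslot_unset by assumption. now rewrite E.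
  - rewrite el_upslot_set by assumption. rewrite !ite_false; auto. apply entry_neq0.
Qed.

Lemma bsum_upslot K c q : bsum K (upslot K c q) = bsum K q.
Proof.
  apply sum_ext; try apply bsum_comp1. intros d Hd. destruct (classic (el q d = 0)) as [E|E].
  - rewrite el_upslot_unset by assumption. now rewrite E, !ite_true.
  - rewrite el_upslot_set by assumption. rewrite !ite_false, bb_entry; auto. apply entry_neq0.
Qed.

Definition newslot (K c v q d0 : A) : A :=
  mkseq K (fun d => ite (d = d0) (entry 0 (el v (loop d0))) (el (upslot K c q) d)).

Lemma newslot_comp1 K c v q d0 : comp1 (fun d => ite (d = d0) (entry 0 (el v (loop d0))) (el (upslot K c q) d)).
Proof. unfold comp1. comp. Qed.

Lemma comp_newslot K c v q : comp1 (newslot K c v q).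
Proof. pose proof comp2_entry. pose proof comp1_loop. unfold comp1, newslot. comp. Qed.

Lemma el_newslot_same (K c v q d : A) : d < K -> el (newslot K c v q d) d = entry 0 (el v (loop d)).
Proof. intros Hd. unfold newslot. rewrite el_mkseq by (apply newslot_comp1 || exact Hd). now rewrite ite_true. Qed.

Lemma el_newslot_other (K c v q d d' : A) : d' < K -> d' <> d -> el (newslot K c v q d) d' = el (upslot K c q) d'.
Proof. intros Hd N. unfold newslot. rewrite el_mkseq by (apply newslot_comp1 || exact Hd). now rewrite ite_false. Qed.

Lemma setcount_newslot K c v q d : d < K ->
  setcount K (newslot K c v q d) + ite (el q d = 0) 0 1 = setcount K q + 1.
Proof.
  intros Hd. rewrite <- (setcount_upslot K c q). unfold setcount.
  pose proof (sum_update K d _ _ (setcount_comp1 (newslot K c v q d)) (setcount_comp1 (upslot K c q))) as U.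
  cbv beta in U. rewrite el_newslot_same in U by exact Hd.
  rewrite (ite_false (entry 0 (el v (loop d)) = 0)) in U by apply entry_neq0.
  replace (ite (el q d = 0) 0 1) with (ite (el (upslot K c q) d = 0) 0 1).
  - apply U; [|exact Hd]. intros i Hi N. now rewrite el_newslot_other.
  - destruct (classic (el q d = 0)) as [E|E].
    + rewrite el_upslot_unset by assumption. now rewrite E.
    + rewrite el_upslot_set by assumption. rewrite !ite_false; auto. apply entry_neq0.
Qed.

Lemma bsum_newslot K c v q d : d < K -> ~ el q d = 0 ->
  bsum K (newslot K c v q d) + bb (el q d) = bsum K q + el v (loop d).
Proof.
  intros Hd E. rewrite <- (bsum_upslot K c q). unfold bsum.
  pose proof (sum_update K d _ _ (bsum_comp1 (newslot K c v q d)) (bsum_comp1 (upslot K c q))) as U.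
  cbv beta in U. rewrite el_newslot_same, el_upslot_set in U by assumption.
  rewrite !(ite_false (entry _ _ = 0)), !bb_entry in U by apply entry_neq0.
  apply U; [|exact Hd]. intros i Hi N. now rewrite el_newslot_other.
Qed.

Lemma pow_pos b n : 0 < pow (b + 1) n.
Proof.
  revert n. ind1; [sigma| |].
  - rewrite pow_0. mlia.
  - intros n IH. rewrite pow_succ. mnia.
Qed.

Lemma pow_le b n m : le n m -> le (pow (b + 1) n) (pow (b + 1) m).
Proof.
  intros H. unfold le in H. apply lt_iff in H as [k Hk]. assert (m = n + k) as -> by mlia. clear Hk.
  unfold le. revert k. ind1; [sigma| |].
  - rewrite add_0_r. mlia.
  - intros k IH. rewrite add_succ_r, pow_succ. mnia.
Qed.

(** At most [K] nonzero terms, each at most the power with exponent [B - 1]. The induction bounds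
    the sum multiplied by [K + 1], which avoids the predecessor of [B]. *)
Lemma sum_lt_pow (K B : A) (f : A -> A) : comp1 f ->
  (forall d, d < K -> f d = 0 \/ exists b, b < B /\ f d = pow (K + 1) b) -> sum K f < pow (K + 1) B.
Proof.
  intros Hf H.
  assert (Q : forall k, k < K + 1 -> sum k f * (K + 1) < k * pow (K + 1) B + 1).
  { ind1; [sigma| |].
    - intros _. rewrite sum_0 by exact Hf. mlia.
    - intros k IH L. rewrite sum_succ by exact Hf. specialize (IH ltac:(mlia)).
      assert (Hk : le (f k * (K + 1)) (pow (K + 1) B)).
      { destruct (H k ltac:(mlia)) as [->|(b & Lb & ->)]; [mlia|]. rewrite <- pow_succ. apply pow_le. mlia. }
      mlia. }
  specialize (Q K ltac:(mlia)). pose proof (pow_pos K B) as Hp.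
  destruct (classic (sum K f < pow (K + 1) B)) as [L|L]; [exact L|exfalso].
  assert (E : exists t, sum K f = pow (K + 1) B + t).
  { destruct (lt_total (pow (K + 1) B) (sum K f)) as [L'|[->|L']]; [|exists 0; mlia|tauto].
    apply lt_iff in L' as [t Ht]. eauto. }
  destruct E as [t E]. rewrite E in Q. revert Q Hp. generalize (pow (K + 1) B). intros p Q Hp. mnia.
Qed.

(** The composite grows on the right by the graph of a call, so it stays in the closure. An arc of
    the new composite from [loop d] factors into an arc of the old one, which bounds an old
    argument, and an arc of [G], which compares it with a new argument. *)
Lemma Entry_ok_update (P N D CS f g u v d y G tau : A) :
  Is_seq P N -> (forall c, Fin_in c CS <-> Col P c) ->
  Is_graph P f g G -> Call P f tau g -> Assigns D f tau G ->
  (forall x z, Strict_arc G x z -> el v z < el u x) -> (forall x z, Weak_arc G x z -> le (el v z) (el u x)) ->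
  Entry_ok P D CS f u d y -> Entry_ok P D CS g v d (entry (cmp (rr y) (colour f g G + 1)) (bb y)).
Proof.
  intros HP HCS HG HC HA HS HW [H1 H2].
  assert (Gcol : Fin_in (colour f g G) CS) by (apply HCS; exists f, g, G; auto).
  unfold Entry_ok. rewrite rr_entry, bb_entry. split.
  - right. destruct H1 as [->|(c & -> & Hc & Hcl & Ht)].
    + exists (colour f g G). rewrite cmp_0_l, src_colour, tgt_colour, gr_colour.
      split; [reflexivity|]. split; [exact Gcol|]. split; [exact (closure_base P D f tau g G HC HA)|reflexivity].
    + exists (dcomp c (colour f g G)). split; [apply cmp_succ|].
      assert (Hcol : Col P (dcomp c (colour f g G))).
      { apply (Col_dcomp P N); auto; [now apply HCS|now apply HCS|]. now rewrite src_colour. }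
      split; [now apply HCS|].
      destruct Hcol as (f' & g' & G' & E & HG').
      assert (E' := E). unfold dcomp in E'.
      apply pr_inj in E' as [E' EG]. apply pr_inj in E' as [Ef Eg].
      rewrite tgt_colour in Eg. rewrite gr_colour in EG. subst f' g' G'.
      rewrite E, src_colour, tgt_colour, gr_colour. split; [|reflexivity].
      rewrite Ht in Hcl. exact (closure_comp P D (src c) f tau g (gr c) G Hcl HC HA HG').
  - intros Hl. specialize (H2 Hl) as [H2 H3]. split.
    + destruct H1 as [->|(c & -> & _)]; [rewrite cmp_0_l|rewrite cmp_succ]; intros; mlia.
    + intros c' _ E z _. destruct H1 as [E0|(c & E0 & _)].
      * rewrite E0, cmp_0_l in E. assert (c' = colour f g G) as -> by mlia. rewrite gr_colour.
        specialize (H2 E0). split; intros Q; [apply HS in Q|apply HW in Q]; mlia.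
      * rewrite E0, cmp_succ in E. assert (c' = dcomp c (colour f g G)) as -> by mlia.
        assert (B : forall x, (Strict_arc (gr c) (loop d) x -> el u x < bb y) /\ (Weak_arc (gr c) (loop d) x -> le (el u x) (bb y))).
        { intros x. split; intros Q; apply (H3 c); auto; (mlia || exact (proj2 (arc_lt _ _ _ _ Q))). }
        unfold dcomp. rewrite !gr_colour. split.
        -- intros Q. apply Strict_gcomp, Strict_path_iff in Q as (x & [[Q1 [Q2|Q2]]|[Q1 Q2]]);
             apply B in Q1; first [apply HS in Q2|apply HW in Q2]; mlia.
        -- intros Q. apply Weak_gcomp in Q as [Q _]. apply Weak_path_iff in Q as (x & Q1 & Q2).
           apply B in Q1. apply HW in Q2. mlia.
Qed.

(** The slot [i0] is replaced with its children, one for each colour [d], unless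
    [d] is set and has no loop. *)
Definition next (K c v L l i0 : A) : A :=
  mkseq (l + K) (fun i =>
    ite (i < l)
      (ite (i = i0 \/ el L i = 0) 0 (upslot K c (slot (el L i)) + 1))
      (ite (el (slot (el L i0)) (sub i l) = 0 \/ has_loop (sub i l))
         (newslot K c v (slot (el L i0)) (sub i l) + 1) 0)).

Section Next.
Context (K c v L l i0 : A).

Lemma next_comp1 : comp1 (fun i =>
    ite (i < l)
      (ite (i = i0 \/ el L i = 0) 0 (upslot K c (slot (el L i)) + 1))
      (ite (el (slot (el L i0)) (sub i l) = 0 \/ has_loop (sub i l))
         (newslot K c v (slot (el L i0)) (sub i l) + 1) 0)).
Proof.
  pose proof comp3_upslot. pose proof comp1_slot. pose proof delta1_has_loop.
  pose proof (comp_newslot K c v (slot (el L i0))) as Q. unfold comp1.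
  apply (comp_ite (fun e => e 0%nat < l)); [delta|comp|].
  apply (comp_ite (fun e => el (slot (el L i0)) (sub (e 0%nat) l) = 0 \/ has_loop (sub (e 0%nat) l))); [delta| |comp].
  apply (comp_app2 (@add A)); [defn| |comp].
  apply (comp_app1 (newslot K c v (slot (el L i0)))); [exact Q|comp].
Qed.

Lemma next_seq : Is_seq (next K c v L l i0) (l + K).
Proof. apply mkseq_seq, next_comp1. Qed.

Lemma el_next_old i : i < l -> i <> i0 -> ~ el L i = 0 ->
  el (next K c v L l i0) i = upslot K c (slot (el L i)) + 1.
Proof.
  intros Hi N E. unfold next. rewrite el_mkseq; [|apply next_comp1|].
  - rewrite ite_true by exact Hi. rewrite ite_false by tauto. reflexivity.
  - apply lt_iff in Hi as [t ->]. apply lt_iff. exists (t + K). rewrite <- !add_assoc. f_equal. f_equal. apply add_comm.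
Qed.

Lemma el_next_dead i : i < l -> (i = i0 \/ el L i = 0) -> el (next K c v L l i0) i = 0.
Proof.
  intros Hi E. unfold next. rewrite el_mkseq; [|apply next_comp1|].
  - rewrite ite_true by exact Hi. now rewrite ite_true.
  - apply lt_iff in Hi as [t ->]. apply lt_iff. exists (t + K). rewrite <- !add_assoc. f_equal. f_equal. apply add_comm.
Qed.

Lemma el_next_add d : d < K -> el (next K c v L l i0) (l + d) =
  ite (el (slot (el L i0)) d = 0 \/ has_loop d) (newslot K c v (slot (el L i0)) d + 1) 0.
Proof.
  intros Hd. unfold next. rewrite el_mkseq; [|apply next_comp1|].
  - rewrite ite_false; [now rewrite sub_add|]. intros H. apply lt_iff in H as [t H].
    apply (succ_neq0 (d + t)). apply (add_cancel_r _ _ l). rewrite add_0_l. etransitivity; [|symmetry; exact H].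
    rewrite (add_comm _ l). now rewrite <- !add_assoc.
  - apply lt_iff in Hd as [t ->]. apply lt_iff. exists t. now rewrite <- !add_assoc.
Qed.
End Next.

(** * Histories and their ranks *)

Definition Hist (K P D CS f u L : A) : Prop :=
  exists l, Is_seq L l /\ Cover K CS f L l /\ Slots_ok K P D CS f u L l.

(** Frames store only the coefficients. The history [L] is quantified away, and with colours given
    by the finite set [CS] the relation is Sigma01, as the machine needs. *)
Definition Rank (K P D CS f u m : A) : Prop :=
  exists L, Hist K P D CS f u L /\ m = coefs K L.

Lemma sigma_Rank K P D CS : sigma3 (Rank K P D CS).
Proof.
  pose proof delta3_Matches. pose proof comp1_slot. pose proof comp1_rr. pose proof comp1_bb.
  pose proof delta1_has_loop. pose proof comp1_loop. pose proof comp2_coefs.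
  unfold sigma3, Rank, Hist, Cover, Slots_ok, Entry_ok, le. sigma.
Qed.

(** A colour [c'] to come is covered by the slot that covered [dcomp c c'] before the call, by
    associativity. If that is the dead slot [i0], its child for [c'] takes over: there [c'] has the
    empty composite, so it is completed by [c'] itself. ISCT ensures that this child exists. *)
Lemma Hist_next (K P N D CS f g u v tau G L l i0 : A) :
  Is_seq P N -> (forall c, Fin_in c CS <-> Col P c) -> (forall c, Fin_in c CS -> c < K) ->
  Isct P D -> Is_graph P f g G -> Call P f tau g -> Assigns D f tau G ->
  (forall x z, Strict_arc G x z -> el v z < el u x) -> (forall x z, Weak_arc G x z -> le (el v z) (el u x)) ->
  Is_seq L l -> Cover K CS f L l -> Slots_ok K P D CS f u L l ->
  i0 < l -> ~ el L i0 = 0 -> Matches K (slot (el L i0)) (colour f g G + 1) ->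
  Hist K P D CS g v (next K (colour f g G) v L l i0).
Proof.
  intros HP HCS HK HI HG HC HA HS HW HL HCov HOk Hi0 Ha0 HM.
  pose (c := colour f g G). pose (L' := next K c v L l i0). fold c in HM. fold c L'.
  assert (Gcol : Fin_in c CS) by (apply HCS; exists f, g, G; auto).
  assert (Upd : forall i d, i < l -> ~ el L i = 0 -> d < K -> ~ el (slot (el L i)) d = 0 ->
    Entry_ok P D CS g v d (el (upslot K c (slot (el L i))) d)).
  { intros i d Hi Ei Hd Ed. rewrite el_upslot_set by assumption.
    apply (Entry_ok_update P N D CS f g u v d _ G tau); auto. }
  exists (l + K). split; [apply next_seq|]. split.
  - intros c' Hc' Hcol' Hsrc.
    assert (Hcc : Fin_in (dcomp c c') CS).
    { apply HCS. apply (Col_dcomp P N); auto; [now apply HCS|now apply HCS|]. unfold c. now rewrite tgt_colour. }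
    destruct (HCov (dcomp c c')) as (i & Hi & Ei & Mi); [now apply HK|exact Hcc| |].
    { unfold dcomp. rewrite src_colour. apply src_colour. }
    assert (Mup : forall d, d < K -> ~ el (slot (el L i)) d = 0 ->
      cmp (cmp (rr (el (slot (el L i)) d)) (c + 1)) (c' + 1) = d + 1).
    { intros d Hd Ed. rewrite cmp_assoc, cmp_succ. now apply Mi. }
    destruct (classic (i = i0)) as [->|Ni].
    + exists (l + c'). split; [mlia|]. unfold L'. rewrite el_next_add by exact Hc'.
      assert (Hal : el (slot (el L i0)) c' = 0 \/ has_loop c').
      { destruct (classic (el (slot (el L i0)) c' = 0)) as [E|E]; [now left|right].
        (* [c'] is set and completed by [c], and also by [c] followed by [c'] *)
        assert (Idem : dcomp c' c' = c').
        { pose proof (Mup c' Hc' E) as Q. rewrite (HM c' Hc' E), cmp_succ in Q. mlia. }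
        (* The composite stored in the updated entry of [c'] is now [c'] itself; hence [c'] is in
           the closure, and being idempotent it has a loop by ISCT. *)
        destruct (proj1 (Upd i0 c' Hi0 Ha0 Hc' E)) as [R0|(c'' & R0 & _ & Hcl & Ht)];
          rewrite el_upslot_set, rr_entry, (HM c' Hc' E) in R0 by assumption; [exfalso; mlia|].
        assert (c'' = c') as -> by mlia.
        destruct (HI g (gr c')) as [x Hx].
        - rewrite Hsrc, Ht in Hcl. exact Hcl.
        - rewrite <- Idem at 3. unfold dcomp. rewrite gr_colour. apply gcomp_composition.
        - exact (has_loop_intro _ _ Hx). }
      rewrite ite_true by exact Hal. split; [mlia|]. rewrite slot_succ.
      intros d Hd Ed. destruct (classic (d = c')) as [->|Nd].
      * rewrite el_newslot_same by assumption. now rewrite rr_entry, cmp_0_l.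
      * rewrite el_newslot_other in * by assumption. apply el_upslot_neq0 in Ed; [|assumption].
        rewrite el_upslot_set, rr_entry by assumption. now apply Mup.
    + exists i. split; [mlia|]. unfold L'. rewrite el_next_old by assumption. split; [mlia|].
      rewrite slot_succ. intros d Hd Ed. apply el_upslot_neq0 in Ed; [|assumption].
      rewrite el_upslot_set, rr_entry by assumption. now apply Mup.
  - intros i Hi Ei d Hd Ed. unfold L' in *. destruct (classic (i < l)) as [Li|Li].
    + destruct (classic (i = i0 \/ el L i = 0)) as [Q|Q]; [now rewrite el_next_dead in Ei|].
      assert (Q1 : i <> i0) by tauto. assert (Q2 : ~ el L i = 0) by tauto.
      rewrite el_next_old, slot_succ in * by assumption. apply el_upslot_neq0 in Ed; [|assumption]. now apply Upd.
    + assert (E : exists d0, i = l + d0 /\ d0 < K).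
      { destruct (lt_total l i) as [Q|[<-|Q]]; [|exists 0; split; mlia|tauto].
        apply lt_iff in Q as [t ->]. exists (t + 1). split; mlia. }
      destruct E as (d0 & -> & Hd0). rewrite el_next_add in * by exact Hd0.
      destruct (classic (el (slot (el L i0)) d0 = 0 \/ has_loop d0)) as [Q|Q]; [|now rewrite ite_false in Ei].
      rewrite ite_true, slot_succ in * by exact Q.
      destruct (classic (d = d0)) as [->|Nd].
      * rewrite el_newslot_same by assumption. unfold Entry_ok. rewrite rr_entry, bb_entry.
        split; [now left|]. intros _. split; [intros _; mlia|]. intros c0 Hc0. mlia.
      * rewrite el_newslot_other in * by assumption. apply el_upslot_neq0 in Ed; [|assumption]. now apply Upd.
Qed.

(** The decreasing coordinate is the number [r0] of colours set in the dead slot. Surviving slots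
    keep their count and their bounds. A child that sets an unset colour counts for [r0 + 1]; the
    others count for [r0] with a smaller sum of bounds, so together they weigh less than the dead
    slot. *)
Lemma Lex_lt_next (K P D CS f g u v G L l i0 : A) :
  (forall x z, Strict_arc G x z -> el v z < el u x) -> (forall x z, Weak_arc G x z -> le (el v z) (el u x)) ->
  Is_seq L l -> Slots_ok K P D CS f u L l -> i0 < l -> ~ el L i0 = 0 ->
  Matches K (slot (el L i0)) (colour f g G + 1) ->
  Lex_lt K (coefs K (next K (colour f g G) v L l i0)) (coefs K L).
Proof.
  intros HS HW HL HOk Hi0 Ha0 HM.
  pose (c := colour f g G). pose (L' := next K c v L l i0). fold c in HM. fold c L'.
  pose (q0 := slot (el L i0)). fold q0 in HM.
  assert (HL' : Is_seq L' (l + K)) by apply next_seq.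
  (* The stored composite followed by the call is [d], whose loop is strict; so the new value of the
     argument [loop d] is below the bound stored when [d] was set. *)
  assert (Ln : forall d, d < K -> ~ el q0 d = 0 -> has_loop d -> el v (loop d) < bb (el q0 d)).
  { intros d Hd Ed Hl. destruct (HOk i0 Hi0 Ha0 d Hd Ed) as [H1 H2]. fold q0 in H1, H2.
    specialize (H2 Hl) as [H2 H3]. pose proof (HM d Hd Ed) as E. pose proof (loop_arc d Hl) as Q.
    destruct H1 as [R|(c1 & R & _)].
    - rewrite R, cmp_0_l in E. assert (Ed' : d = c) by mlia.
      assert (Egr : gr d = G) by (rewrite Ed'; apply gr_colour).
      specialize (H2 R). rewrite Egr in Q. apply HS in Q. mlia.
    - rewrite R, cmp_succ in E. assert (Ed' : d = dcomp c1 c) by mlia.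
      assert (Egr : gr d = gcomp (gr c1) G) by (rewrite Ed'; unfold dcomp, c; now rewrite !gr_colour).
      rewrite Egr in Q.
      apply Strict_gcomp, Strict_path_iff in Q as (x & Q).
      assert (B : (Strict_arc (gr c1) (loop d) x -> el u x < bb (el q0 d)) /\ (Weak_arc (gr c1) (loop d) x -> le (el u x) (bb (el q0 d)))).
      { split; intros Q'; apply (H3 c1); auto; (mlia || exact (proj2 (arc_lt _ _ _ _ Q'))). }
      destruct Q as [[Q1 [Q2|Q2]]|[Q1 Q2]]; apply B in Q1; first [apply HS in Q2|apply HW in Q2]; mlia. }
  pose (r0 := setcount K q0).
  assert (Wold : forall r i, i < l -> i <> i0 -> weight K r (el L' i) = weight K r (el L i)).
  { intros r i Hi N. unfold L'. destruct (classic (el L i = 0)) as [E|E].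
    - rewrite el_next_dead by auto. now rewrite E.
    - rewrite el_next_old by assumption. unfold weight. rewrite slot_succ, setcount_upslot, bsum_upslot.
      destruct (classic (setcount K (slot (el L i)) = r)) as [Q|Q].
      + rewrite !ite_true; auto. split; [mlia|exact Q].
      + rewrite !ite_false; tauto. }
  assert (W0 : forall x r, x = 0 -> weight K r x = 0) by (intros x r E; unfold weight; rewrite ite_false; tauto).
  assert (Wdead : forall r, weight K r (el L' i0) = 0).
  { intros r. apply W0. unfold L'. apply el_next_dead; auto. }
  (* Without subtraction: in each coordinate, the weight of the dead slot is exchanged for the
     weights of its children. *)
  assert (Split : forall r, sum (l + K) (fun i => weight K r (el L' i)) + weight K r (el L i0) =
    sum l (fun i => weight K r (el L i)) + sum K (fun d => weight K r (el L' (l + d)))).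
  { intros r. rewrite sum_append by apply weight_comp1.
    pose proof (sum_update l i0 _ _ (weight_comp1 K r L') (weight_comp1 K r L) (Wold r) Hi0) as U.
    cbv beta in U. rewrite Wdead in U. mlia. }
  assert (Cadd : forall r, comp1 (fun d => weight K r (el L' (l + d)))).
  { intros r. pose proof comp3_weight. unfold comp1. comp. }
  exists r0. split; [unfold r0; apply setcount_le|]. split.
  - intros r Hr. assert (Hr' : r < K + 1) by (pose proof (setcount_le K q0); unfold r0 in Hr; mlia).
    rewrite (el_coefs K L' _ r HL' Hr'), (el_coefs K L l r HL Hr').
    specialize (Split r). unfold weight at 2 in Split. rewrite ite_false in Split.
    2: { fold q0 r0. intros [_ E]. mlia. }
    enough (Z : sum K (fun d => weight K r (el L' (l + d))) = 0) by (rewrite Z in Split; mlia).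
    transitivity (sum K (fun _ => 0)); [|rewrite sum_const; mlia].
    apply sum_ext; [apply Cadd|apply comp1_const|]. intros d Hd. unfold L'. rewrite el_next_add by exact Hd. fold q0.
    destruct (classic (el q0 d = 0 \/ has_loop d)) as [Q|Q]; [rewrite ite_true by exact Q|rewrite ite_false by exact Q; now apply W0].
    unfold weight. rewrite slot_succ, ite_false; [reflexivity|]. intros [_ E].
    pose proof (setcount_newslot K c v q0 d Hd) as C. rewrite E in C. fold r0 in C.
    destruct (classic (el q0 d = 0)) as [Z|Z]; [rewrite ite_true in C by exact Z|rewrite ite_false in C by exact Z]; mlia.
  - assert (Hr' : r0 < K + 1) by apply setcount_le.
    rewrite (el_coefs K L' _ r0 HL' Hr'), (el_coefs K L l r0 HL Hr').
    specialize (Split r0). unfold weight at 2 in Split. rewrite ite_true in Split by auto. fold q0 in Split.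
    enough (Z : sum K (fun d => weight K r0 (el L' (l + d))) < pow (K + 1) (bsum K q0)) by mlia.
    apply sum_lt_pow; [apply Cadd|]. intros d Hd. unfold L'. rewrite el_next_add by exact Hd. fold q0.
    destruct (classic (el q0 d = 0 \/ has_loop d)) as [Q|Q]; [rewrite ite_true by exact Q|left; rewrite ite_false by exact Q; now apply W0].
    unfold weight. rewrite slot_succ.
    pose proof (setcount_newslot K c v q0 d Hd) as C. fold r0 in C.
    destruct (classic (el q0 d = 0)) as [Z|Z].
    + rewrite ite_true in C by exact Z. left. rewrite ite_false; [reflexivity|]. intros [_ E]. rewrite E in C. mlia.
    + rewrite ite_false in C by exact Z. assert (Hl : has_loop d) by tauto.
      right. exists (bsum K (newslot K c v q0 d)). split.
      * pose proof (bsum_newslot K c v q0 d Hd Z). pose proof (Ln d Hd Z Hl). mlia.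
      * rewrite ite_true; [reflexivity|]. split; mlia.
Qed.

(** A single slot with no colour set matches every composite vacuously, so it is a cover by
    itself. *)
Lemma Rank_init K P D CS : rank_init P (Rank K P D CS).
Proof.
  intros n e u _ _. pose (q := mkseq K (fun _ => 0)). pose (L := snoc (mkseq 0 (fun _ => 0)) 0 (q + 1)).
  assert (E : el L 0 = q + 1) by apply el_snoc_new.
  assert (Eq : forall d, d < K -> el q d = 0) by (intros d Hd; apply (el_mkseq K (fun _ => 0)); [apply comp1_const|exact Hd]).
  exists (coefs K L), L. split; [|reflexivity]. exists (0 + 1). split; [apply snoc_seq|]. split.
  - intros c _ _ _. exists 0. split; [mlia|]. rewrite E. split; [mlia|]. rewrite slot_succ.
    intros d Hd N. destruct N. auto.
  - intros i Hi _ d Hd N. assert (i = 0) as -> by mlia. rewrite E, slot_succ in N. destruct N. auto.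
Qed.

(** The cover, applied to the colour of the call itself, yields the slot that the call completes;
    this slot is killed. *)
Lemma Rank_descent I K P N D CS : Is_seq P N -> (forall c, Fin_in c CS <-> Col P c) ->
  (forall c, Fin_in c CS -> c < K) -> Is_description P D -> Safe I P D -> Isct P D ->
  rank_descent I P K (Rank K P D CS).
Proof.
  intros HP HCS HK HD HSafe HI f u m tau g v n e k e' (L & (l & HL & HCov & HOk) & ->) He Hu He' Hv HC HT.
  destruct (HD f tau g HC) as [(G & HA & _) HG]. specialize (HG G HA).
  destruct (HSafe f tau g G u v HC HA HT) as [HS HW].
  assert (ES : forall x z, Strict_arc G x z -> el v z < el u x).
  { intros x z Q. destruct (HS x z Q) as (a & b & Ha & Hb & Lt).
    apply (Nth_el u n) in Ha; [|exact Hu|exact (Nth_bound _ _ _ _ Hu Ha)].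
    apply (Nth_el v k) in Hb; [|exact Hv|exact (Nth_bound _ _ _ _ Hv Hb)]. now subst. }
  assert (EW : forall x z, Weak_arc G x z -> le (el v z) (el u x)).
  { intros x z Q. destruct (HW x z Q) as (a & b & Ha & Hb & Lt).
    apply (Nth_el u n) in Ha; [|exact Hu|exact (Nth_bound _ _ _ _ Hu Ha)].
    apply (Nth_el v k) in Hb; [|exact Hv|exact (Nth_bound _ _ _ _ Hv Hb)]. subst.
    destruct Lt as [Lt|Lt]; mlia. }
  assert (Gcol : Fin_in (colour f g G) CS) by (apply HCS; exists f, g, G; auto).
  destruct (HCov (colour f g G) (HK _ Gcol) Gcol (src_colour f g G)) as (i0 & Hi0 & Ha0 & HM).
  exists (coefs K (next K (colour f g G) v L l i0)). split.
  - exists (next K (colour f g G) v L l i0). split; [|reflexivity].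
    apply (Hist_next K P N D CS f g u v tau G L l i0); assumption.
  - apply (Lex_lt_next K P D CS f g u v G L l i0); assumption.
Qed.

Theorem soundness : @Wo_omega_tower A 3 -> @Isct_soundness A.
Proof.
  intros HWo I HI P D HPr HD HSafe HIsct. pose proof HPr as (N & HP & _).
  destruct (Col_bound P) as [K HK].
  (* [Col] is only Sigma01, but occurs as a premise in [Cover]; the finite set [CS] replaces it
     there. *)
  destruct (bounded_comprehension (Col P) K (Col_sigma P)) as (CS & _ & HCS').
  assert (HCS : forall c, Fin_in c CS <-> Col P c).
  { intros c. rewrite HCS'. split; [tauto|]. intros H. split; [auto|exact H]. }
  apply (machine I P K (Rank K P D CS) HWo HI HPr).
  - apply sigma_Rank.
  - apply Rank_init.
  - apply (Rank_descent I K P N D CS); auto. intros c Hc. apply HK. now apply HCS.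
Qed.

End Slots.

Theorem theorem5p1 :
  provable RCA0 (sentence (f_imp (WO_omega_tower 3) ISCT_soundness)).
Proof. apply provable_of_models. intros A. exact soundness. Qed.
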